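(* Let $Y$ be any of the spaces $\mathcal{LM}$, $\mathcal L L^1$, $\mathcal{LM}_d$, $\mathcal{LM}_s$, $\mathcal R_0$, $\mathcal J_0$. Then the closure of $Y$ in $\mathcal B$ with respect to the $\mathcal B$-norm coincides with the closure of $Y$ in $\mathcal B$ with respect to the sup norm $\|\cdot\|_\infty$. Moreover, if $Y$ is any of $\mathcal LL^1$, $\mathcal R_0$, $\mathcal J_0$, then the closure of $Y$ in $\mathcal B$ (for the $\mathcal B$-norm) is $\mathcal B\cap C_0(\overline{\mathbb C}_+)$.
   Context: $\mathbb C_+=\{z:\Re z>0\}$. $\mathcal B$ is the space of holomorphic $f$ on $\mathbb C_+$ with $\|f\|_{\mathcal B_0}:=\int_0^\infty\sup_{\beta\in\mathbb R}|f'(\alpha+i\beta)|\,d\alpha<\infty$; such $f$ are bounded and extend continuously to $\overline{\mathbb C}_+$; norm $\|f\|_{\mathcal B}=\|f\|_\infty+\|f\|_{\mathcal B_0}$. For a set $\mathcal N$ of bounded Borel measures on $\mathbb R_+=[0,\infty)$, $\mathcal{LN}=\{\mathcal L\mu:\mu\in\mathcal N\}$ with $\mathcal L\mu(z)=\int e^{-zt}d\mu(t)$; $M=M(\mathbb R_+)$ is all bounded Borel measures, $L^1$ the absolutely continuous ones, $M_d$ the discrete ones, $M_s$ the singular non-atomic ones. It is known that $\mathcal{LM}\subset\mathcal B$. $\mathcal R_0$ is the space of rational functions vanishing at infinity with no poles in $\overline{\mathbb C}_+$; $\mathcal J_0$ is the space of entire functions of exponential type belonging to $H^\infty(\mathbb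 C_+)\cap C_0(\overline{\mathbb C}_+)$. $C_0(\overline{\mathbb C}_+)$ denotes continuous functions on $\overline{\mathbb C}_+$ tending to $0$ as $|z|\to\infty$. *)

(* Defs.v *)
From HB Require Import structures.
From mathcomp Require Import all_boot all_order all_algebra.
From mathcomp Require Import all_classical all_reals all_analysis.
From mathcomp Require Export complex.
Import Order.TTheory GRing.Theory Num.Theory.
Import numFieldNormedType.Exports.

Set Implicit Arguments.
Unset Strict Implicit.
Unset Printing Implicit Defensive.

Local Open Scope ring_scope.
Local Open Scope classical_set_scope.

Section Defs.
Variable R : realType.

Notation Cn := ((R[i] : numFieldType)^o).

Definition cabs (z : R[i]) : R := ComplexField.Normc.normc z.

Definition Cplus : set R[i] := [set z | 0 < complex.Re z].

Definition holo (f : R[i] -> R[i]) : Prop :=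
  forall z : R[i], 0 < complex.Re z -> derivable (f : Cn -> Cn) (z : Cn) 1.

Definition Rpos : set R := `]0, +oo[%classic.

Definition B0norm (f : R[i] -> R[i]) : \bar R :=
  (\int[@lebesgue_measure R]_(a in Rpos)
     ereal_sup [set (cabs ('D_1 (f : Cn -> Cn) ((a +i* b)%C : Cn)))%:E
               | b in [set: R]])%E.

Definition supn (f : R[i] -> R[i]) : \bar R :=
  ereal_sup [set (cabs (f z))%:E | z in Cplus].

Definition Bnorm (f : R[i] -> R[i]) : \bar R := (supn f + B0norm f)%E.

Definition Bspace : set (R[i] -> R[i]) :=
  [set f | holo f /\ (B0norm f < +oo)%E].

Definition closB (Y : set (R[i] -> R[i])) : set (R[i] -> R[i]) :=
  [set f | Bspace f /\ forall e : R, 0 < e ->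
     exists2 g, Y g & (Bnorm (fun z => (f z - g z)%R) < e%:E)%E].

Definition closInf (Y : set (R[i] -> R[i])) : set (R[i] -> R[i]) :=
  [set f | Bspace f /\ forall e : R, 0 < e ->
     exists2 g, Y g & (supn (fun z => (f z - g z)%R) < e%:E)%E].

Definition C0cl (f : R[i] -> R[i]) : Prop :=
  exists F : R[i] -> R[i],
    [/\ {within [set z : Cn | 0 <= complex.Re (z : R[i])], continuous (F : Cn -> Cn)},
        (forall z, 0 < complex.Re z -> F z = f z) &
        (forall e : R, 0 < e -> exists M : R, forall z : R[i],
             0 <= complex.Re z -> M < cabs z -> cabs (F z) < e)].

(* bounded complex Borel measures on R_+ : mu = (m1 - m2) + i (m3 - m4)
   with m_k finite positive Borel measures on R carried by [0, +oo) *)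
Record cmeas := CMeas {
  cm1 : {finite_measure set R -> \bar R};
  cm2 : {finite_measure set R -> \bar R};
  cm3 : {finite_measure set R -> \bar R};
  cm4 : {finite_measure set R -> \bar R} }.

Definition cm_on_Rplus (mu : cmeas) : Prop :=
  [/\ cm1 mu `]-oo, 0[ = 0%E, cm2 mu `]-oo, 0[ = 0%E,
      cm3 mu `]-oo, 0[ = 0%E & cm4 mu `]-oo, 0[ = 0%E].

Definition cmval (mu : cmeas) (A : set R) : R[i] :=
  ((fine (cm1 mu A) - fine (cm2 mu A)) +i* (fine (cm3 mu A) - fine (cm4 mu A)))%C.

(* int e^{-zt} dnu(t) for a finite positive measure nu *)
Definition lapR (nu : {finite_measure set R -> \bar R}) (z : R[i]) : R[i] :=
  ((Rintegral nu `[0, +oo[ (fun t => expR (- ((complex.Re z : R) * (t : R))) * cos ((complex.Im z : R) * (t : R))))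
   +i* (- Rintegral nu `[0, +oo[ (fun t => expR (- ((complex.Re z : R) * (t : R))) * sin ((complex.Im z : R) * (t : R)))))%C.

Definition lap (mu : cmeas) (z : R[i]) : R[i] :=
  (lapR (cm1 mu) z - lapR (cm2 mu) z) + 'i%C * (lapR (cm3 mu) z - lapR (cm4 mu) z).

Definition LN (P : cmeas -> Prop) : set (R[i] -> R[i]) :=
  [set f | exists mu, [/\ cm_on_Rplus mu, P mu & f = lap mu]].

Definition Mall : cmeas -> Prop := fun _ => True.

Definition Mac (mu : cmeas) : Prop :=
  forall A : set R, measurable A -> @lebesgue_measure R A = 0%E -> cmval mu A = 0.

Definition Mdisc (mu : cmeas) : Prop :=
  exists S : set R, countable S /\
    forall A : set R, measurable A -> A `&` S = set0 -> cmval mu A = 0.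

Definition Msing (mu : cmeas) : Prop :=
  (forall t : R, cmval mu [set t] = 0) /\
  exists N : set R, [/\ measurable N, @lebesgue_measure R N = 0%E &
    forall A : set R, measurable A -> A `&` N = set0 -> cmval mu A = 0].

Definition LM := LN Mall.
Definition LL1 := LN Mac.
Definition LMd := LN Mdisc.
Definition LMs := LN Msing.

Definition R0 : set (R[i] -> R[i]) :=
  [set f | exists p q : {poly R[i]},
     [/\ (size p < size q)%N, (forall z, root q z -> complex.Re z < 0) &
         f = (fun z => p.[z] / q.[z])]].

Definition J0 : set (R[i] -> R[i]) :=
  [set f | [/\ forall z : R[i], derivable (f : Cn -> Cn) (z : Cn) 1,
     exists A B : R, forall z, cabs (f z) <= A * expR (B * cabs z),
     (supn f < +oo)%E & C0cl f]].

End Defs.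

Arguments LM R : clear implicits.
Arguments LL1 R : clear implicits.
Arguments LMd R : clear implicits.
Arguments LMs R : clear implicits.
Arguments R0 R : clear implicits.
Arguments J0 R : clear implicits.

(* Main.v *)
(* Let Y be one of the spaces and suppose f in B is within e0 of g in Y uniformly.
   The function h(z) = g(z + eps) - g(z + N) + g(+oo) is again in Y: for transforms of
   measures it amounts to multiplying the measure by e^{-eps t} - e^{-N t} and restoring
   the mass at 0, which preserves each of the four classes.  Cauchy estimates bound the
   derivative of f - g on the line Re z = a by C e0 / a, and f'(z) - f'(z + eps) by
   C eps / a^2; together with the integrability of sup_b |f'(a + ib)| near 0 and near
   infinity they make ||f - h||_B small (choose N, then eps, then e0).  Hence the two
   closures agree.

   For the second part, the Cayley transform and the Taylor expansion show that every
   f in B with a C_0 extension is a uniform limit of combinations of 1/(z + l), l > 0,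
   and 1/(z + l) is a uniform limit of elements of Y.  Conversely elements of L(L^1)
   are C_0 because densities are L^1-limits of step functions, whose transforms are
   combinations of (1 - e^{-Tz}) / z. *)
Require Import Defs.
From HB Require Import structures.
From mathcomp Require Import all_boot all_order all_algebra.
From mathcomp Require Import all_classical all_reals all_analysis measurable_realfun.
From mathcomp Require Import complex.
From mathcomp Require Import ring lra.
Import Order.TTheory GRing.Theory Num.Theory.
Import numFieldNormedType.Exports.
Set Implicit Arguments. Unset Strict Implicit. Unset Printing Implicit Defensive.
Local Open Scope ring_scope.
Local Open Scope classical_set_scope.

(** * The modulus on [R[i]] as a real number *)

Section Modulus.
Variable R : realType.
Implicit Types (x y : R) (z w : R[i]).

(** Uniform closeness of [f] and [g] bounds f' - g' on Re z = a only by a multiple of 1/a, which is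
    integrable neither near 0 nor near infinity. Both shifts answer this: the shift by eps replaces
    1/a by 1/(a + eps), and subtracting the shift by N leaves the difference of (f - g)' at two
    points N - eps apart, which decays like 1/a^2. The price is paid by [f] alone, through f'(z) -
    f'(z + eps) and the tail f'(z + N); so N and eps depend on [f] only and the accuracy of [g] can
    be chosen last. The constant g(+oo) makes f - h small far to the right, and integrating the
    derivative from there bounds the sup norm by the integral norm.

    In the second half [f] need not be holomorphic across the imaginary axis, so its Taylor
    polynomials on the disc need not converge uniformly; [f] is first composed with z -> (z +
    eps)/(1 + eps z), which in the disc is w -> rho w with rho < 1.

    Both halves rest on Taylor expansion with explicit remainder, which is derived from Goursat's
    theorem on rectangles: the exponential maps vertical segments to circles. *)

Lemma cabsE x y : cabs (x +i* y)%C = Num.sqrt (x ^+ 2 + y ^+ 2).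
Proof. by []. Qed.

Lemma normcE_cabs z : `|z| = ((cabs z)%:C)%C.
Proof. by []. Qed.

Lemma cabs_ge0 z : 0 <= cabs z.
Proof. by case: z => x y; rewrite cabsE sqrtr_ge0. Qed.

Lemma cabs0 : cabs (0 : R[i]) = 0.
Proof. exact: ComplexField.Normc.normc0. Qed.

Lemma cabs1 : cabs (1 : R[i]) = 1.
Proof. exact: ComplexField.Normc.normc1. Qed.

Lemma cabsM z w : cabs (z * w) = cabs z * cabs w.
Proof. exact: ComplexField.Normc.normcM. Qed.

Lemma cabsV z : cabs z^-1 = (cabs z)^-1.
Proof. exact: ComplexField.Normc.normcV. Qed.

Lemma cabsN z : cabs (- z) = cabs z.
Proof. by case: z => x y; rewrite /cabs /= !sqrrN. Qed.

Lemma cabsD z w : cabs (z + w) <= cabs z + cabs w.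
Proof. exact: le_normcD. Qed.

Lemma cabsB z w : cabs (z - w) <= cabs z + cabs w.
Proof. by rewrite -(cabsN w) cabsD. Qed.

Lemma cabs_distC z w : cabs (z - w) = cabs (w - z).
Proof. by rewrite -cabsN opprB. Qed.

Lemma cabs_dist_trans v z w : cabs (z - w) <= cabs (z - v) + cabs (v - w).
Proof. by rewrite (le_trans _ (cabsD _ _)) // addrA subrK. Qed.

Lemma cabs_eq0 z : (cabs z == 0) = (z == 0).
Proof.
apply/eqP/eqP => [|->]; last exact: cabs0.
exact: ComplexField.Normc.eq0_normc.
Qed.

Lemma cabs_gt0 z : (0 < cabs z) = (z != 0).
Proof. by rewrite lt_def cabs_eq0 cabs_ge0 andbT. Qed.

Lemma cabsX z n : cabs (z ^+ n) = cabs z ^+ n.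
Proof. by elim: n => [|n IH]; rewrite ?expr0 ?cabs1 // !exprS cabsM IH. Qed.

Lemma cabs_real x : cabs (x%:C)%C = `|x|.
Proof. by rewrite cabsE expr0n addr0 sqrtr_sqr. Qed.

Lemma cabs_imag x : cabs (x *i)%C = `|x|.
Proof. by rewrite cabsE expr0n add0r sqrtr_sqr. Qed.

Lemma cabs_Re z : `|complex.Re z| <= cabs z.
Proof.
case: z => x y; rewrite cabsE /= -sqrtr_sqr ler_sqrt ?addr_ge0 ?sqr_ge0 //.
by rewrite lerDl sqr_ge0.
Qed.

Lemma cabs_Im z : `|complex.Im z| <= cabs z.
Proof.
case: z => x y; rewrite cabsE /= -sqrtr_sqr ler_sqrt ?addr_ge0 ?sqr_ge0 //.
by rewrite lerDr sqr_ge0.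
Qed.

Lemma cabs_le z : cabs z <= `|complex.Re z| + `|complex.Im z|.
Proof.
have {1}-> : z = ((complex.Re z)%:C + (complex.Im z)*i)%C.
  by case: z => x y; simpc.
by rewrite (le_trans (cabsD _ _)) // cabs_real cabs_imag.
Qed.

Lemma cabs_Re_ge z : complex.Re z <= cabs z.
Proof. exact: le_trans (ler_norm _) (cabs_Re z). Qed.

Lemma cabs_sub_ge z w : cabs z - cabs w <= cabs (z - w).
Proof. by rewrite lerBlDr -{1}(subrK w z) cabsD. Qed.

Lemma ReD z w : complex.Re (z + w) = complex.Re z + complex.Re w.
Proof. by case: z w => [? ?] [? ?]. Qed.
Lemma ImD z w : complex.Im (z + w) = complex.Im z + complex.Im w.
Proof. by case: z w => [? ?] [? ?]. Qed.
Lemma ReN z : complex.Re (- z) = - complex.Re z.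
Proof. by case: z => ? ?. Qed.
Lemma ImN z : complex.Im (- z) = - complex.Im z.
Proof. by case: z => ? ?. Qed.
Lemma cReM z w : complex.Re (z * w) =
  complex.Re z * complex.Re w - complex.Im z * complex.Im w.
Proof. by case: z w => [? ?] [? ?]. Qed.
Lemma cImM z w : complex.Im (z * w) =
  complex.Re z * complex.Im w + complex.Im z * complex.Re w.
Proof. by case: z w => [? ?] [? ?]. Qed.

Lemma complex_ext z w :
  complex.Re z = complex.Re w -> complex.Im z = complex.Im w -> z = w.
Proof. by case: z w => [? ?] [? ?] /= -> ->. Qed.

End Modulus.

(** * Complex differentiability in epsilon-delta form *)

Section Differentiability.
Variable R : realType.
Implicit Types (f g : R[i] -> R[i]) (z w l : R[i]).
Notation Cn := ((R[i] : numFieldType)^o).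

(** All radii and errors are real, and nothing is divided by [h], so [h = 0] need not be excluded.
    [cdiff_derivable] and [derivable_cdiff] translate to and from [derivable]. *)
Definition cdiff f z l := forall e : R, 0 < e -> exists2 d : R, 0 < d &
  forall h, cabs h < d -> cabs (f (z + h) - f z - l * h) <= e * cabs h.

Definition ccont f z := forall e : R, 0 < e -> exists2 d : R, 0 < d &
  forall w, cabs (w - z) < d -> cabs (f w - f z) <= e.

Lemma cdiff_derivable f z l :
  cdiff f z l -> derivable (f : Cn -> Cn) (z : Cn) 1 /\ 'D_1 (f : Cn -> Cn) (z : Cn) = l.
Proof.
move=> H.
suff lim : h^-1 *: (((f : Cn -> Cn) \o shift (z : Cn)) (h *: (1 : Cn)) - f z) @[h --> (0 : (R[i] : numFieldType)^o)^'] --> (l : Cn).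
  by split; [apply/cvg_ex; exists l | apply/cvg_lim].
apply/cvgrPdist_le => e e0.
(* The norm of [R[i]] takes values in [R[i]]; a positive [e] there is the image of a real number,
   which is extracted here. *)
have : e \is Num.real by rewrite realE ltW.
move=> /complex_realP [e' ee']; move: e0; rewrite {}ee' ltcR => e0.
have [d d0 {}H] := H _ e0.
apply/nbhs_ballP; exists (d%:C)%C => /=; first by rewrite ltcR.
move=> h; rewrite /ball /= sub0r normrN normcE_cabs ltcR => hd h0.
rewrite /shift /= normcE_cabs lecR.
have -> : h *: (1 : Cn) = h by rewrite /GRing.scale /= mulr1.
have := H h hd; rewrite (addrC z h) => H1.
have ->: l - h^-1 *: (f (h + z) - f z) = - (h^-1 * (f (h + z) - f z - l * h)).
  by rewrite /GRing.scale /=; field.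
by rewrite cabsN cabsM cabsV ler_pdivrMl ?cabs_gt0 // (mulrC (cabs h)).
Qed.

Lemma derivable_cdiff f z :
  derivable (f : Cn -> Cn) (z : Cn) 1 -> cdiff f z ('D_1 (f : Cn -> Cn) (z : Cn)).
Proof.
move=> /cvgrPdist_le H e e0.
have := H (e%:C)%C; rewrite ltcR => /(_ e0).
move=> /nbhs_ballP[d /= d0 {}H].
have : d \is Num.real by rewrite realE ltW.
move=> /complex_realP [d' dd']; move: d0 H; rewrite {}dd' ltcR => d0 H.
exists d' => // h hd.
have [->|h0] := eqVneq h 0; first by rewrite addr0 subrr mulr0 subrr cabs0 mulr0.
have := H h; rewrite /ball /= sub0r normrN normcE_cabs ltcR => /(_ hd h0).
rewrite /shift /= normcE_cabs lecR.
have -> : h *: (1 : Cn) = h by rewrite /GRing.scale /= mulr1.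
rewrite (addrC h z).
set D := derive _ _ _.
rewrite -[lim _]/D.
have ->: D - h^-1 *: (f (z + h) - f z) = - (h^-1 * (f (z + h) - f z - D * h)).
  by rewrite /GRing.scale /=; field.
by rewrite cabsN cabsM cabsV ler_pdivrMl ?cabs_gt0 // (mulrC (cabs h)).
Qed.

Lemma cdiff_unique f z l l' : cdiff f z l -> cdiff f z l' -> l = l'.
Proof. by move=> /cdiff_derivable[_ <-] /cdiff_derivable[_ <-]. Qed.

Lemma cdiff_cont f z l : cdiff f z l -> ccont f z.
Proof.
move=> /(_ 1 ltr01)[d d0 H] e e0.
have L0 : 0 < 1 + cabs l by rewrite ltr_pwDl ?cabs_ge0.
exists (Num.min d (e / (1 + cabs l))).
  by rewrite lt_min d0 divr_gt0.
move=> w; rewrite lt_min => /andP[wd we].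
have := H _ wd; rewrite (addrC z) subrK => H1.
rewrite -[f w - f z](subrK (l * (w - z))) (le_trans (cabsD _ _)) //.
rewrite (le_trans (lerD H1 (lexx _))) // cabsM -mulrDl mulrC.
by rewrite -ler_pdivlMr // ltW.
Qed.

Lemma cdiff_cst c z : cdiff (fun _ => c) z 0.
Proof.
move=> e e0; exists 1 => // h _.
by rewrite subrr mul0r subrr cabs0 mulr_ge0 ?cabs_ge0 // ltW.
Qed.

Lemma cdiff_id z : cdiff id z 1.
Proof.
move=> e e0; exists 1 => // h _.
by rewrite mul1r (addrC z) addrK subrr cabs0 mulr_ge0 ?cabs_ge0 // ltW.
Qed.

Lemma cdiffD f g z l l' : cdiff f z l -> cdiff g z l' ->
  cdiff (fun w => f w + g w) z (l + l').
Proof.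
move=> Hf Hg e e0; have e2 : 0 < e / 2 by rewrite divr_gt0.
have [d d0 {}Hf] := Hf _ e2; have [d' d'0 {}Hg] := Hg _ e2.
exists (Num.min d d'); first by rewrite lt_min d0.
move=> h; rewrite lt_min => /andP[/Hf H1 /Hg H2].
have -> : f (z + h) + g (z + h) - (f z + g z) - (l + l') * h =
  (f (z + h) - f z - l * h) + (g (z + h) - g z - l' * h) by ring.
by rewrite (le_trans (cabsD _ _)) // [e]splitr mulrDl lerD.
Qed.

Lemma cdiffM f g z l l' : cdiff f z l -> cdiff g z l' ->
  cdiff (fun w => f w * g w) z (l * g z + f z * l').
Proof.
move=> Hf Hg e e0.
pose K := 1 + cabs (g z) + cabs (f z) + cabs l.
have K0 : 0 < K by rewrite /K; have := cabs_ge0 (g z); have := cabs_ge0 (f z);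
  have := cabs_ge0 l; lra.
have eK : 0 < e / (4 * K) by rewrite divr_gt0 // mulr_gt0.
have [d d0 H1] := Hf _ eK; have [d' d'0 H2] := Hg _ eK.
have eK1 : 0 < Num.min 1 (e / (4 * K)) by rewrite lt_min eK ltr01.
have [d'' d''0 H3] := cdiff_cont Hg eK1.
exists (Num.min d (Num.min d' d'')); first by rewrite !lt_min d0 d'0.
move=> h; rewrite !lt_min => /and3P[hd hd' hd''].
have {}H1 := H1 _ hd; have {}H2 := H2 _ hd'.
have := H3 (z + h); rewrite (addrC z) addrK => /(_ hd'').
rewrite le_min => /andP[H31 H32].
set A := f (z + h) - f z - l * h in H1 *; set B := g (z + h) - g z - l' * h in H2 *.
have -> : f (h + z) * g (h + z) - f z * g z - (l * g z + f z * l') * h =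
  A * (g (h + z) - g z) + A * g z + f z * B + l * h * (g (h + z) - g z).
  by rewrite /A /B (addrC z h); ring.
have h0 := cabs_ge0 h.
have E : e = e / (4 * K) * (4 * K) by field; lra.
apply: (@le_trans _ _ (cabs A * 1 + cabs A * cabs (g z) + cabs (f z) * cabs B + cabs l * cabs h * (e / (4 * K)))).
  rewrite (le_trans (cabsD _ _)) // lerD //; last first.
    by rewrite !cabsM ler_wpM2l // mulr_ge0 ?cabs_ge0.
  rewrite (le_trans (cabsD _ _)) // lerD //; last by rewrite cabsM.
  rewrite (le_trans (cabsD _ _)) // lerD //; last by rewrite cabsM.
  by rewrite cabsM ler_wpM2l // cabs_ge0.
set q := e / (4 * K) in E H1 H2 eK *.
have := cabs_ge0 (g z); have := cabs_ge0 (f z); have := cabs_ge0 l.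
move: E; rewrite /K => E; move: q E eK H1 H2 => q E q0 H1 H2.
move: (cabs A) (cabs B) (cabs (f z)) (cabs (g z)) (cabs l) (cabs h) E H1 H2 h0.
move=> A' B' F G L k E H1 H2 h0 L0 F0 G0; rewrite E.
have qk : 0 <= q * k by rewrite mulr_ge0 // ltW.
have := ler_wpM2r G0 H1; have := ler_wpM2l F0 H2.
have := mulr_ge0 G0 qk; have := mulr_ge0 F0 qk; have := mulr_ge0 L0 qk.
nra.
Qed.

Lemma cdiff_ext f g z l (d : R) : 0 < d ->
  (forall w, cabs (w - z) < d -> f w = g w) -> cdiff f z l -> cdiff g z l.
Proof.
move=> d0 fg H e e0; have [d' d'0 {}H] := H _ e0.
exists (Num.min d d'); first by rewrite lt_min d0.
move=> h; rewrite lt_min => /andP[hd hd'].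
rewrite -!fg ?subrr ?cabs0 //; first exact: H.
by rewrite (addrC z) addrK.
Qed.

Lemma cdiff_comp f g z l l' : cdiff f z l -> cdiff g (f z) l' ->
  cdiff (fun w => g (f w)) z (l' * l).
Proof.
move=> Hf Hg e e0.
have L0 : 0 < 2 * (1 + cabs l) by have := cabs_ge0 l; lra.
have L0' : 0 < 2 * (1 + cabs l') by have := cabs_ge0 l'; lra.
have [d d0 H1] := Hg _ (divr_gt0 e0 L0).
have [d' d'0 H2] := Hf _ (divr_gt0 e0 L0').
have [d'' d''0 H3] := Hf _ ltr01.
exists (Num.min d' (Num.min d'' (d / (1 + cabs l)))).
  by rewrite !lt_min d'0 d''0 divr_gt0 //; have := cabs_ge0 l; lra.
move=> h; rewrite !lt_min => /and3P[hd' hd'' hd].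
have {}H2 := H2 _ hd'; have {}H3 := H3 _ hd''.
have H4 : cabs (f (z + h) - f z) <= (1 + cabs l) * cabs h.
  rewrite -[f (z + h) - f z](subrK (l * h)) (le_trans (cabsD _ _)) //.
  by rewrite mulrDl cabsM lerD.
have := H1 (f (z + h) - f z); rewrite (addrC (f z)) subrK => {}H1.
have {}H1 : cabs (g (f (z + h)) - g (f z) - l' * (f (z + h) - f z)) <= e / 2 * cabs h.
  apply: (le_trans (H1 _)).
    rewrite (le_lt_trans H4) //; rewrite ltr_pdivlMr in hd; last first.
      by have := cabs_ge0 l; lra.
    by rewrite mulrC.
  rewrite (le_trans (ler_wpM2l _ H4)) //; first by rewrite ltW // divr_gt0.
  rewrite mulrA ler_wpM2r ?cabs_ge0 // le_eqVlt; apply/orP; left; apply/eqP.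
  by field; have := cabs_ge0 l; lra.
have -> : g (f (z + h)) - g (f z) - l' * l * h =
  (g (f (z + h)) - g (f z) - l' * (f (z + h) - f z)) + l' * (f (z + h) - f z - l * h).
  by ring.
rewrite (le_trans (cabsD _ _)) // [e]splitr mulrDl lerD // cabsM.
rewrite (le_trans (ler_wpM2l (cabs_ge0 _) H2)) // mulrA ler_wpM2r ?cabs_ge0 //.
rewrite mulrA ler_pdivrMr //.
have := cabs_ge0 l'; nra.
Qed.

Lemma cdiff_inv z : z != 0 -> cdiff GRing.inv z (- z^-1 ^+ 2).
Proof.
move=> z0 e e0.
have a0 : 0 < cabs z by rewrite cabs_gt0.
exists (Num.min (cabs z / 2) (e * cabs z ^+ 3 / 2)).
  by rewrite lt_min !divr_gt0 // mulr_gt0 // exprn_gt0.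
move=> h; rewrite lt_min => /andP[h1 h2].
have zh : cabs z / 2 <= cabs (z + h).
  have := cabs_sub_ge z (- h); rewrite cabsN opprK.
  by move: h1; move: (cabs z) (cabs h) (cabs _) => a b c; lra.
have zh0 : z + h != 0 by rewrite -cabs_gt0 (lt_le_trans _ zh) // divr_gt0.
have -> : (z + h)^-1 - z^-1 - - z^-1 ^+ 2 * h = h * ((z + h)^-1 * z^-1 ^+ 2) * h.
  by field; rewrite z0 zh0.
rewrite cabsM ler_wpM2r ?cabs_ge0 // 2!cabsM cabsX !cabsV.
rewrite exprVn -invfM ler_pdivrMr ?mulr_gt0 ?exprn_gt0 //; last first.
  by rewrite (lt_le_trans _ zh) // divr_gt0.
rewrite (le_trans (ltW h2)) // -[e * _ / 2]mulrA (ler_wpM2l (ltW e0)) //.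
have := ler_wpM2r (exprn_ge0 2 (ltW a0)) zh.
by rewrite mulrAC -exprS.
Qed.

Lemma cdiffV f z l : cdiff f z l -> f z != 0 ->
  cdiff (fun w => (f w)^-1) z (- (f z)^-1 ^+ 2 * l).
Proof. by move=> Hf fz; apply: cdiff_comp Hf (cdiff_inv fz). Qed.

Lemma cdiffN f z l : cdiff f z l -> cdiff (fun w => - f w) z (- l).
Proof.
move=> Hf e e0; have [d d0 {}Hf] := Hf e e0; exists d => // h /Hf.
by rewrite -cabsN; congr (_ <= _); congr cabs; ring.
Qed.

Lemma cdiffB f g z l l' : cdiff f z l -> cdiff g z l' ->
  cdiff (fun w => f w - g w) z (l - l').
Proof. by move=> Hf Hg; apply: (cdiffD Hf); apply: cdiffN. Qed.

Lemma cdiff_shift f z c l : cdiff f (z + c) l -> cdiff (fun w => f (w + c)) z l.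
Proof.
move=> Hf e e0; have [d d0 {}Hf] := Hf e e0; exists d => // h /Hf.
by rewrite (addrAC z c h).
Qed.

Lemma ccont_mul f g z : ccont f z -> ccont g z -> ccont (fun w => f w * g w) z.
Proof.
move=> Hf Hg e e0.
pose K := 1 + cabs (g z) + cabs (f z).
have K0 : 0 < K by rewrite /K; have := cabs_ge0 (g z); have := cabs_ge0 (f z); lra.
have eK : 0 < Num.min 1 (e / K) by rewrite lt_min ltr01 divr_gt0.
have [d d0 H1] := Hf _ eK; have [d' d'0 H2] := Hg _ eK.
exists (Num.min d d'); first by rewrite lt_min d0.
move=> w; rewrite lt_min => /andP[/H1 {}H1 /H2 {}H2].
move: H1 H2; rewrite !le_min => /andP[A1 A2] /andP[B1 B2].
have -> : f w * g w - f z * g z =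
  (f w - f z) * (g w - g z) + (f w - f z) * g z + f z * (g w - g z) by ring.
have E : e = e / K * 1 + e / K * cabs (g z) + cabs (f z) * (e / K) by rewrite /K; field; rewrite /K in K0; lra.
rewrite E (le_trans (cabsD _ _)) // lerD //; last by rewrite cabsM ler_wpM2l ?cabs_ge0.
rewrite (le_trans (cabsD _ _)) // lerD //; last by rewrite cabsM ler_wpM2r ?cabs_ge0.
by rewrite cabsM ler_pM ?cabs_ge0.
Qed.

Lemma ccont_comp f g z : ccont f z -> ccont g (f z) -> ccont (fun w => g (f w)) z.
Proof.
move=> Hf Hg e e0; have [d d0 {}Hg] := Hg _ e0.
have [d' d'0 {}Hf] := Hf _ (divr_gt0 d0 (ltr0Sn _ 1)).
exists d' => // w /Hf H; apply: Hg; rewrite (le_lt_trans H) //.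
by rewrite ltr_pdivrMr // ltr_pMr // ltr1n.
Qed.

End Differentiability.

(** * Bisection of rectangles *)

Section Bisection.
Variable R : realType.

(** The first three quarters are tested in turn. The fourth is taken when they all satisfy [P]; it
    must then fail whenever the whole rectangle does. *)
Let quarter (P : R -> R -> R -> R -> Prop) (q : (R * R) * (R * R)) : (R * R) * (R * R) :=
  let: ((a, b), (c, d)) := q in
  let m := (a + b) / 2 in let n := (c + d) / 2 in
  if pselect (P a m c n) then
    if pselect (P m b c n) then
      if pselect (P a m n d) then ((m, b), (n, d)) else ((a, m), (n, d))
    else ((m, b), (c, n))
  else ((a, m), (c, n)).

(* A failure would propagate to nested rectangles that shrink to a point. *)
Lemma rect_ind (P : R -> R -> R -> R -> Prop) (a b c d : R) :
  a <= b -> c <= d ->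
  (forall a b c d, a <= b -> c <= d ->
     P a ((a + b) / 2) c ((c + d) / 2) -> P ((a + b) / 2) b c ((c + d) / 2) ->
     P a ((a + b) / 2) ((c + d) / 2) d -> P ((a + b) / 2) b ((c + d) / 2) d ->
     P a b c d) ->
  (forall x y, a <= x <= b -> c <= y <= d -> exists2 e : R, 0 < e &
     forall a' b' c' d', a <= a' -> a' <= x <= b' -> b' <= b ->
       c <= c' -> c' <= y <= d' -> d' <= d -> b' - a' <= e -> d' - c' <= e ->
       P a' b' c' d') ->
  P a b c d.
Proof.
move=> ab cd Psub Ploc; apply: contrapT => nP.
pose q n := iter n (quarter P) ((a, b), (c, d)).
have qS n : let: ((a0, b0), (c0, d0)) := q n in
    let: ((a1, b1), (c1, d1)) := q n.+1 in
    (a0 <= b0 -> c0 <= d0 -> ~ P a0 b0 c0 d0 ->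
    [/\ [/\ a0 <= a1, a1 <= b1 & b1 <= b0], [/\ c0 <= c1, c1 <= d1 & d1 <= d0],
        ~ P a1 b1 c1 d1, b1 - a1 = (b0 - a0) / 2 & d1 - c1 = (d0 - c0) / 2]).
  rewrite /q iterS -/(q n); case: (q n) => -[a0 b0] [c0 d0] /=.
  have H := Psub a0 b0 c0 d0.
  case: pselect => H1; last by move=> ? ? _; split => //; try split; lra.
  case: pselect => H2; last by move=> ? ? _; split => //; try split; lra.
  case: pselect => H3; last by move=> ? ? _; split => //; try split; lra.
  move=> ab0 cd0 nP0; split => //; try split; try lra.
  by move=> H4; apply: nP0; apply: H.
pose A n := (q n).1.1; pose B n := (q n).1.2.
pose C n := (q n).2.1; pose D n := (q n).2.2.
have inv n : [/\ A n <= B n, C n <= D n, ~ P (A n) (B n) (C n) (D n),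
    B n - A n = (b - a) / 2 ^+ n & D n - C n = (d - c) / 2 ^+ n].
  elim: n => [|n [h1 h2 h3 h4 h5]].
    by rewrite /A /B /C /D /= expr0 !divr1; split.
  have := qS n; move: h1 h2 h3 h4 h5; rewrite /A /B /C /D.
  case: (q n) => -[a0 b0] [c0 d0]; case: (q n.+1) => -[a1 b1] [c1 d1] /= h1 h2 h3 h4 h5.
  move=> /(_ h1 h2 h3)[[_ g1 _] [_ g2 _] g3 g4 g5]; split => //.
    by rewrite g4 h4 exprS invfM mulrA mulrAC.
  by rewrite g5 h5 exprS invfM mulrA mulrAC.
have mon n : [/\ A n <= A n.+1, B n.+1 <= B n, C n <= C n.+1 & D n.+1 <= D n].
  have := qS n; have := inv n; rewrite /A /B /C /D.
  case: (q n) => -[a0 b0] [c0 d0]; case: (q n.+1) => -[a1 b1] [c1 d1] /= [h1 h2 h3 _ _].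
  by move=> /(_ h1 h2 h3)[[? _ ?] [? _ ?] _ _ _].
have monA m n : (m <= n)%N -> [/\ A m <= A n, B n <= B m, C m <= C n & D n <= D m].
  elim: n => [|n IH]; first by rewrite leqn0 => /eqP ->.
  rewrite leq_eqVlt ltnS => /orP[/eqP->//|/IH[h1 h2 h3 h4]].
  have [g1 g2 g3 g4] := mon n.
  by split; [exact: le_trans g1|exact: le_trans h2|exact: le_trans g3|exact: le_trans h4].
have AB m n : A m <= B n /\ C m <= D n.
  have [h1 _ h3 _] := monA _ _ (leq_maxl m n).
  have [_ h2 _ h4] := monA _ _ (leq_maxr m n).
  have [k1 k2 _ _ _] := inv (maxn m n).
  by split; [apply: le_trans h1 (le_trans k1 h2)|apply: le_trans h3 (le_trans k2 h4)].
pose x := sup (range A); pose y := sup (range C).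
have hx n : A n <= x <= B n.
  apply/andP; split.
    apply: ub_le_sup; last by exists n.
    by exists (B n) => _ [m _ <-]; have [] := AB m n.
  apply: ge_sup; first by exists (A n); exists n.
  by move=> _ [m _ <-]; have [] := AB m n.
have hy n : C n <= y <= D n.
  apply/andP; split.
    apply: ub_le_sup; last by exists n.
    by exists (D n) => _ [m _ <-]; have [] := AB m n.
  apply: ge_sup; first by exists (C n); exists n.
  by move=> _ [m _ <-]; have [] := AB m n.
have [e e0 He] := Ploc x y (hx 0%N) (hy 0%N).
pose K := (b - a) + (d - c).
have K0 : 0 <= K by rewrite /K; lra.
(* Since K / e < n < 2^n, both sides of the n-th rectangle are at most [e]. *)
pose n := Num.bound (K / e).
have Kn : K / 2 ^+ n <= e.
  rewrite ler_pdivrMr ?exprn_gt0 // mulrC -ler_pdivrMr //.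
  have : K / e < n%:R by rewrite archi_boundP // divr_ge0 // ltW.
  move=> /ltW /le_trans; apply.
  by rewrite -natrX ler_nat ltnW // ltn_expl.
have [h1 h2 h3 h4 h5] := inv n.
have [g1 g2 g3 g4] := monA 0%N n (leq0n n).
apply: h3; apply: He => //.
- by rewrite h4 (le_trans _ Kn) // ler_pM2r ?invr_gt0 ?exprn_gt0 // /K; lra.
- by rewrite h5 (le_trans _ Kn) // ler_pM2r ?invr_gt0 ?exprn_gt0 // /K; lra.
Qed.

End Bisection.

(** * Integrals of complex functions over real segments *)

Section ComplexIntegral.
Variable R : realType.
Notation leb := (@lebesgue_measure R).
Implicit Types (phi psi : R -> R[i]) (a b c d m : R).

Definition rcont phi t := forall e : R, 0 < e -> exists2 d : R, 0 < d &
  forall s, `|s - t| < d -> cabs (phi s - phi t) <= e.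

Definition cont_on a b phi := forall t, a <= t <= b -> rcont phi t.

Definition Cint a b phi : R[i] :=
  ((Rintegral leb `[a, b] (fun t => complex.Re (phi t))) +i*
   (Rintegral leb `[a, b] (fun t => complex.Im (phi t))))%C.

Lemma rcont_Re phi t : rcont phi t -> {for t, continuous (fun s => complex.Re (phi s))}.
Proof.
move=> H; apply/cvgrPdist_le => e e0; have [d d0 {}H] := H _ e0.
apply/nbhs_ballP; exists d => //= s; rewrite /ball /= distrC => /H.
by apply: le_trans; rewrite -ReN -ReD cabs_distC cabs_Re.
Qed.

Lemma rcont_Im phi t : rcont phi t -> {for t, continuous (fun s => complex.Im (phi s))}.
Proof.
move=> H; apply/cvgrPdist_le => e e0; have [d d0 {}H] := H _ e0.
apply/nbhs_ballP; exists d => //= s; rewrite /ball /= distrC => /H.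
by apply: le_trans; rewrite -ImN -ImD cabs_distC cabs_Im.
Qed.

Lemma rcont_comp (f : R[i] -> R[i]) phi t :
  rcont phi t -> ccont f (phi t) -> rcont (fun s => f (phi s)) t.
Proof.
move=> Hp Hf e e0; have [d d0 {}Hf] := Hf _ e0.
have [d' d'0 {}Hp] := Hp _ (divr_gt0 d0 (ltr0Sn _ 1)).
exists d' => // s /Hp H; apply: Hf; rewrite (le_lt_trans H) //.
by rewrite ltr_pdivrMr // ltr_pMr // ltr1n.
Qed.

Lemma rcont_horiz c t : rcont (fun x => (x +i* c)%C) t.
Proof.
move=> e e0; exists e => // s st.
have -> : (s +i* c - (t +i* c) = (s - t)%:C)%C by apply: complex_ext; rewrite /= ?subrr.
by rewrite cabs_real ltW.
Qed.

Lemma rcont_vert c t : rcont (fun y => (c +i* y)%C) t.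
Proof.
move=> e e0; exists e => // s st.
have -> : (c +i* s - (c +i* t) = (s - t)*i)%C by apply: complex_ext; rewrite /= ?subrr.
by rewrite cabs_imag ltW.
Qed.

Lemma rcontD phi psi t : rcont phi t -> rcont psi t ->
  rcont (fun s => phi s + psi s) t.
Proof.
move=> H1 H2 e e0; have e2 : 0 < e / 2 by rewrite divr_gt0.
have [d d0 {}H1] := H1 _ e2; have [d' d'0 {}H2] := H2 _ e2.
exists (Num.min d d'); first by rewrite lt_min d0.
move=> s; rewrite lt_min => /andP[/H1 {}H1 /H2 {}H2].
rewrite opprD addrACA [e]splitr (le_trans (cabsD _ _)) // lerD //.
Qed.

Lemma rcontZ k phi t : rcont phi t -> rcont (fun s => k * phi s) t.
Proof.
move=> H e e0; have k0 : 0 < 1 + cabs k by have := cabs_ge0 k; lra.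
have [d d0 {}H] := H _ (divr_gt0 e0 k0).
exists d => // s /H {}H; rewrite -mulrBr cabsM.
rewrite (le_trans (ler_wpM2l (cabs_ge0 _) H)) // mulrA ler_pdivrMr //.
by have := cabs_ge0 k; nra.
Qed.

Lemma rcont_cst k t : rcont (fun=> k) t.
Proof. by move=> e e0; exists 1 => // s _; rewrite subrr cabs0 ltW. Qed.

Lemma cont_on_Re a b phi : cont_on a b phi ->
  leb.-integrable `[a, b] (EFin \o (fun s => complex.Re (phi s))).
Proof.
move=> H; apply: continuous_compact_integrable; first exact: segment_compact.
apply: continuous_in_subspaceT => t; rewrite inE /= in_itv /= => tab.
exact: rcont_Re (H _ tab).
Qed.

Lemma cont_on_Im a b phi : cont_on a b phi ->
  leb.-integrable `[a, b] (EFin \o (fun s => complex.Im (phi s))).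
Proof.
move=> H; apply: continuous_compact_integrable; first exact: segment_compact.
apply: continuous_in_subspaceT => t; rewrite inE /= in_itv /= => tab.
exact: rcont_Im (H _ tab).
Qed.

Lemma eq_Cint a b phi psi : (forall t, a <= t <= b -> phi t = psi t) ->
  Cint a b phi = Cint a b psi.
Proof.
move=> H; rewrite /Cint; congr (_ +i* _)%C; apply: eq_Rintegral => t;
by rewrite inE /= in_itv /= => /H ->.
Qed.

Lemma CintD a b phi psi : cont_on a b phi -> cont_on a b psi ->
  Cint a b (fun t => phi t + psi t) = Cint a b phi + Cint a b psi.
Proof.
move=> H1 H2; rewrite /Cint; simpc; congr (_ +i* _)%C.
- rewrite -RintegralD //; [|exact: cont_on_Re..].
  by apply: eq_Rintegral => t _; rewrite ReD.
- rewrite -RintegralD //; [|exact: cont_on_Im..].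
  by apply: eq_Rintegral => t _; rewrite ImD.
Qed.

Lemma CintZ a b k phi : cont_on a b phi ->
  Cint a b (fun t => k * phi t) = k * Cint a b phi.
Proof.
move=> H; have IR := cont_on_Re H; have II := cont_on_Im H.
case: k => x y; rewrite /Cint.
have ZR r : leb.-integrable `[a, b] (EFin \o (fun s => r * complex.Re (phi s))).
  by have := fun mI => @integrableZl _ _ _ leb _ mI r _ IR; apply; exact: measurable_itv.
have ZI r : leb.-integrable `[a, b] (EFin \o (fun s => r * complex.Im (phi s))).
  by have := fun mI => @integrableZl _ _ _ leb _ mI r _ II; apply; exact: measurable_itv.
apply: complex_ext; rewrite ?cReM ?cImM /=.
- rewrite -!RintegralZl // -RintegralB //.
  by apply: eq_Rintegral => t _; case: (phi t).
- rewrite -!RintegralZl // -RintegralD //.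
  by apply: eq_Rintegral => t _; case: (phi t).
Qed.

Lemma Rintegral_split m a b (f : R -> R) : a <= m <= b ->
  leb.-integrable `[a, b] (EFin \o f) ->
  Rintegral leb `[a, b] f = Rintegral leb `[a, m] f + Rintegral leb `[m, b] f.
Proof.
move=> /andP[am mb] If; apply/eqP; rewrite addrC -subr_eq; apply/eqP.
rewrite Rintegral_itvB ?bnd_simp // Rintegral_itv_obnd_cbnd //.
by apply: integrableS If => //; apply: subset_itvr; rewrite bnd_simp.
Qed.

Lemma Cint_split m a b phi : a <= m <= b -> cont_on a b phi ->
  Cint a b phi = Cint a m phi + Cint m b phi.
Proof.
move=> H1 H; rewrite /Cint; simpc; congr (_ +i* _)%C.
- by apply: Rintegral_split (cont_on_Re H).
- by apply: Rintegral_split (cont_on_Im H).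
Qed.

Lemma Rintegral_cst_itv a b (r : R) : a <= b ->
  Rintegral leb `[a, b] (fun=> r) = r * (b - a).
Proof.
move=> ab; rewrite Rintegral_cst //=.
rewrite lebesgue_measure_itv /= lte_fin.
move: ab; rewrite le_eqVlt => /orP[/eqP ->|ab]; first by rewrite ltxx subrr.
by rewrite ab.
Qed.

Lemma Cint_cst a b k : a <= b -> Cint a b (fun=> k) = k * ((b - a)%:C)%C.
Proof. by move=> ab; rewrite /Cint !Rintegral_cst_itv //; case: k => x y; simpc. Qed.

Lemma Rintegral_bound a b (f : R -> R) (M : R) : a <= b ->
  leb.-integrable `[a, b] (EFin \o f) -> (forall t, a <= t <= b -> `|f t| <= M) ->
  `|Rintegral leb `[a, b] f| <= M * (b - a).
Proof.
move=> ab If H; rewrite (le_trans (le_normr_Rintegral _ If)) //.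
rewrite -(Rintegral_cst_itv M ab); apply: le_Rintegral => //.
- exact: (integrable_norm If).
- apply: continuous_compact_integrable; first exact: segment_compact.
  by apply: continuous_subspaceT => x; exact: cvg_cst.
Qed.

(** Real and imaginary parts are bounded separately, whence the factor 2. It reappears in the Cauchy
    and Taylor estimates, where only the order of magnitude matters. *)
Lemma Cint_bound a b phi (M : R) : a <= b -> cont_on a b phi ->
  (forall t, a <= t <= b -> cabs (phi t) <= M) ->
  cabs (Cint a b phi) <= 2 * M * (b - a).
Proof.
move=> ab H B; rewrite (le_trans (cabs_le _)) //= -mulrA mulr_natl mulr2n lerD //.
- by apply: Rintegral_bound (cont_on_Re H) _ => // t /B; apply: le_trans; exact: cabs_Re.
- by apply: Rintegral_bound (cont_on_Im H) _ => // t /B; apply: le_trans; exact: cabs_Im.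
Qed.

Lemma Cint_pt a phi : Cint a a phi = 0.
Proof. by rewrite /Cint set_itv1 !Rintegral_set1. Qed.

End ComplexIntegral.

(** * Goursat's theorem on rectangles *)

Section Goursat.
Variable R : realType.
Implicit Types (H G : R[i] -> R[i]) (a b c d m : R) (z p : R[i]).

Lemma le0_of_eps (x C : R) : 0 <= C -> (forall e, 0 < e -> x <= e * C) -> x <= 0.
Proof.
move=> C0 Hx; rewrite leNgt; apply/negP => x0.
have C1 : 0 < 2 * (C + 1) by lra.
have := Hx _ (divr_gt0 x0 C1); rewrite mulrAC ler_pdivlMr //; nra.
Qed.

Definition inrect a b c d z := a <= complex.Re z <= b /\ c <= complex.Im z <= d.

(** The integral of H dz along the boundary of the rectangle, counterclockwise. *)
Definition rI H a b c d : R[i] :=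
  Cint a b (fun x => H (x +i* c)%C) - Cint a b (fun x => H (x +i* d)%C) +
  'i%C * (Cint c d (fun y => H (b +i* y)%C) - Cint c d (fun y => H (a +i* y)%C)).

Definition rect_cont H a b c d := forall z, inrect a b c d z -> ccont H z.

Lemma rect_cont_horiz H a b c d y : rect_cont H a b c d -> c <= y <= d ->
  cont_on a b (fun x => H (x +i* y)%C).
Proof. by move=> h cy t tab; apply: rcont_comp (rcont_horiz _ _) (h _ _). Qed.

Lemma rect_cont_vert H a b c d x : rect_cont H a b c d -> a <= x <= b ->
  cont_on c d (fun y => H (x +i* y)%C).
Proof. by move=> h cy t tab; apply: rcont_comp (rcont_vert _ _) (h _ _). Qed.

Lemma rI_vsplit H m a b c d : a <= m <= b -> c <= d -> rect_cont H a b c d ->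
  rI H a b c d = rI H a m c d + rI H m b c d.
Proof.
move=> amb cd h; rewrite /rI.
rewrite (@Cint_split _ m a b (fun x => H (x +i* c)%C)) //; last first.
  by apply: rect_cont_horiz h _; rewrite lexx.
rewrite (@Cint_split _ m a b (fun x => H (x +i* d)%C)) //; last first.
  by apply: rect_cont_horiz h _; rewrite lexx andbT.
ring.
Qed.

Lemma rI_hsplit H m a b c d : a <= b -> c <= m <= d -> rect_cont H a b c d ->
  rI H a b c d = rI H a b c m + rI H a b m d.
Proof.
move=> ab cmd h; rewrite /rI.
rewrite (@Cint_split _ m c d (fun y => H (b +i* y)%C)) //; last first.
  by apply: rect_cont_vert h _; rewrite lexx andbT.
rewrite (@Cint_split _ m c d (fun y => H (a +i* y)%C)) //; last first.
  by apply: rect_cont_vert h _; rewrite lexx.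
ring.
Qed.

Lemma rID H G a b c d : a <= b -> c <= d -> rect_cont H a b c d -> rect_cont G a b c d ->
  rI (fun z => H z + G z) a b c d = rI H a b c d + rI G a b c d.
Proof.
move=> ab cd h g; rewrite /rI.
rewrite !CintD; try by [apply: rect_cont_horiz h _; rewrite lexx ?andbT //
 | apply: rect_cont_horiz g _; rewrite lexx ?andbT //
 | apply: rect_cont_vert h _; rewrite lexx ?andbT //
 | apply: rect_cont_vert g _; rewrite lexx ?andbT //].
ring.
Qed.

(** The integrals of x, and those of y, agree on opposite sides and cancel; the constant parts leave
    a multiple of (b - a)(d - c) with coefficient 0. *)
Lemma rI_affine k l a b c d : a <= b -> c <= d ->
  rI (fun z => k + l * z) a b c d = 0.
Proof.
move=> ab cd; rewrite /rI.
have E1 y : Cint a b (fun x => k + l * (x +i* y)%C) =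
    (k + l * (y*i)%C) * ((b - a)%:C)%C + l * Cint a b (fun x => (x%:C)%C).
  rewrite -(Cint_cst _ ab) -CintZ; last by move=> t _; exact: rcont_horiz.
  rewrite -CintD; first last.
  - by move=> t _; apply: rcontZ; exact: rcont_horiz.
  - by move=> t _; exact: rcont_cst.
  apply: eq_Cint => t _; rewrite -addrA -mulrDr; congr (_ + _ * _).
  by simpc.
have E2 x : Cint c d (fun y => k + l * (x +i* y)%C) =
    (k + l * (x%:C)%C) * ((d - c)%:C)%C + l * Cint c d (fun y => (y*i)%C).
  rewrite -(Cint_cst _ cd) -CintZ; last by move=> t _; exact: rcont_vert.
  rewrite -CintD; first last.
  - by move=> t _; apply: rcontZ; exact: rcont_vert.
  - by move=> t _; exact: rcont_cst.
  apply: eq_Cint => t _; rewrite -addrA -mulrDr; congr (_ + _ * _).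
  by simpc.
rewrite !E1 !E2.
have iE (x : R) : (x*i = 'i * x%:C :> R[i])%C by simpc.
have ii : ('i * 'i = -1 :> R[i])%C by rewrite -expr2 sqr_i.
rewrite !iE !rmorphB /=.
move: (Cint _ _ _) (Cint _ _ _) => X Y.
set A := (a%:C)%C; set B := (b%:C)%C; set C := (c%:C)%C; set D := (d%:C)%C.
ring.
Qed.

Lemma rI_bound H a b c d (M : R) : a <= b -> c <= d -> rect_cont H a b c d ->
  (forall z, inrect a b c d z -> cabs (H z) <= M) ->
  cabs (rI H a b c d) <= 4 * M * ((b - a) + (d - c)).
Proof.
move=> ab cd h B; rewrite /rI.
have i1 : cabs ('i%C : R[i]) = 1 by rewrite cabs_imag normr1.
rewrite (le_trans (cabsD _ _)) // cabsM i1 mul1r.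
have -> : 4 * M * (b - a + (d - c)) = (2 * M * (b - a) + 2 * M * (b - a)) +
  (2 * M * (d - c) + 2 * M * (d - c)) by ring.
by rewrite lerD // (le_trans (cabsB _ _)) // lerD // Cint_bound //;
  try (by move=> t tt; apply: B; rewrite /inrect /= tt ?lexx ?ab ?cd);
  try (by apply: rect_cont_horiz h _; rewrite lexx ?andbT);
  try (by apply: rect_cont_vert h _; rewrite lexx ?andbT).
Qed.

Lemma rect_cont_sub a' b' c' d' H a b c d : a <= a' -> b' <= b -> c <= c' -> d' <= d ->
  rect_cont H a b c d -> rect_cont H a' b' c' d'.
Proof.
move=> aa bb cc dd h z [/andP[z1 z2] /andP[z3 z4]]; apply: h.
by split; apply/andP; split; lra.
Qed.

Lemma inrect_dist a b c d z p : inrect a b c d z -> inrect a b c d p ->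
  cabs (z - p) <= (b - a) + (d - c).
Proof.
move=> [/andP[z1 z2] /andP[z3 z4]] [/andP[p1 p2] /andP[p3 p4]].
rewrite (le_trans (cabs_le _)) // ReD ImD ReN ImN lerD //.
  by rewrite ler_norml; apply/andP; split; lra.
by rewrite ler_norml; apply/andP; split; lra.
Qed.

Lemma ccont_affine k l z : ccont (fun w => k + l * w) z.
Proof.
apply: cdiff_cont; apply: cdiffD; first exact: cdiff_cst.
by apply: cdiffM; [exact: cdiff_cst|exact: cdiff_id].
Qed.

Theorem goursat H a b c d : a <= b -> c <= d ->
  (forall z, inrect a b c d z -> exists l, cdiff H z l) -> rI H a b c d = 0.
Proof.
move=> ab cd dH.
have cH : rect_cont H a b c d by move=> z /dH[l]; exact: cdiff_cont.
apply/eqP; rewrite -cabs_eq0 eq_le cabs_ge0 andbT.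
apply: (@le0_of_eps _ (((b - a) + (d - c)) ^+ 2)); first exact: sqr_ge0.
move=> e e0.
(* This bound survives bisection: each quarter has half the value of (b' - a') + (d' - c'), so the
   four squares add up to the original one. *)
pose P a' b' c' d' := a <= a' -> b' <= b -> c <= c' -> d' <= d ->
  cabs (rI H a' b' c' d') <= e * ((b' - a') + (d' - c')) ^+ 2.
suff: P a b c d by apply.
apply: rect_ind => //.
  move=> {}a' {}b' {}c' {}d' ab' cd' P1 P2 P3 P4 aa bb cc dd.
  set m := (a' + b') / 2 in P1 P2 P3 P4 *; set n := (c' + d') / 2 in P1 P2 P3 P4 *.
  have hm : a' <= m <= b' by rewrite /m; lra.
  have hn : c' <= n <= d' by rewrite /n; lra.
  have /andP[hm1 hm2] := hm; have /andP[hn1 hn2] := hn.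
  have {}cH : rect_cont H a' b' c' d' by apply: rect_cont_sub cH.
  rewrite (rI_vsplit hm cd' cH) (rI_hsplit hm1 hn); last by apply: rect_cont_sub cH.
  rewrite (rI_hsplit hm2 hn); last by apply: rect_cont_sub cH.
  have {}P1 : cabs (rI H a' m c' n) <= e * (m - a' + (n - c')) ^+ 2 by apply: P1; lra.
  have {}P2 : cabs (rI H m b' c' n) <= e * (b' - m + (n - c')) ^+ 2 by apply: P2; lra.
  have {}P3 : cabs (rI H a' m n d') <= e * (m - a' + (d' - n)) ^+ 2 by apply: P3; lra.
  have {}P4 : cabs (rI H m b' n d') <= e * (b' - m + (d' - n)) ^+ 2 by apply: P4; lra.
  have -> : e * (b' - a' + (d' - c')) ^+ 2 =
    (e * (m - a' + (n - c')) ^+ 2 + e * (m - a' + (d' - n)) ^+ 2) +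
    (e * (b' - m + (n - c')) ^+ 2 + e * (b' - m + (d' - n)) ^+ 2).
    by rewrite /m /n; field.
  by rewrite (le_trans (cabsD _ _)) // lerD // (le_trans (cabsD _ _)) // lerD.
move=> x y xab ycd.
have [l Hl] := dH (x +i* y)%C (conj xab ycd).
(* A quarter of [e] makes up for the factor 4 in [rI_bound]. *)
have e4 : 0 < e / 4 by rewrite divr_gt0.
have [dl dl0 {}Hl] := Hl _ e4.
exists (dl / 4); first by rewrite divr_gt0.
move=> a' b' c' d' aa xab' bb cc ycd' dd lab lcd _ _ _ _.
set p := (x +i* y)%C in Hl *.
have ab' : a' <= b' by lra.
have cd' : c' <= d' by lra.
have {}cH : rect_cont H a' b' c' d' by apply: rect_cont_sub cH.
set s := b' - a' + (d' - c').
have pr : inrect a' b' c' d' p by split.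
(* The first-order expansion of [H] at [p] has boundary integral 0, and [H] differs from it by at
   most [e / 4 * s] on the rectangle. *)
pose A z := (H p - l * p) + l * z.
have -> : H = (fun z => (H z - A z) + A z) by apply/funext => z; rewrite subrK.
have cA : rect_cont A a' b' c' d' by move=> z _; exact: ccont_affine.
have cHA : rect_cont (fun z => H z - A z) a' b' c' d'.
  move=> z zr f f0; have f2 : 0 < f / 2 by rewrite divr_gt0.
  have [d1 d10 h1] := cH z zr _ f2; have [d2 d20 h2] := cA z zr _ f2.
  exists (Num.min d1 d2); first by rewrite lt_min d10.
  move=> w; rewrite lt_min => /andP[/h1 k1 /h2 k2].
  rewrite (_ : _ - _ - _ = (H w - H z) - (A w - A z)); last by ring.
  by rewrite (le_trans (cabsB _ _)) // [f]splitr lerD.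
rewrite rID // rI_affine // addr0.
have -> : e * s ^+ 2 = 4 * (e / 4 * s) * s by field.
apply: rI_bound => // z zr.
have zp := inrect_dist zr pr; rewrite -/s in zp.
have -> : H z - A z = H (p + (z - p)) - H p - l * (z - p).
  by rewrite (addrC p) subrK /A; ring.
rewrite (le_trans (Hl _ _)) //; first by rewrite (le_lt_trans zp) // /s; lra.
by rewrite ler_pM2l.
Qed.

(** The point [p] is enclosed in a square of side 2e clipped to the rectangle. The rest splits into
    four rectangles that avoid [p] or are degenerate, and since [H] is bounded the small one
    contributes at most 16 M e. *)
Theorem goursat_except H a b c d p (M : R) : a <= b -> c <= d ->
  rect_cont H a b c d -> (forall z, inrect a b c d z -> cabs (H z) <= M) ->
  (forall z, inrect a b c d z -> z != p -> exists l, cdiff H z l) ->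
  rI H a b c d = 0.
Proof.
move=> ab cd cH bM dH.
have good a' b' c' d' : a <= a' -> a' <= b' -> b' <= b -> c <= c' -> c' <= d' -> d' <= d ->
    ~ inrect a' b' c' d' p -> rI H a' b' c' d' = 0.
  move=> h1 h2 h3 h4 h5 h6 np; apply: goursat => // z zr; apply: dH.
    by case: zr => /andP[? ?] /andP[? ?]; split; lra.
  by apply/eqP => zp; apply: np; rewrite -zp.
have [pr|] := pselect (inrect a b c d p); last exact: good.
have M0 : 0 <= M by rewrite (le_trans _ (bM _ pr)) ?cabs_ge0.
apply/eqP; rewrite -cabs_eq0 eq_le cabs_ge0 andbT.
apply: (@le0_of_eps _ (16 * M)) => [|e e0]; first by rewrite mulr_ge0.
case: p pr dH good => x y pr _ good.
have [/andP[p1 p2] /andP[p3 p4]] : a <= x <= b /\ c <= y <= d by [].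
pose a' := Num.max a (x - e); pose b' := Num.min b (x + e).
pose c' := Num.max c (y - e); pose d' := Num.min d (y + e).
have ha1 : a <= a' by rewrite le_max lexx.
have ha2 : a' <= x by rewrite ge_max p1; lra.
have hb1 : b' <= b by rewrite ge_min lexx.
have hb2 : x <= b' by rewrite le_min p2; lra.
have hc1 : c <= c' by rewrite le_max lexx.
have hc2 : c' <= y by rewrite ge_max p3; lra.
have hd1 : d' <= d by rewrite ge_min lexx.
have hd2 : y <= d' by rewrite le_min p4; lra.
have hae : x - e <= a' by rewrite le_max lexx orbT.
have hbe : b' <= x + e by rewrite ge_min lexx orbT.
have hce : y - e <= c' by rewrite le_max lexx orbT.
have hde : d' <= y + e by rewrite ge_min lexx orbT.
have dega u v w : rI H u u v w = 0 by rewrite /rI !Cint_pt !subrr mulr0 addr0.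
have degc u v w : rI H u v w w = 0 by rewrite /rI !Cint_pt !subrr mulr0 addr0.
(* Either clipping leaves no strip on this side, or the edge of the strip lies at distance [e] from
   [p]. *)
have E1 : rI H a a' c d = 0.
  have [->|ne] := eqVneq a' a; first exact: dega.
  apply: good => //; try lra; move=> [/= /andP[_ q] _].
  move: ne q; rewrite /a'; case: (leP a (x - e)) => ?; rewrite ?eqxx // => _ ?.
  lra.
have E2 : rI H b' b c d = 0.
  have [->|ne] := eqVneq b' b; first exact: dega.
  apply: good => //; try lra; move=> [/= /andP[q _] _].
  move: ne q; rewrite /b'; case: (leP b (x + e)) => ?; rewrite ?eqxx // => _ ?.
  lra.
have E3 : rI H a' b' c c' = 0.
  have [->|ne] := eqVneq c' c; first exact: degc.
  apply: good => //; try lra; move=> [_ /= /andP[_ q]].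
  move: ne q; rewrite /c'; case: (leP c (y - e)) => ?; rewrite ?eqxx // => _ ?.
  lra.
have E4 : rI H a' b' d' d = 0.
  have [->|ne] := eqVneq d' d; first exact: degc.
  apply: good => //; try lra; move=> [_ /= /andP[q _]].
  move: ne q; rewrite /d'; case: (leP d (y + e)) => ?; rewrite ?eqxx // => _ ?.
  lra.
rewrite (@rI_vsplit H a' a b c d) //; last by lra.
rewrite E1 add0r (@rI_vsplit H b' a' b c d) //; [|lra|by apply: rect_cont_sub cH].
rewrite E2 addr0 (@rI_hsplit H c' a' b' c d) //; [|lra|lra|by apply: rect_cont_sub cH].
rewrite E3 add0r (@rI_hsplit H d' a' b' c' d) //; [|lra|lra|by apply: rect_cont_sub cH].
rewrite E4 addr0.
have S : (b' - a') + (d' - c') <= 4 * e by lra.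
rewrite (le_trans (@rI_bound H a' b' c' d' M _ _ _ _)) //; try lra.
- by apply: rect_cont_sub cH.
- move=> z [/andP[? ?] /andP[? ?]]; apply: bM; split; lra.
- have -> : e * (16 * M) = 4 * M * (4 * e) by ring.
  by rewrite ler_wpM2l // mulr_ge0.
Qed.

End Goursat.

(** * The complex exponential *)

Section ComplexExponential.
Variable R : realType.
Implicit Types (z w : R[i]) (x y : R).

Lemma is_derive_approx (f : R -> R) (x l : R) : is_derive x (1 : R) f l ->
  forall e, 0 < e -> exists2 d, 0 < d &
    forall h, `|h| < d -> `|f (x + h) - f x - l * h| <= e * `|h|.
Proof.
move=> [df fl] e e0; move: df => /cvgrPdist_le /(_ e e0) /nbhs_ballP[d /= d0 Hd].
exists d => // h hd.
have [->|h0] := eqVneq h 0; first by rewrite addr0 subrr mulr0 subrr normr0 mulr0.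
have := Hd h; rewrite /ball /= sub0r normrN => /(_ hd h0).
rewrite -/(derive _ _ _) fl /GRing.scale /= mulr1 (addrC h x).
have -> : l - h^-1 * (f (x + h) - f x) = - (h^-1 * (f (x + h) - f x - l * h)).
  by field.
by rewrite normrN normrM normfV ler_pdivrMl ?normr_gt0 // (mulrC `|h|).
Qed.

Definition cexp z : R[i] :=
  (expR (complex.Re z) * cos (complex.Im z) +i* (expR (complex.Re z) * sin (complex.Im z)))%C.

Lemma cexpD z w : cexp (z + w) = cexp z * cexp w.
Proof.
apply: complex_ext; rewrite ?cReM ?cImM /= ReD ImD expRD ?cosD ?sinD; ring.
Qed.

Lemma cexp0 : cexp 0 = 1.
Proof. by rewrite /cexp /= expR0 cos0 sin0 mulr1 mulr0. Qed.

Lemma cabs_cexp z : cabs (cexp z) = expR (complex.Re z).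
Proof.
rewrite cabsE !exprMn -mulrDr cos2Dsin2 mulr1 sqrtr_sqr ger0_norm //.
Qed.

Lemma cexp_neq0 z : cexp z != 0.
Proof. by rewrite -cabs_gt0 cabs_cexp expR_gt0. Qed.

Lemma cexpN z : cexp (- z) = (cexp z)^-1.
Proof.
apply: (mulfI (cexp_neq0 z)).
by rewrite -cexpD subrr cexp0 mulfV // cexp_neq0.
Qed.

Lemma cexp_2pi z : cexp (z + (pi *+ 2)*i%C) = cexp z.
Proof. by rewrite /cexp /= ReD ImD /= addr0 cosD2pi sinD2pi. Qed.

Lemma cexp_eq1 z : `|complex.Im z| <= pi -> cexp z = 1 -> z = 0.
Proof.
move=> zpi z1; have := congr1 (@cabs R) z1; rewrite cabs_cexp cabs1 -expR0 => /expR_inj x0.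
have := congr1 (@complex.Re R) z1; rewrite /cexp /= x0 expR0 mul1r => y0.
apply: complex_ext => //=; have [z0|z0] := leP 0 (complex.Im z).
- apply: (@cos_inj R); rewrite ?in_itv /= ?cos0 ?lexx ?pi_ge0 ?z0 //.
  by rewrite (le_trans (ler_norm _)).
- apply/eqP; rewrite -oppr_eq0; apply/eqP; apply: (@cos_inj R).
  + by rewrite in_itv /= oppr_ge0 ltW //= -[- _]ger0_norm ?normrN // oppr_ge0 ltW.
  + by rewrite in_itv /= lexx pi_ge0.
  + by rewrite cosN y0 cos0.
Qed.

Lemma cexp_inj z w : `|complex.Im z - complex.Im w| <= pi -> cexp z = cexp w -> z = w.
Proof.
move=> zw E; apply/eqP; rewrite -subr_eq0; apply/eqP; apply: cexp_eq1.
  by rewrite ImD ImN.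
by rewrite cexpD cexpN E mulfV // cexp_neq0.
Qed.

Lemma cdiff_cexp0 : cdiff cexp 0 1.
Proof.
(* Each coordinate below is off by at most [3 * q * cabs h], so [q <= e / 8] suffices; [q <= 1]
   keeps [expR x] below 2. *)
move=> e e0; pose q := Num.min 1 (e / 8).
have q0 : 0 < q by rewrite lt_min ltr01 divr_gt0.
have [q1 qe] : q <= 1 /\ q <= e / 8 by rewrite /q; split; rewrite ge_min lexx ?orbT.
have [d1 d10 H1] := is_derive_approx (@is_derive_expR R 0) q0.
have [d2 d20 H2] := is_derive_approx (@is_derive_cos R 0) q0.
have [d3 d30 H3] := is_derive_approx (@is_derive_sin R 0) q0.
exists (Num.min (q / 2) (Num.min d1 (Num.min d2 d3))).
  by rewrite !lt_min d10 d20 d30 divr_gt0.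
move=> h; rewrite !lt_min => /and4P[hq h1 h2 h3].
set x := complex.Re h; set y := complex.Im h.
have xh : `|x| <= cabs h by exact: cabs_Re.
have yh : `|y| <= cabs h by exact: cabs_Im.
have := H1 x (le_lt_trans xh h1); rewrite add0r expR0 mul1r => {}H1.
have := H2 y (le_lt_trans yh h2); rewrite add0r cos0 sin0 oppr0 mul0r subr0 => {}H2.
have := H3 y (le_lt_trans yh h3); rewrite add0r cos0 sin0 subr0 mul1r => {}H3.
have c0 := cabs_ge0 h.
have X1 : `|expR x - 1| <= q.
  have := ler_normD (expR x - 1 - x) x; rewrite subrK; nra.
have X2 : `|expR x| <= 2 by have := ler_normD (expR x - 1) 1; rewrite subrK normr1; lra.
have B1 : `|expR x * cos y - 1 - x| <= 3 * q * cabs h.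
  have -> : expR x * cos y - 1 - x = expR x * (cos y - 1) + (expR x - 1 - x) by ring.
  rewrite (le_trans (ler_normD _ _)) // normrM.
  have : `|expR x| * `|cos y - 1| <= 2 * (q * cabs h).
    by rewrite ler_pM // (le_trans H2) // ler_wpM2l // ltW.
  have : `|expR x - 1 - x| <= q * cabs h by rewrite (le_trans H1) // ler_wpM2l // ltW.
  lra.
have B2 : `|expR x * sin y - y| <= 3 * q * cabs h.
  have -> : expR x * sin y - y = expR x * (sin y - y) + (expR x - 1) * y by ring.
  rewrite (le_trans (ler_normD _ _)) // !normrM.
  have : `|expR x| * `|sin y - y| <= 2 * (q * cabs h).
    by rewrite ler_pM // (le_trans H3) // ler_wpM2l // ltW.
  have : `|expR x - 1| * `|y| <= q * cabs h by rewrite ler_pM.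
  lra.
rewrite add0r cexp0 mul1r (le_trans (cabs_le _)) //.
rewrite !ReD !ImD !ReN !ImN /= oppr0 addr0 -/x -/y.
have : q * cabs h <= e / 8 * cabs h by rewrite ler_wpM2r.
have := mulr_ge0 (ltW e0) c0; lra.
Qed.

Lemma cdiff_cexp z : cdiff cexp z (cexp z).
Proof.
move=> e e0; have a0 : 0 < expR (complex.Re z) by exact: expR_gt0.
have [d d0 H] := cdiff_cexp0 (divr_gt0 e0 a0); exists d => // h /H.
rewrite add0r cexp0 mul1r => {}H.
have -> : cexp (z + h) - cexp z - cexp z * h = cexp z * (cexp h - 1 - h).
  by rewrite cexpD; ring.
rewrite cabsM cabs_cexp mulrC -ler_pdivlMr //.
by rewrite mulrAC in H.
Qed.

End ComplexExponential.

(** * Circle integrals as integrals over vertical segments *)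

Section Circle.
Variable R : realType.
Implicit Types (F K H : R[i] -> R[i]) (z w : R[i]) (r rho : R).

Let pi2 : R := pi *+ 2.

Let pi2_gt0 : 0 < pi2. Proof. by rewrite /pi2 mulrn_wgt0 // pi_gt0. Qed.

(** If [H z = G (cexp z)], this is the integral of [G] over the circle of radius exp(rho) with
    respect to the angle. *)
Definition vmean H rho := Cint 0 pi2 (fun y => H (rho +i* y)%C).

(** Periodicity cancels the horizontal sides of a rectangle of height 2 pi, so Goursat's theorem
    equates the vertical ones. The rectangle is cut at height pi because [goursat_except] allows for
    one exceptional point, and at most one point of [E] lies in each half. *)
Lemma vmean_const H (M rho1 rho2 : R) (E : R[i] -> Prop) : rho1 <= rho2 ->
  (forall z, H (z + pi2*i%C) = H z) ->
  (forall z, rho1 <= complex.Re z <= rho2 -> ccont H z) ->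
  (forall z, rho1 <= complex.Re z <= rho2 -> cabs (H z) <= M) ->
  (forall z, rho1 <= complex.Re z <= rho2 -> ~ E z -> exists l, cdiff H z l) ->
  (forall z w, E z -> E w -> `|complex.Im z - complex.Im w| <= pi -> z = w) ->
  vmean H rho1 = vmean H rho2.
Proof.
move=> r12 per cH bH dH Einj.
have cr a b : rect_cont H rho1 rho2 a b by move=> z [zr _]; exact: cH.
have half a b : b - a <= pi -> a <= b -> rI H rho1 rho2 a b = 0.
  move=> ba ab.
  have [[p [Ep pr]]|np] := pselect (exists p, E p /\ inrect rho1 rho2 a b p).
    apply: (@goursat_except _ _ _ _ _ _ p M) => // [z [zr _]|z zr zp]; first exact: bH.
    apply: dH => [|Ez]; first by case: zr.
    move/eqP: zp; apply; apply: Einj => //.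
    case: zr pr => _ /andP[z1 z2] [_ /andP[p1 p2]].
    by rewrite ler_norml; apply/andP; split; lra.
  apply: goursat => // z zr; apply: dH => [|Ez]; first by case: zr.
  by apply: np; exists z.
have pp := pi_ge0 R.
have : rI H rho1 rho2 0 pi2 = 0.
  rewrite (@rI_hsplit _ H pi) //; last by rewrite /pi2; lra.
  by rewrite !half ?addr0 // /pi2; lra.
rewrite /rI.
have -> : (fun x => H (x +i* pi2)%C) = (fun x => H (x +i* 0)%C).
  apply/funext => x; rewrite -(per (x +i* 0)%C); congr H.
  by apply: complex_ext; rewrite ?ReD ?ImD /= ?addr0 ?add0r.
rewrite subrr add0r => /eqP; rewrite mulf_eq0 => /orP[/eqP E0|].
  by have := congr1 (@complex.Im R) E0 => /= /eqP; rewrite oner_eq0.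
by rewrite subr_eq0 => /eqP E0; rewrite /vmean E0.
Qed.

Lemma vmean_bound H rho (M : R) : (forall y, rcont (fun y => H (rho +i* y)%C) y) ->
  (forall y, cabs (H (rho +i* y)%C) <= M) -> cabs (vmean H rho) <= 2 * M * pi2.
Proof.
move=> c b; have := @Cint_bound _ 0 pi2 (fun y => H (rho +i* y)%C) M (ltW pi2_gt0).
by rewrite subr0; apply => [t _|t _]; [exact: c|exact: b].
Qed.

(* The logarithm turns circles around 0 into vertical segments, so the integral
   of [K dz] over a circle does not depend on the radius. *)
Lemma circle_integral0 K w (R0 M r : R) : 0 < r < R0 ->
  (forall z, cabs z < R0 -> ccont K z) ->
  (forall z, cabs z < R0 -> cabs (K z) <= M) ->
  (forall z, cabs z < R0 -> z != w -> exists l, cdiff K z l) ->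
  Cint 0 pi2 (fun t => K (cexp (ln r +i* t)%C) * cexp (ln r +i* t)%C) = 0.
Proof.
move=> /andP[r0 rR] cK bK dK.
pose H z := K (cexp z) * cexp z.
have small z : complex.Re z <= ln r -> cabs (cexp z) < R0.
  by move=> zr; rewrite cabs_cexp (le_lt_trans _ rR) // -[leRHS]lnK ?posrE // ler_expR.
have cH z : complex.Re z <= ln r -> ccont H z.
  move=> zr; have ce := cdiff_cont (cdiff_cexp z).
  by apply: ccont_mul (ccont_comp ce (cK _ (small _ zr))) ce.
have bH z : complex.Re z <= ln r -> cabs (H z) <= M * expR (complex.Re z).
  move=> zr; rewrite /H cabsM cabs_cexp ler_wpM2r ?expR_ge0 //.
  exact: bK (small _ zr).
have M0 : 0 <= M.
  by rewrite (le_trans (cabs_ge0 _) (bK 0 _)) // cabs0 (lt_trans r0).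
have const rho : rho <= ln r -> vmean H rho = vmean H (ln r).
  move=> rr; apply: (@vmean_const H (M * r) _ _ (fun z => cexp z = w)) => //.
  - by move=> z; rewrite /H cexp_2pi.
  - by move=> z /andP[_ zr]; exact: cH.
  - move=> z /andP[_ zr]; rewrite (le_trans (bH _ zr)) // ler_wpM2l //.
    by rewrite -[leRHS]lnK ?posrE // ler_expR.
  - move=> z /andP[_ zr] ne.
    have [l Hl] := dK _ (small _ zr) (introN eqP ne).
    eexists; apply: cdiffM (cdiff_cexp z).
    by apply: cdiff_comp Hl; exact: cdiff_cexp.
  - by move=> z z' <- zz' pz; apply: cexp_inj.
rewrite -[LHS]/(vmean H (ln r)).
apply/eqP; rewrite -cabs_eq0 eq_le cabs_ge0 andbT.
apply: (@le0_of_eps _ _ (2 * M * pi2)).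
  by rewrite mulr_ge0 ?(ltW pi2_gt0) // mulr_ge0.
(* The circle shrinks to 0: the integrand is at most M exp(rho), so the common value of all these
   integrals is 0. *)
move=> e e0; pose rho := Num.min (ln r) (ln e).
have rr : rho <= ln r by rewrite ge_min lexx.
rewrite -(const rho rr).
have -> : e * (2 * M * pi2) = 2 * (M * e) * pi2 by ring.
apply: vmean_bound => y.
  by apply: rcont_comp (rcont_vert _ _) (cH _ _).
rewrite (le_trans (bH _ _)) //= ler_wpM2l // -[leRHS]lnK ?posrE // ler_expR.
by rewrite ge_min lexx orbT.
Qed.

Definition circ r (t : R) : R[i] := cexp (ln r +i* t)%C.

Lemma cabs_circ r t : 0 < r -> cabs (circ r t) = r.
Proof. by move=> r0; rewrite /circ cabs_cexp /= lnK ?posrE. Qed.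

Lemma rcont_circ r t : rcont (circ r) t.
Proof. by apply: rcont_comp (rcont_vert _ _) _; apply: cdiff_cont; exact: cdiff_cexp. Qed.

Lemma circ_neq0 r t : circ r t != 0. Proof. exact: cexp_neq0. Qed.

(** Multiplying the radius by exp(1) multiplies the integral by exp(-(n + 1)), yet by [vmean_const]
    it does not change it. *)
Lemma Cint_circ_inv r n : 0 < r -> Cint 0 pi2 (fun t => (circ r t)^-1 ^+ n.+1) = 0.
Proof.
move=> r0; pose H z : R[i] := (cexp z)^-1 ^+ n.+1.
have dH z : exists l, cdiff H z l.
  have Hi : cdiff (fun z => (cexp z)^-1) z _ := cdiffV (cdiff_cexp z) (cexp_neq0 z).
  rewrite /H; elim: n {H} => [|n [l IH]]; first by eexists; exact: Hi.
  by eexists; under eq_fun do rewrite exprS; apply: cdiffM Hi IH.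
have HE a : vmean H (ln r + a) = (((expR a)%:C)^-1)%C ^+ n.+1 * vmean H (ln r).
  rewrite /vmean -CintZ; last first.
    move=> t _; apply: rcont_comp (rcont_vert _ _) _.
    by have [l] := dH (ln r +i* t)%C; exact: cdiff_cont.
  apply: eq_Cint => t _; rewrite /H -exprMn -invfM; congr (_^-1 ^+ _).
  have -> : ((ln r + a) +i* t = (a%:C) + (ln r +i* t))%C by simpc; rewrite addrC.
  by rewrite cexpD; congr (_ * _); rewrite /cexp /= cos0 sin0 mulr1 mulr0.
have : vmean H (ln r) = vmean H (ln r + 1).
  apply: (@vmean_const H ((expR (- ln r)) ^+ n.+1) _ _ (fun=> False)) => //.
  - by rewrite lerDl.
  - by move=> z; rewrite /H cexp_2pi.
  - by move=> z _; have [l] := dH z; exact: cdiff_cont.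
  - move=> z /andP[zr _]; rewrite /H cabsX cabsV cabs_cexp -expRN.
    by rewrite ler_pXn2r ?nnegrE ?(ltW (expR_gt0 _)) // ler_expR lerN2.
rewrite HE => E.
have : (1 - (((expR 1)%:C)^-1)%C ^+ n.+1) * vmean H (ln r) = 0.
  by rewrite mulrBl mul1r -E subrr.
move=> /eqP; rewrite mulf_eq0 => /orP[|/eqP //].
rewrite subr_eq0 => /eqP /(congr1 (@cabs R)).
rewrite cabs1 cabsX cabsV cabs_real ger0_norm ?(ltW (expR_gt0 _)) // => /eqP.
rewrite gt_eqF // exprn_ilt1 ?invr_ge0 ?(ltW (expR_gt0 _)) //.
by rewrite invf_lt1 ?expR_gt0 // expR_gt1.
Qed.

End Circle.

(** * Cauchy's formula and Taylor's expansion *)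

Section CauchyFormula.
Variable R : realType.
Implicit Types (F : R[i] -> R[i]) (z w : R[i]) (r M : R) (n k : nat).
Local Notation pi2 := (pi *+ 2 : R).

Lemma pi2_gt0 : 0 < pi2. Proof. by rewrite mulrn_wgt0 // pi_gt0. Qed.

Lemma ccont_cst (c : R[i]) z : ccont (fun=> c) z.
Proof. exact: cdiff_cont (cdiff_cst c z). Qed.

Lemma ccont_id z : ccont id z.
Proof. exact: cdiff_cont (cdiff_id z). Qed.

Lemma ccontV F z : ccont F z -> F z != 0 -> ccont (fun z => (F z)^-1) z.
Proof. by move=> cF Fz; apply: ccont_comp cF _; apply: cdiff_cont; exact: cdiff_inv. Qed.

Lemma ccontX F n z : ccont F z -> ccont (fun z => F z ^+ n) z.
Proof.
move=> cF; elim: n => [|n IH].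
  by under eq_fun do rewrite expr0; exact: ccont_cst.
by under eq_fun do rewrite exprS; exact: ccont_mul.
Qed.

Lemma ccontD F G z : ccont F z -> ccont G z -> ccont (fun z => F z + G z) z.
Proof.
move=> H1 H2 e e0; have e2 : 0 < e / 2 by rewrite divr_gt0.
have [d d0 {}H1] := H1 _ e2; have [d' d'0 {}H2] := H2 _ e2.
exists (Num.min d d'); first by rewrite lt_min d0.
move=> s; rewrite lt_min => /andP[/H1 {}H1 /H2 {}H2].
by rewrite opprD addrACA [e]splitr (le_trans (cabsD _ _)) // lerD.
Qed.

Lemma circle_kernel F w (R0 M r : R) : 0 < r < R0 -> cabs w < r ->
  (forall z, cabs z < R0 -> exists l, cdiff F z l) ->
  (forall z, cabs z < R0 -> cabs (F z) <= M) ->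
  Cint 0 pi2 (fun t => F (circ r t) * (circ r t / (circ r t - w))) =
  F w * Cint 0 pi2 (fun t => circ r t / (circ r t - w)).
Proof.
move=> /andP[r0 rR] wr dF bF; have wR := lt_trans wr rR.
have [l Hl] := dF _ wR.
pose K z := if z == w then l else (F z - F w) / (z - w).
have zw t : circ r t - w != 0.
  by rewrite subr_eq0; apply/eqP => E; move: wr; rewrite -E cabs_circ // ltxx.
have dK z : cabs z < R0 -> z != w -> exists l, cdiff K z l.
  move=> zR zw'; have [l' Hl'] := dF _ zR.
  have zw0 : z - w != 0 by rewrite subr_eq0.
  have H1 := cdiffM (cdiffB Hl' (cdiff_cst (F w) z))
    (cdiffV (cdiffB (cdiff_id z) (cdiff_cst w z)) zw0).
  have zp : 0 < cabs (z - w) by rewrite cabs_gt0.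
  eexists; apply: (cdiff_ext zp _ H1).
  move=> v vz /=; rewrite /K ifN //; apply: contraTN vz => /eqP ->.
  by rewrite cabs_distC ltxx.
have cK z : cabs z < R0 -> ccont K z.
  move=> zR; have [->|ne] := eqVneq z w; last by have [l'] := dK _ zR ne; exact: cdiff_cont.
  move=> e e0; have [d d0 Hd] := Hl _ e0; exists d => // v vd.
  rewrite /K eqxx; case: eqVneq => [_|vw]; first by rewrite subrr cabs0 ltW.
  have vw0 : v - w != 0 by rewrite subr_eq0.
  have := Hd _ vd; rewrite (addrC w) subrK => H1.
  have -> : (F v - F w) / (v - w) - l = (F v - F w - l * (v - w)) / (v - w) by field.
  by rewrite cabsM cabsV ler_pdivrMr // cabs_gt0.
have [d d0 Hd] := Hl _ ltr01.
have M0 : 0 <= M by rewrite (le_trans (cabs_ge0 _) (bF _ wR)).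
(* Within [d] of [w] differentiability bounds the quotient by 1 + |l|; farther away its numerator is
   at most 2 M. *)
have bK z : cabs z < R0 -> cabs (K z) <= 1 + cabs l + (M + M) / d.
  have Md : 0 <= (M + M) / d by rewrite divr_ge0 ?(ltW d0) // addr_ge0.
  have l0 := cabs_ge0 l.
  move=> zR; rewrite /K; case: eqVneq => [_|vw]; first by lra.
  have vw0 : z - w != 0 by rewrite subr_eq0.
  have [zd|zd] := ltP (cabs (z - w)) d.
    have := Hd _ zd; rewrite (addrC w) subrK mul1r => H1.
    have -> : (F z - F w) / (z - w) = (F z - F w - l * (z - w)) / (z - w) + l by field.
    have : cabs ((F z - F w - l * (z - w)) / (z - w)) <= 1.
      by rewrite cabsM cabsV ler_pdivrMr ?mul1r // cabs_gt0.
    have := cabsD ((F z - F w - l * (z - w)) / (z - w)) l; lra.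
  suff : cabs ((F z - F w) / (z - w)) <= (M + M) / d by lra.
  rewrite cabsM cabsV ler_pM ?invr_ge0 ?cabs_ge0 //.
    by rewrite (le_trans (cabsB _ _)) // lerD // bF.
  by rewrite lef_pV2 ?posrE // cabs_gt0.
have r0R : 0 < r < R0 by rewrite r0.
have := circle_integral0 r0R cK bK dK => /eqP.
rewrite (_ : (fun t => _) = (fun t => F (circ r t) * (circ r t / (circ r t - w)) +
   (- F w) * (circ r t / (circ r t - w)))); last first.
  apply/funext => t; rewrite -/(circ r t) /K ifN; last by have := zw t; rewrite subr_eq0.
  by field; exact: zw.
have ck t : rcont (fun t => circ r t / (circ r t - w)) t.
  apply: (@rcont_comp _ (fun z => z / (z - w))) (rcont_circ _ _) _.
  apply: ccont_mul (ccont_id _) _.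
  by apply: ccontV => //; apply: ccontD (ccont_id _) (ccont_cst _ _).
rewrite CintD; first last.
- by move=> t _; apply: rcontZ; exact: ck.
- move=> t _.
  have cF : ccont F (circ r t).
    have [|l' ] := dF (circ r t); first by rewrite cabs_circ.
    exact: cdiff_cont.
  apply: (@rcont_comp _ (fun z => F z * (z / (z - w)))) (rcont_circ _ _) _.
  apply: ccont_mul cF _; apply: ccont_mul (ccont_id _) _.
  by apply: ccontV => //; apply: ccontD (ccont_id _) (ccont_cst _ _).
rewrite CintZ; last by move=> t _; exact: ck.
by rewrite mulNr subr_eq0 => /eqP.
Qed.

(** The finite geometric expansion of z / (z - w) in powers of w / z, with the remainder kept as an
    integral. *)
Lemma circle_expand F w r n : 0 < r -> cabs w < r ->
  (forall t, ccont F (circ r t)) ->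
  Cint 0 pi2 (fun t => F (circ r t) * (circ r t / (circ r t - w))) =
  \sum_(k < n) Cint 0 pi2 (fun t => F (circ r t) * (circ r t)^-1 ^+ k) * w ^+ k +
  Cint 0 pi2 (fun t => F (circ r t) * ((w / circ r t) ^+ n * (circ r t / (circ r t - w)))).
Proof.
move=> r0 wr cF.
have zw t : circ r t - w != 0.
  by rewrite subr_eq0; apply/eqP => E; move: wr; rewrite -E cabs_circ // ltxx.
elim: n => [|n IH].
  by rewrite big_ord0 add0r; apply: eq_Cint => t _; rewrite expr0 mul1r.
rewrite {}IH big_ord_recr /= -addrA; congr (_ + _).
rewrite mulrC -CintZ; last first.
  move=> t _; apply: (@rcont_comp _ (fun z => F z * z^-1 ^+ n)) (rcont_circ _ _) _.
  apply: ccont_mul (cF t) (ccontX _ (ccontV (ccont_id _) (circ_neq0 _ _))).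
rewrite -CintD; first last.
- move=> t _.
  apply: (@rcont_comp _ (fun z => F z * ((w / z) ^+ n.+1 * (z / (z - w))))) (rcont_circ _ _) _.
  apply: ccont_mul (cF t) _; apply: ccont_mul.
    by apply: ccontX; apply: ccont_mul (ccont_cst _ _) (ccontV (ccont_id _) (circ_neq0 _ _)).
  apply: ccont_mul (ccont_id _) _; apply: ccontV => //.
  by apply: ccontD (ccont_id _) (ccont_cst _ _).
- move=> t _.
  apply: rcontZ; apply: (@rcont_comp _ (fun z => F z * z^-1 ^+ n)) (rcont_circ _ _) _.
  apply: ccont_mul (cF t) (ccontX _ (ccontV (ccont_id _) (circ_neq0 _ _))).
apply: eq_Cint => t _; rewrite exprS !exprMn.
have := zw t; have := circ_neq0 r t; move: (circ r t) => z z0 zw0.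
rewrite exprVn; field; rewrite zw0 z0 /=.
by rewrite expf_neq0.
Qed.

Lemma circle_rem F w r M n : 0 < r -> cabs w < r -> 0 <= M ->
  (forall t, ccont F (circ r t)) -> (forall t, cabs (F (circ r t)) <= M) ->
  cabs (Cint 0 pi2 (fun t => F (circ r t) * ((w / circ r t) ^+ n * (circ r t / (circ r t - w))))) <=
  2 * (M * ((cabs w / r) ^+ n * (r / (r - cabs w)))) * pi2.
Proof.
move=> r0 wr M0 cF bF.
have zw t : circ r t - w != 0.
  by rewrite subr_eq0; apply/eqP => E; move: wr; rewrite -E cabs_circ // ltxx.
rewrite -[X in _ <= _ * X]subr0; apply: Cint_bound => [|t _|t _].
- by rewrite ltW // pi2_gt0.
- apply: (@rcont_comp _ (fun z => F z * ((w / z) ^+ n * (z / (z - w))))) (rcont_circ _ _) _.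
  apply: ccont_mul (cF t) _; apply: ccont_mul.
    by apply: ccontX; apply: ccont_mul (ccont_cst _ _) (ccontV (ccont_id _) (circ_neq0 _ _)).
  apply: ccont_mul (ccont_id _) _; apply: ccontV => //.
  by apply: ccontD (ccont_id _) (ccont_cst _ _).
- rewrite 2!cabsM cabsX 2!cabsM 2!cabsV cabs_circ // ler_pM //.
  + exact: cabs_ge0.
  + apply: mulr_ge0; first by rewrite exprn_ge0 // divr_ge0 ?cabs_ge0 // ltW.
    by rewrite divr_ge0 ?cabs_ge0 // ltW.
  + rewrite ler_wpM2l //; first by rewrite exprn_ge0 // divr_ge0 ?cabs_ge0 // ltW.
    rewrite ler_wpM2l ?(ltW r0) // lef_pV2 ?posrE ?subr_gt0 // ?cabs_gt0 //.
    by rewrite (le_trans _ (cabs_sub_ge _ _)) // cabs_circ.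
Qed.

Lemma pow_small (q C e : R) : 0 <= q < 1 -> 0 <= C -> 0 < e -> exists n, q ^+ n * C <= e.
Proof.
move=> /andP[q0 q1] C0 e0.
have qn : `|q| < 1 by rewrite ger0_norm.
have := cvg_expr qn => /cvgrPdist_le /(_ (e / (C + 1))).
have C1 : 0 < C + 1 by lra.
move=> /(_ (divr_gt0 e0 C1)) [n _ Hn]; exists n.
have := Hn n (leqnn n); rewrite sub0r normrN /= ger0_norm ?exprn_ge0 //.
rewrite ler_pdivlMr // => H.
have := exprn_ge0 n q0; nra.
Qed.

(** The function 1 is expanded along the circle: the term k = 0 gives 2 pi, the other terms vanish
    by [Cint_circ_inv], and the remainder tends to 0. The sum has [n.+1] terms so that k = 0 always
    occurs. *)
Lemma circle_winding w r : 0 < r -> cabs w < r ->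
  Cint 0 pi2 (fun t => circ r t / (circ r t - w)) = ((pi2)%:C)%C.
Proof.
move=> r0 wr; apply/eqP; rewrite -subr_eq0 -cabs_eq0 eq_le cabs_ge0 andbT.
apply: (@le0_of_eps _ _ 1) => // e e0; rewrite mulr1.
have p0 := ltW pi2_gt0.
have rw : 0 < r - cabs w by rewrite subr_gt0.
have [||n Hn] := @pow_small (cabs w / r) (2 * (r / (r - cabs w)) * pi2) e _ _ e0.
- by rewrite divr_ge0 ?cabs_ge0 ?(ltW r0) //= ltr_pdivrMr ?mul1r.
- by rewrite mulr_ge0 // mulr_ge0 // divr_ge0 // ltW.
have := @circle_expand (fun=> 1) w r n.+1 r0 wr (fun t => ccont_cst _ _).
have -> : Cint 0 pi2 (fun t => 1 * (circ r t / (circ r t - w))) =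
   Cint 0 pi2 (fun t => circ r t / (circ r t - w)) by apply: eq_Cint => t _; rewrite mul1r.
have -> : \sum_(k < n.+1) Cint 0 pi2 (fun t => 1 * (circ r t)^-1 ^+ k) * w ^+ k = ((pi2)%:C)%C.
  rewrite big_ord_recl big1 ?addr0; last first.
    move=> k _; rewrite (_ : Cint _ _ _ = 0) ?mul0r // -(Cint_circ_inv k r0).
    by apply: eq_Cint => t _; rewrite mul1r.
  rewrite (_ : w ^+ _ = 1) // mulr1 -[RHS]mul1r -[in RHS](subr0 (pi2)) -Cint_cst ?p0 //.
  by apply: eq_Cint => t _; rewrite expr0 mulr1.
move=> ->; rewrite addrC addKr.
rewrite (le_trans (@circle_rem (fun=> 1) w r 1 n.+1 r0 wr _ _ _)) //.
- by move=> t; exact: ccont_cst.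
- by move=> t; rewrite cabs1.
- rewrite mul1r (le_trans _ Hn) // exprS.
  have -> : 2 * (cabs w / r * (cabs w / r) ^+ n * (r / (r - cabs w))) * pi2 =
    cabs w / r * ((cabs w / r) ^+ n * (2 * (r / (r - cabs w)) * pi2)) by ring.
  apply: ler_piMl; last by rewrite ler_pdivrMr // mul1r ltW.
  rewrite mulr_ge0 ?exprn_ge0 ?divr_ge0 ?cabs_ge0 ?(ltW r0) // mulr_ge0 //.
  by rewrite mulr_ge0 // divr_ge0 // ltW.
Qed.

(** The remainder is explicit because it is used in two ways: for small [n] it identifies values and
    derivatives at the centre, for large [n] it gives uniform approximation. *)
Theorem taylor F (R0 M r : R) : 0 < r < R0 ->
  (forall z, cabs z < R0 -> exists l, cdiff F z l) ->
  (forall z, cabs z < R0 -> cabs (F z) <= M) ->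
  exists c : nat -> R[i], (forall k, cabs (c k) <= 2 * M / r ^+ k) /\
    forall n w, cabs w < r -> cabs (F w - \sum_(k < n) c k * w ^+ k) <=
      2 * M * ((cabs w / r) ^+ n * (r / (r - cabs w))).
Proof.
move=> /andP[r0 rR] dF bF.
have M0 : 0 <= M by rewrite (le_trans (cabs_ge0 _) (bF 0 _)) // cabs0 (lt_trans r0).
have sm t : cabs (circ r t) < R0 by rewrite cabs_circ.
have cF t : ccont F (circ r t) by have [l] := dF _ (sm t); exact: cdiff_cont.
have p0 : 0 < pi2 := pi2_gt0.
have pC0 : ((pi2)%:C)%C != 0 :> R[i] by rewrite -cabs_gt0 cabs_real normr_gt0 gt_eqF.
have pV : cabs (((pi2)%:C)%C^-1 : R[i]) = (pi2)^-1.
  by rewrite cabsV cabs_real ger0_norm // ltW.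
exists (fun k => ((pi2)%:C)%C^-1 * Cint 0 pi2 (fun t => F (circ r t) * (circ r t)^-1 ^+ k)).
split=> [k|n w wr].
  rewrite cabsM pV ler_pdivrMl // mulrC -[X in _ <= _ * X]subr0 -mulrA.
  apply: Cint_bound => [|t _|t _]; first exact: ltW.
  - apply: (@rcont_comp _ (fun z => F z * z^-1 ^+ k)) (rcont_circ _ _) _.
    exact: ccont_mul (cF t) (ccontX _ (ccontV (ccont_id _) (circ_neq0 _ _))).
  - rewrite cabsM cabsX cabsV cabs_circ // exprVn ler_wpM2r ?bF //.
    by rewrite invr_ge0 exprn_ge0 // ltW.
have r0R : 0 < r < R0 by rewrite r0.
have := circle_kernel r0R wr dF bF.
rewrite circle_winding // (circle_expand n r0 wr cF).
set S := \sum_(_ < _) _; set E := Cint _ _ _ => EQ.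
have -> : F w - \sum_(k < n) ((pi2)%:C)%C^-1 *
    Cint 0 pi2 (fun t => F (circ r t) * (circ r t)^-1 ^+ k) * w ^+ k = ((pi2)%:C)%C^-1 * E.
  have -> : F w = ((pi2)%:C)%C^-1 * (S + E) by rewrite EQ mulrC mulfK.
  rewrite mulrDr /S mulr_sumr.
  under eq_bigr do rewrite mulrA.
  by rewrite addrC addKr.
rewrite cabsM pV ler_pdivrMl // mulrC -mulrA.
by apply: circle_rem => // t; apply: bF.
Qed.


End CauchyFormula.

(** * Cauchy estimates in discs and in the half-plane *)

Section DiscEstimates.
Variable R : realType.
Implicit Types (F f h : R[i] -> R[i]) (z w l : R[i]) (M r a : R).
Notation Cn := ((R[i] : numFieldType)^o).

(** Order 1 of the expansion at w = 0 identifies the constant term; order 2 shows that the next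
    coefficient is a derivative, hence equal to [l] by uniqueness. For |w| <= r / 2 the factor r /
    (r - |w|) is at most 2. *)
Lemma holo_disc_est F z0 (R0 M r : R) l : 0 < r < R0 ->
  (forall z, cabs (z - z0) < R0 -> exists l, cdiff F z l) ->
  (forall z, cabs (z - z0) < R0 -> cabs (F z) <= M) -> cdiff F z0 l ->
  cabs l <= 2 * M / r /\
  forall w, cabs w <= r / 2 ->
    cabs (F (z0 + w) - F z0 - l * w) <= 4 * M * (cabs w ^+ 2 / r ^+ 2).
Proof.
move=> rR dF bF Hl; have /andP[r0 rR0] := rR.
pose G z := F (z + z0).
have dG z : cabs z < R0 -> exists l, cdiff G z l.
  move=> zR; have [|l' Hl'] := dF (z + z0); first by rewrite addrK.
  by exists l'; exact: cdiff_shift.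
have bG z : cabs z < R0 -> cabs (G z) <= M.
  by move=> zR; apply: bF; rewrite addrK.
have M0 : 0 <= M by rewrite (le_trans (cabs_ge0 _) (bG 0 _)) // cabs0 (lt_trans r0).
have [c [cb ct]] := taylor rR dG bG.
have c0 : c 0%N = F z0.
  have := ct 1%N 0; rewrite cabs0 => /(_ r0).
  rewrite big_ord1 expr0 mulr1 mul0r expr1 mul0r mulr0 => c0.
  by apply/eqP; rewrite eq_sym -subr_eq0 -cabs_eq0 eq_le cabs_ge0 andbT -[F z0]/(F z0) -[z0 in F z0]add0r.
have est w : cabs w <= r / 2 ->
    cabs (F (z0 + w) - F z0 - c 1%N * w) <= 4 * M * (cabs w ^+ 2 / r ^+ 2).
  move=> wr; have w0 := cabs_ge0 w; have wr' : cabs w < r by lra.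
  have := ct 2%N w wr'.
  rewrite big_ord_recr big_ord1 /= expr0 mulr1 c0 expr1 opprD addrA /G (addrC w).
  move=> /le_trans; apply; rewrite expr_div_n.
  have -> : 4 * M * (cabs w ^+ 2 / r ^+ 2) = 2 * M * (cabs w ^+ 2 / r ^+ 2 * 2) by ring.
  rewrite ler_wpM2l ?mulr_ge0 // ler_wpM2l ?divr_ge0 ?exprn_ge0 ?(ltW r0) //.
  by rewrite ler_pdivrMr; lra.
have c1 : cdiff F z0 (c 1%N).
  move=> e e0; have K0 : 0 < 4 * M / r ^+ 2 + 1.
    by rewrite ltr_wpDl // divr_ge0 ?mulr_ge0 ?exprn_ge0 // ltW.
  exists (Num.min (r / 2) (e / (4 * M / r ^+ 2 + 1))).
    by rewrite lt_min !divr_gt0.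
  move=> w; rewrite lt_min => /andP[w1 w2].
  rewrite (le_trans (est _ (ltW w1))) //.
  have -> : 4 * M * (cabs w ^+ 2 / r ^+ 2) = 4 * M / r ^+ 2 * cabs w * cabs w.
    by field; rewrite gt_eqF.
  rewrite ler_wpM2r ?cabs_ge0 //; rewrite ltr_pdivlMr // in w2.
  have := cabs_ge0 w; lra.
rewrite (cdiff_unique Hl c1); split => //.
Qed.

(* Locked: otherwise [lra] compares derivatives by unfolding limits. *)
Definition hder : (R[i] -> R[i]) -> R[i] -> R[i] :=
  locked (fun h z => 'D_1 (h : Cn -> Cn) (z : Cn)).

Lemma hderE h z : hder h z = 'D_1 (h : Cn -> Cn) (z : Cn).
Proof. by rewrite /hder -lock. Qed.

Lemma holo_cdiff h z : holo h -> 0 < complex.Re z -> cdiff h z (hder h z).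
Proof. by move=> hh z0; rewrite hderE; apply: derivable_cdiff; exact: hh. Qed.

Lemma cdiff_holo h : (forall z, 0 < complex.Re z -> exists l, cdiff h z l) -> holo h.
Proof. by move=> H z /H[l /cdiff_derivable[]]. Qed.

Lemma hder_cdiff h z l : cdiff h z l -> hder h z = l.
Proof. by rewrite hderE => /cdiff_derivable[]. Qed.

Lemma halfplane_disc a z v : a <= complex.Re z -> cabs (v - z) < a -> 0 < complex.Re v.
Proof.
move=> az vz; have := cabs_Re (v - z); rewrite ReD ReN => /ler_normlP[].
by move: (cabs _) vz => q; lra.
Qed.

Lemma hder_bound h M a z : holo h -> (forall z, 0 < complex.Re z -> cabs (h z) <= M) ->
  0 < a -> a <= complex.Re z -> cabs (hder h z) <= 4 * M / a.
Proof.
move=> hh bh a0 az.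
have ra : 0 < a / 2 < a by lra.
have [|||l] := @holo_disc_est h z a M (a / 2) (hder h z) ra.
- by move=> v /(halfplane_disc az) v0; eexists; exact: holo_cdiff.
- by move=> v /(halfplane_disc az) v0; exact: bh.
- by apply: holo_cdiff => //; lra.
by move=> _; rewrite (le_trans l) // le_eqVlt; apply/orP; left; apply/eqP; field; lra.
Qed.

(** Adding the first-order expansions at [z] and at [w], each evaluated at the other point, leaves
    (h'(z) - h'(w)) (z - w) equal to a sum of two quadratic remainders. So the first-order estimate
    alone controls the variation of h'. For points more than a / 4 apart the bound on h' itself is
    enough. *)
Lemma hder_lip h M a z w : holo h -> (forall z, 0 < complex.Re z -> cabs (h z) <= M) ->
  0 < a -> a <= complex.Re z -> a <= complex.Re w ->
  cabs (hder h z - hder h w) <= 32 * M * cabs (z - w) / a ^+ 2.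
Proof.
move=> hh bh a0 az aw.
have z0 : 0 < complex.Re z by lra.
have w0 : 0 < complex.Re w by lra.
have M0 : 0 <= M by rewrite (le_trans (cabs_ge0 _) (bh z _)).
have [->|zw] := eqVneq z w; first by rewrite !subrr cabs0 mulr0 mul0r.
have k0 : 0 < cabs (z - w) by rewrite cabs_gt0 subr_eq0.
have [big|small] := ltP (a / 4) (cabs (z - w)).
  rewrite (le_trans (cabsB _ _)) // (le_trans (lerD (hder_bound hh bh a0 az) (hder_bound hh bh a0 aw))) //.
  have -> : 4 * M / a + 4 * M / a = 8 * M * a / a ^+ 2 by field; lra.
  rewrite ler_wpM2r ?invr_ge0 ?exprn_ge0 ?(ltW a0) //.
  have -> : 32 * M * cabs (z - w) = 8 * M * (4 * cabs (z - w)) by ring.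
  by rewrite ler_wpM2l ?mulr_ge0 //; lra.
have ra : 0 < a / 2 < a by lra.
have est v : a <= complex.Re v -> forall u, cabs u <= a / 2 / 2 ->
    cabs (h (v + u) - h v - hder h v * u) <= 4 * M * (cabs u ^+ 2 / (a / 2) ^+ 2).
  move=> av; have [|||_ l] := @holo_disc_est h v a M (a / 2) (hder h v) ra.
  - by move=> x /(halfplane_disc av) x0; eexists; exact: holo_cdiff.
  - by move=> x /(halfplane_disc av) x0; exact: bh.
  - by apply: holo_cdiff => //; lra.
  exact: l.
have := est z az (w - z); rewrite (cabs_distC w) (addrC z (w - z)) subrK => E1.
have := est w aw (z - w); rewrite (addrC w) subrK => E2.
have {}E1 := E1 ltac:(lra); have {}E2 := E2 ltac:(lra).
rewrite -(ler_pM2r k0) -cabsM; clear est.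
move: (hder h z) (hder h w) (h z) (h w) E1 E2 => p q s t E1 E2.
have -> : (p - q) * (z - w) = (t - s - p * (w - z)) + (s - t - q * (z - w)) by ring.
rewrite (le_trans (cabsD _ _)) // (le_trans (lerD E1 E2)) //.
by rewrite le_eqVlt; apply/orP; left; apply/eqP; field; lra.
Qed.

Lemma cexp_quadratic w : cabs (cexp w - 1 - w) <= 4 * expR (2 + 2 * cabs w) * cabs w ^+ 2.
Proof.
have w0 := cabs_ge0 w.
have rR : 0 < 1 + 2 * cabs w < 2 + 2 * cabs w by lra.
have [|||_ H] := @holo_disc_est (@cexp R) 0 (2 + 2 * cabs w) (expR (2 + 2 * cabs w)) (1 + 2 * cabs w) 1 rR.
- by move=> z _; eexists; exact: cdiff_cexp.
- move=> z; rewrite subr0 => zr; rewrite cabs_cexp ler_expR (le_trans _ (ltW zr)) //.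
  exact: cabs_Re_ge.
- by have := cdiff_cexp (0 : R[i]); rewrite cexp0.
have := H w; rewrite add0r cexp0 mul1r => {}H.
rewrite (le_trans (H _)) //; first by lra.
rewrite ler_wpM2l ?mulr_ge0 ?expR_ge0 // ler_pdivrMr ?exprn_gt0 //; last by lra.
rewrite ler_peMr ?exprn_ge0 // exprn_ege1 //; lra.
Qed.

End DiscEstimates.

(** * Functions with a C_0 extension to the closed half-plane *)

Section C0.
Variable R : realType.
Implicit Types (f g F : R[i] -> R[i]) (z w l : R[i]).
Notation Cn := ((R[i] : numFieldType)^o).

(** The continuous extension is replaced by a Cauchy condition at each point of the closed
    half-plane. Only values in the open half-plane enter, so uniform limits there preserve the
    property. *)
Definition C0prop f :=
  (forall z, 0 <= complex.Re z -> forall e : R, 0 < e -> exists2 d : R, 0 < d &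
     forall v w, 0 < complex.Re v -> 0 < complex.Re w ->
       cabs (v - z) < d -> cabs (w - z) < d -> cabs (f v - f w) <= e) /\
  (forall e : R, 0 < e -> exists M : R, forall z,
     0 < complex.Re z -> M < cabs z -> cabs (f z) <= e).

Lemma C0cl_prop f : C0cl f -> C0prop f.
Proof.
move=> [F [cF Ff dF]]; split => [z z0 e e0|e e0]; last first.
  have [M HM] := dF e e0; exists M => z z0 Mz.
  by rewrite -Ff // ltW // HM // ltW.
move: cF => /subspace_continuousP /(_ (z : Cn) z0) /cvgrPdist_le /(_ (((e / 2)%:C)%C)).
rewrite ltcR divr_gt0 // => /(_ isT).
move=> /nbhs_ballP[d /= d0 H].
have : d \is Num.real by rewrite realE ltW.
move=> /complex_realP [d' dd']; move: d0 H; rewrite {}dd' ltcR => d0 H.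
have {}H v : 0 < complex.Re v -> cabs (v - z) < d' -> cabs (f v - F z) <= e / 2.
  move=> v0 vd; have := H v; rewrite /ball /= distrC normcE_cabs ltcR => /(_ vd (ltW v0)).
  by rewrite -[from_subspace _ _ z]/(F z) -[from_subspace _ _ v]/(F v) normcE_cabs lecR cabs_distC (Ff v v0).
exists d' => // v w v0 w0 vz wz.
rewrite (le_trans (cabs_dist_trans (F z) _ _)) // [leRHS]splitr lerD ?H //.
by rewrite cabs_distC H.
Qed.

Lemma complex_cauchy_cvg (u : nat -> R[i]) :
  (forall e : R, 0 < e -> exists N, forall n m, (N <= n)%N -> (N <= m)%N -> cabs (u n - u m) <= e) ->
  exists l, forall e : R, 0 < e -> exists N, forall n, (N <= n)%N -> cabs (u n - l) <= e.
Proof.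
move=> H.
have aux (p : R[i] -> R) : (forall z w, `|p z - p w| <= cabs (z - w)) ->
    exists l : R, forall e : R, 0 < e -> exists N, forall n, (N <= n)%N -> `|p (u n) - l| <= e.
  move=> pl; have : cvgn (p \o u).
    apply/cauchy_cvgP; apply: cauchy_exP => e e0.
    have [N HN] := H _ (divr_gt0 e0 (ltr0Sn _ 1)).
    exists (p (u N)); exists N => // n /= Nn; rewrite /ball /=.
    rewrite (le_lt_trans (pl _ _)) // (le_lt_trans (HN _ _ (leqnn N) Nn)) //.
    by rewrite ltr_pdivrMr // ltr_pMr // ltr1n.
  move=> /cvg_ex[l /cvgrPdist_le Hl]; exists l => e /Hl[N _ HN]; exists N => n /HN.
  by rewrite distrC.
have [lx Hx] := aux (@complex.Re R) (fun z w => ltac:(by rewrite -ReN -ReD cabs_Re)).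
have [ly Hy] := aux (@complex.Im R) (fun z w => ltac:(by rewrite -ImN -ImD cabs_Im)).
exists (lx +i* ly)%C => e e0; have e2 : 0 < e / 2 by rewrite divr_gt0.
have [N1 H1] := Hx _ e2; have [N2 H2] := Hy _ e2.
exists (maxn N1 N2) => n; rewrite geq_max => /andP[n1 n2].
rewrite (le_trans (cabs_le _)) // ReD ImD ReN ImN [leRHS]splitr lerD //; [exact: H1|exact: H2].
Qed.

Lemma C0prop_cl f : C0prop f -> C0cl f.
Proof.
move=> [cf df].
pose Lim z l := forall e : R, 0 < e -> exists2 d : R, 0 < d &
  forall w, 0 < complex.Re w -> cabs (w - z) < d -> cabs (f w - l) <= e.
(* Completeness gives a limit along z + 1/(n + 1), and the Cauchy condition at [z] extends it to
   every approach from the open half-plane. *)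
have exl z : 0 <= complex.Re z -> exists l, Lim z l.
  move=> z0; pose v n : R[i] := z + ((n.+1%:R^-1 : R)%:C)%C.
  have v0 n : 0 < complex.Re (v n) by rewrite ReD /= ltr_wpDl // invr_gt0.
  have vz d : 0 < d -> exists N, forall n, (N <= n)%N -> cabs (v n - z) < d.
    move=> d0; exists (Num.bound d^-1) => n Nn.
    rewrite /v (addrC z) addrK cabs_real ger0_norm ?invr_ge0 //.
    rewrite invf_plt ?posrE // (lt_le_trans (archi_boundP _)) ?invr_ge0 ?(ltW d0) //.
    by rewrite ler_nat ltnW.
  have [l Hl] : exists l, forall e : R, 0 < e -> exists N, forall n, (N <= n)%N -> cabs (f (v n) - l) <= e.
    apply: complex_cauchy_cvg => e e0; have [d d0 Hd] := cf z z0 e e0.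
    by have [N HN] := vz d d0; exists N => n m Nn Nm; apply: Hd => //; apply: HN.
  exists l => e e0; have e2 : 0 < e / 2 by rewrite divr_gt0.
  have [d d0 Hd] := cf z z0 _ e2; exists d => // w w0 wz.
  have [N1 H1] := vz d d0; have [N2 H2] := Hl _ e2.
  rewrite (le_trans (cabs_dist_trans (f (v (maxn N1 N2))) _ _)) // [leRHS]splitr lerD //.
    by apply: Hd => //; apply: H1; rewrite leq_maxl.
  by apply: H2; rewrite leq_maxr.
pose F z := if pselect (0 < complex.Re z) then f z else
  if pselect (exists l, Lim z l) is left E then projT1 (cid E) else 0.
have FLim z : 0 <= complex.Re z -> Lim z (F z).
  move=> z0; rewrite /F; case: pselect => [zp e e0|zn].
    have [d d0 Hd] := cf z z0 e e0; exists d => // w w0 wz.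
    by apply: Hd => //; rewrite subrr cabs0.
  case: pselect => [E|]; last by move=> []; exact: exl.
  by case: (cid E).
have near z d : 0 <= complex.Re z -> 0 < d -> exists2 w, 0 < complex.Re w & cabs (w - z) < d.
  move=> z0 d0; exists (z + ((d / 2)%:C)%C); first by rewrite ReD /= ltr_wpDl // divr_gt0.
  by rewrite (addrC z) addrK cabs_real ger0_norm; lra.
exists F; split.
- apply/subspace_continuousP => /= z z0; apply/cvgrPdist_le => e e0.
  have : e \is Num.real by rewrite realE ltW.
  move=> /complex_realP [e' ee']; move: e0; rewrite {}ee' ltcR => e0.
  have e2 : 0 < e' / 2 by rewrite divr_gt0.
  have [d d0 Hd] := FLim z z0 _ e2.
  (* Half of [d]: as [F w] may itself be a limit, it is compared with [f] at an interior point close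
     to [w], which must still lie within [d] of [z]. *)
  apply/nbhs_ballP; exists (((d / 2)%:C)%C) => /=; first by rewrite ltcR divr_gt0.
  move=> w; rewrite /ball /= distrC normcE_cabs ltcR => wz w0.
  rewrite normcE_cabs lecR.
  have [d1 d10 Hd1] := FLim w w0 _ e2.
  have m0 : 0 < Num.min d1 (d / 2) by rewrite lt_min d10 divr_gt0.
  have [v v0 vw] := near w _ w0 m0.
  move: vw; rewrite lt_min => /andP[vw1 vw2].
  rewrite (le_trans (cabs_dist_trans (f v) _ _)) // [leRHS]splitr lerD //.
    rewrite cabs_distC; apply: Hd => //.
    by rewrite (le_lt_trans (cabs_dist_trans w _ _)) //; lra.
  exact: Hd1.
- by move=> z z0; rewrite /F; case: pselect.
- move=> e e0; have e3 : 0 < e / 3 by rewrite divr_gt0.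
  have [M HM] := df _ e3; exists (M + 1) => z z0 Mz.
  have [d d0 Hd] := FLim z z0 _ e3.
  have m0 : 0 < Num.min d 1 by rewrite lt_min d0 ltr01.
  have [v v0] := near z _ z0 m0; rewrite lt_min => /andP[vz1 vz2].
  have {}Hd := Hd _ v0 vz1.
  have {}HM : cabs (f v) <= e / 3.
    apply: HM => //; have := cabs_sub_ge z v; rewrite cabs_distC.
    by move: (cabs _) (cabs _) (cabs _) vz2 Mz => p q s; lra.
  have := cabs_sub_ge (F z) (f v); rewrite cabs_distC.
  by move: (cabs _) (cabs _) (cabs _) Hd HM => p q s; lra.
Qed.

Lemma C0prop_limit f : (forall e : R, 0 < e -> exists2 g, C0prop g &
    forall z, 0 < complex.Re z -> cabs (f z - g z) <= e) -> C0prop f.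
Proof.
move=> H; split => [z z0 e e0|e e0].
  have e3 : 0 < e / 3 by rewrite divr_gt0.
  have [g [cg _] fg] := H _ e3; have [d d0 Hd] := cg z z0 _ e3.
  exists d => // v w v0 w0 vz wz.
  have := Hd _ _ v0 w0 vz wz; have := fg _ v0; have := fg _ w0; rewrite (cabs_distC (f w)).
  have := cabs_dist_trans (g v) (f v) (f w); have := cabs_dist_trans (g w) (g v) (f w).
  lra.
have e2 : 0 < e / 2 by rewrite divr_gt0.
have [g [_ dg] fg] := H _ e2; have [M HM] := dg _ e2.
exists M => z z0 /(HM _ z0); have := fg _ z0; have := cabs_sub_ge (f z) (g z).
lra.
Qed.

Lemma C0prop_ext f g : (forall z, 0 < complex.Re z -> f z = g z) -> C0prop f -> C0prop g.
Proof.
move=> fg Hf; apply: C0prop_limit => e e0; exists f => // z z0.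
by rewrite fg // subrr cabs0 ltW.
Qed.

Lemma C0prop_lin c f g : C0prop f -> C0prop g -> C0prop (fun z => f z + c * g z).
Proof.
move=> [cf df] [cg dg].
have k0 : 0 < 1 + cabs c by have := cabs_ge0 c; lra.
split => [z z0 e e0|e e0].
  have e2 : 0 < e / 2 by rewrite divr_gt0.
  have [d d0 H1] := cf z z0 _ e2; have [d' d'0 H2] := cg z z0 _ (divr_gt0 e2 k0).
  exists (Num.min d d'); first by rewrite lt_min d0.
  move=> v w v0 w0; rewrite !lt_min => /andP[v1 v2] /andP[w1 w2].
  rewrite opprD addrACA -mulrBr (le_trans (cabsD _ _)) // [leRHS]splitr lerD ?H1 //.
  rewrite cabsM; have := H2 _ _ v0 w0 v2 w2; rewrite ler_pdivlMr // => H.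
  by have := cabs_ge0 (g v - g w); move: (cabs (_ - _)) H => q; lra.
have e2 : 0 < e / 2 by rewrite divr_gt0.
have [M H1] := df _ e2; have [M' H2] := dg _ (divr_gt0 e2 k0).
exists (Num.max M M') => z z0; rewrite gt_max => /andP[m1 m2].
rewrite (le_trans (cabsD _ _)) // [leRHS]splitr lerD ?H1 // cabsM.
have := H2 _ z0 m2; rewrite ler_pdivlMr // => H.
by have := cabs_ge0 (g z); move: (cabs (g z)) H => q; lra.
Qed.

(** Bisection stands for compactness of the bounded part of the closed half-plane; the Cauchy
    condition covers the points of the imaginary axis. *)
Lemma C0prop_unif f (M : R) : C0prop f -> forall e : R, 0 < e -> exists2 d : R, 0 < d &
  forall v w, 0 < complex.Re v -> 0 < complex.Re w -> cabs v <= M -> cabs (v - w) < d ->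
    cabs (f v - f w) <= e.
Proof.
move=> [cf _] e e0; pose K := Num.max M 1.
have K0 : 0 <= K by rewrite le_max ler01 orbT.
pose P (a b c d : R) := exists2 dl : R, 0 < dl &
  forall v w, 0 < complex.Re v -> 0 < complex.Re w -> inrect a b c d v ->
    cabs (v - w) < dl -> cabs (f v - f w) <= e.
suff [dl dl0 H] : P 0 K (- K) K.
  exists dl => // v w v0 w0 vM vw; apply: (H v w) => //.
  have vK : cabs v <= K by rewrite (le_trans vM) // le_max lexx.
  have := cabs_Re v; have := cabs_Im v => /ler_normlP[a1 a2] /ler_normlP[a3 a4].
  by split; apply/andP; split; lra.
apply: rect_ind => [||a b c d ab cd|x y xK yK]; [lra|lra| |].
  move=> [d1 d10 H1] [d2 d20 H2] [d3 d30 H3] [d4 d40 H4].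
  exists (Num.min (Num.min d1 d2) (Num.min d3 d4)); first by rewrite !lt_min d10 d20 d30.
  move=> v w v0 w0 [/andP[r1 r2] /andP[r3 r4]]; rewrite !lt_min => /andP[/andP[s1 s2] /andP[s3 s4]].
  have [l1|l1] := leP (complex.Re v) ((a + b) / 2); have [l2|l2] := leP (complex.Im v) ((c + d) / 2).
  - by apply: H1 => //; split; apply/andP; split; lra.
  - by apply: H3 => //; split; apply/andP; split; lra.
  - by apply: H2 => //; split; apply/andP; split; lra.
  - by apply: H4 => //; split; apply/andP; split; lra.
have [x0 _] := andP xK.
have [d d0 Hd] := cf (x +i* y)%C x0 e e0.
exists (d / 8); first by rewrite divr_gt0.
move=> a b c d' _ xab _ _ ycd _ lab lcd; exists (d / 4); first by rewrite divr_gt0.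
move=> v w v0 w0 vr vw.
have vz : cabs (v - (x +i* y)%C) <= d / 4.
  rewrite (le_trans (inrect_dist vr (conj _ _ : inrect a b c d' (x +i* y)%C))) //.
  lra.
apply: Hd => //; first by lra.
by rewrite (le_lt_trans (cabs_dist_trans v _ _)) // cabs_distC; lra.
Qed.

Lemma C0prop_bounded f : C0prop f -> exists M : R, forall z, 0 < complex.Re z -> cabs (f z) <= M.
Proof.
move=> Hf; have [M HM] := Hf.2 1 ltr01.
pose K := Num.max M 1.
have K0 : 0 <= K by rewrite le_max ler01 orbT.
pose P (a b c d : R) := exists M : R,
  forall v, 0 < complex.Re v -> inrect a b c d v -> cabs (f v) <= M.
suff [B HB] : P 0 K (- K) K.
  exists (Num.max B 1) => z z0; rewrite le_max.
  have [zM|Mz] := leP (cabs z) M; last by rewrite (HM _ z0 Mz) orbT.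
  rewrite HB //.
  have vK : cabs z <= K by rewrite (le_trans zM) // le_max lexx.
  have := cabs_Re z; have := cabs_Im z => /ler_normlP[a1 a2] /ler_normlP[a3 a4].
  by split; apply/andP; split; lra.
apply: rect_ind => [||a b c d ab cd|x y xK yK]; [lra|lra| |].
  move=> [M1 H1] [M2 H2] [M3 H3] [M4 H4].
  exists (Num.max (Num.max M1 M2) (Num.max M3 M4)) => v v0 [/andP[r1 r2] /andP[r3 r4]].
  rewrite !le_max.
  have [l1|l1] := leP (complex.Re v) ((a + b) / 2); have [l2|l2] := leP (complex.Im v) ((c + d) / 2).
  - by rewrite H1 //; split; apply/andP; split; lra.
  - by rewrite H3 ?orbT //; split; apply/andP; split; lra.
  - by rewrite H2 ?orbT //; split; apply/andP; split; lra.
  - by rewrite H4 ?orbT //; split; apply/andP; split; lra.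
have [x0 _] := andP xK.
have [d d0 Hd] := Hf.1 (x +i* y)%C x0 1 ltr01.
exists (d / 8); first by rewrite divr_gt0.
move=> a b c d' _ xab _ _ ycd _ lab lcd.
(* The centre may lie on the imaginary axis, so the reference value of [f] is taken at an interior
   point next to it. *)
pose w := ((x + d / 2) +i* y)%C.
exists (cabs (f w) + 1) => v v0 vr.
have vz : cabs (v - (x +i* y)%C) <= d / 4.
  rewrite (le_trans (inrect_dist vr (conj _ _ : inrect a b c d' (x +i* y)%C))) //.
  lra.
have wz : cabs (w - (x +i* y)%C) = d / 2.
  rewrite (_ : w - _ = ((d / 2)%:C)%C); first by rewrite cabs_real ger0_norm; lra.
  by apply: complex_ext; rewrite /= ?subrr // addrC addKr.
have : cabs (f v - f w) <= 1.
  by apply: Hd => //; rewrite ?wz /=; lra.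
by have := cabs_sub_ge (f v) (f w); lra.
Qed.

End C0.

(** * Lebesgue integrals on the line *)

Section RealIntegration.
Variable R : realType.
Notation leb := (@lebesgue_measure R).
Implicit Types (D : set R) (g : R -> \bar R).

(** Lebesgue measure is determined by its values on intervals, hence equals its image under a
    translation. *)
Lemma integral_shift (c : R) D g : measurable D -> measurable_fun D g ->
  (forall x, D x -> 0 <= g x)%E ->
  (\int[leb]_(x in D) g x = \int[leb]_(x in [set x | D (x + c)%R]) g (x + c)%R)%E.
Proof.
move=> mD mg g0.
have mphi : measurable_fun [set: measurableTypeR R] (fun x : measurableTypeR R => (x + c : measurableTypeR R)).
  by apply: measurable_funD.
pose mu := pushforward leb (fun x : measurableTypeR R => (x + c : measurableTypeR R)).
have muE : forall A, measurable A -> leb A = mu A.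
  apply: lebesgue_measure_unique => X /ocitvP[->|[[x y] /= xy ->]].
    by rewrite !measure0.
  rewrite /mu /pushforward.
  have -> : (fun x0 : R => x0 + c) @^-1` `]x, y] = `]x - c, y - c]%classic.
    by apply/seteqP; split => t /=; rewrite !in_itv /= ltrBlDr lerBrDr.
  rewrite !lebesgue_measure_itv /= !lte_fin ltrD2r xy.
  by rewrite -!EFinB; congr EFin; ring.
rewrite (eq_measure_integral mu); last by move=> A mA _; exact: muE.
by rewrite ge0_integral_pushforward // => x; rewrite inE; exact: g0.
Qed.

(** Dominated convergence: the restrictions of [g] to [E n] lie below [g] and vanish eventually at
    each point. *)
Lemma integral_vanish d (T : measurableType d) (mu : {measure set T -> \bar R})
    (D : set T) (E : nat -> set T) (g : T -> R) :
  measurable D -> (forall n, measurable (E n)) -> (forall n, E n `<=` D) ->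
  mu.-integrable D (EFin \o g) -> (forall x, D x -> 0 <= g x) ->
  (forall x, D x -> exists N, forall n, (N <= n)%N -> ~ E n x) ->
  forall e : R, 0 < e -> exists n, (\int[mu]_(x in E n) (g x)%:E < e%:E)%E.
Proof.
move=> mD mE ED ig g0 Ev e e0.
have mg := measurable_int _ ig.
have : (\int[mu]_(x in D) ((EFin \o g) \_ (E n)) x)%E @[n --> \oo] -->
    (\int[mu]_(x in D) (cst 0%E) x)%E.
  apply: (@dominated_cvg _ _ _ mu D mD _ _ (EFin \o g)) => //.
  - move=> n; apply/(measurable_restrict _ (mE n) mD).
    by apply: measurable_funS mg => //; exact: subIsetl.
  - move=> x Dx; have [N HN] := Ev x Dx.
    apply: cvg_near_cst; exists N => // n Nn /=.
    by rewrite patchE memNset //; exact: HN.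
  - move=> n x Dx; rewrite patchE; case: ifPn => _ /=.
      by rewrite ger0_norm ?lee_fin ?g0.
    by rewrite normr0 lee_fin g0.
rewrite integral0 => /fine_cvgP[fn /cvgrPdist_lt /(_ _ e0)].
move: fn => [N1 _ H1] [N2 _ H2]; exists (maxn N1 N2).
have {}H1 := H1 _ (leq_maxl N1 N2); have {}H2 := H2 _ (leq_maxr N1 N2).
move: H1 H2; rewrite /= sub0r normrN => H1 H2.
have E1 : (\int[mu]_(x in D) ((EFin \o g) \_ (E (maxn N1 N2))) x =
    \int[mu]_(x in E (maxn N1 N2)) (g x)%:E)%E.
  rewrite -integral_mkcondr setIidr //; exact: ED.
move: H1 H2; rewrite E1 => H1 H2.
by rewrite -(fineK H1) lte_fin (le_lt_trans (ler_norm _)).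
Qed.

Lemma approx_is_derive (f : R -> R) (x l : R) :
  (forall e, 0 < e -> exists2 d, 0 < d &
    forall h, `|h| < d -> `|f (x + h) - f x - l * h| <= e * `|h|) ->
  is_derive x (1 : R) f l.
Proof.
move=> H.
suff lim : h^-1 *: ((f \o shift x) (h *: (1 : R)) - f x) @[h --> (0 : R)^'] --> l.
  by apply: DeriveDef; [apply/cvg_ex; exists l | apply/cvg_lim].
apply/cvgrPdist_le => e e0; have [d d0 {}H] := H _ e0.
apply/nbhs_ballP; exists d => //= h; rewrite /ball /= sub0r normrN => hd h0.
rewrite /GRing.scale /= mulr1 (addrC h x).
have -> : l - h^-1 * (f (x + h) - f x) = - (h^-1 * (f (x + h) - f x - l * h)).
  by field.
by rewrite normrN normrM normfV ler_pdivrMl ?normr_gt0 // (mulrC `|h|); exact: H.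
Qed.

Lemma continuous_inv_sqr (k c a : R) : 0 <= a -> 0 < c ->
  {for a, continuous (fun a : R => k / (a + c) ^+ 2)}.
Proof.
move=> a0 c0; apply: cvgM; first exact: cvg_cst.
apply: cvgV; first by rewrite expf_neq0 //; lra.
have h : (fun a : R => a + c) x @[x --> a] --> a + c.
  by apply: cvgD; [exact: cvg_id|exact: cvg_cst].
exact: (cvgM h h).
Qed.

Lemma integral_inv_sqr (k c : R) : 0 <= k -> 0 < c ->
  (\int[leb]_(a in @Rpos R) (k / (a + c) ^+ 2)%:E = (k / c)%:E)%E.
Proof.
move=> k0 c0.
pose F (a : R) := - (k / (a + c)).
have dF (a : R) : 0 <= a -> is_derive a (1 : R) F (k / (a + c) ^+ 2).
  move=> a0; apply: approx_is_derive => e e0.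
  have x0 : 0 < a + c by lra.
  have K0 : 0 < 2 * (k + 1) by lra.
  exists (Num.min ((a + c) / 2) (e * (a + c) ^+ 3 / (2 * (k + 1)))).
    by rewrite lt_min !divr_gt0 // mulr_gt0 // exprn_gt0.
  move=> h; rewrite lt_min => /andP[h1 h2].
  have := h1 => /ltr_normlP[h3 h4]; have y0 : 0 < a + h + c by lra.
  have y2 : (a + c) / 2 <= a + h + c by lra.
  rewrite /F; have -> : - (k / (a + h + c)) - - (k / (a + c)) - k / (a + c) ^+ 2 * h =
    - (k * h ^+ 2 / ((a + c) ^+ 2 * (a + h + c))) by field; lra.
  have d0 : 0 < (a + c) ^+ 2 * (a + h + c) by rewrite mulr_gt0 // exprn_gt0.
  rewrite normrN normrM normfV (gtr0_norm d0) normrM normrX (ger0_norm k0).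
  rewrite ler_pdivrMr // [`|h| ^+ 2]expr2 mulrA [X in _ <= X]mulrAC ler_wpM2r //.
  rewrite ltr_pdivlMr // in h2.
  have : (a + c) ^+ 3 / 2 <= (a + c) ^+ 2 * (a + h + c).
    by rewrite exprSr -mulrA ler_wpM2l // exprn_ge0 // ltW.
  move: (_ ^+ 2 * _) => X; move: (`|h|) (normr_ge0 h) h2 => p p0 h2 HX.
  have : e * ((a + c) ^+ 3 / 2) <= e * X by rewrite ler_pM2l.
  by lra.
have cF (a : R) (a0 : 0 <= a) := @continuous_inv_sqr k c a a0 c0.
rewrite /Rpos integral_itv_obnd_cbnd; last first.
  apply/measurable_EFinP; apply: measurable_realfun.open_continuous_measurable_fun.
    exact: interval_open.
  by move=> a; rewrite inE /= in_itv /= andbT => a0; apply: cF; exact: ltW.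
rewrite (@ge0_continuous_FTC2y _ (fun a => k / (a + c) ^+ 2) F 0 0) //.
- by rewrite -EFinB sub0r /F add0r opprK.
- by move=> a a0; rewrite divr_ge0 // exprn_ge0 //; lra.
- by apply: continuous_in_subspaceT => a; rewrite inE /= in_itv /= andbT; exact: cF.
- apply/cvgrPdist_le => e e0; near=> a.
  have a0 : 0 < a by near: a; exact: nbhs_pinfty_gt.
  rewrite /F opprK add0r ger0_norm; last by rewrite divr_ge0 //; lra.
  rewrite ler_pdivrMr; last by lra.
  rewrite mulrC -ler_pdivrMr //.
  have ka : k / e <= a by near: a; apply: nbhs_pinfty_ge; rewrite num_real.
  by lra.
- by move=> a a0; have [] := dF a (ltW a0).
- apply: cvg_at_right_filter.
  have [/derivable1_diffP/differentiable_continuous d0 _] := dF 0 (lexx _).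
  exact: d0.
- move=> a; rewrite in_itv /= andbT => a0; rewrite derive1E.
  by have [_ ->] := dF a (ltW a0).
Unshelve. all: by end_near. Qed.

End RealIntegration.

(** * The supremum of the derivative on vertical lines *)

Section Regularization.
Variable R : realType.
Notation leb := (@lebesgue_measure R).
Notation Cn := ((R[i] : numFieldType)^o).
Implicit Types (f g h u : R[i] -> R[i]) (z w : R[i]).

Lemma RposE (a : R) : @Rpos R a = (0 < a) :> Prop.
Proof. by rewrite /Rpos /= in_itv /= andbT. Qed.

Definition bounded_by (M : R) h := forall z, 0 < complex.Re z -> cabs (h z) <= M.

(** The integrand of [B0norm] as a real number, which is faithful for bounded holomorphic functions
    by the Cauchy estimate. *)
Definition phi : (R[i] -> R[i]) -> R -> R := locked (fun h a =>
  fine (ereal_sup [set (cabs (hder h (a +i* b)%C))%:E | b in [set: R]])).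

Lemma phiE h (a C : R) : (forall b, cabs (hder h (a +i* b)%C) <= C) ->
  ereal_sup [set (cabs (hder h (a +i* b)%C))%:E | b in [set: R]] = (phi h a)%:E.
Proof.
move=> H; rewrite /phi -lock fineK // ge0_fin_numE.
  by rewrite (le_lt_trans _ (ltry C)) //; apply: ge_ereal_sup => _ [b _ <-]; rewrite lee_fin.
apply: (@le_trans _ _ (cabs (hder h (a +i* 0)%C))%:E); first by rewrite lee_fin cabs_ge0.
by apply: ereal_sup_ubound; exists 0.
Qed.

Lemma phi_ge h (a C b : R) : (forall b, cabs (hder h (a +i* b)%C) <= C) ->
  cabs (hder h (a +i* b)%C) <= phi h a.
Proof.
by move=> H; rewrite -lee_fin -(phiE H); apply: ereal_sup_ubound; exists b.
Qed.

Lemma phi_le h (a C : R) : (forall b, cabs (hder h (a +i* b)%C) <= C) -> phi h a <= C.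
Proof.
move=> H; rewrite -lee_fin -(phiE H); apply: ge_ereal_sup => _ [b _ <-].
by rewrite lee_fin.
Qed.

Lemma phi_ge0 h a : 0 <= phi h a.
Proof.
rewrite /phi -lock; apply: fine_ge0; apply: (@le_trans _ _ (cabs (hder h (a +i* 0)%C))%:E).
  by rewrite lee_fin cabs_ge0.
by apply: ereal_sup_ubound; exists 0.
Qed.

Lemma bounded_hder h (M a b : R) : holo h -> bounded_by M h -> 0 < a ->
  cabs (hder h (a +i* b)%C) <= 4 * M / a.
Proof. by move=> hh hM a0; apply: hder_bound. Qed.

Lemma bounded_phi_ge h (M a b : R) : holo h -> bounded_by M h -> 0 < a ->
  cabs (hder h (a +i* b)%C) <= phi h a.
Proof. by move=> hh hM a0; apply: phi_ge => c; exact: bounded_hder hM a0. Qed.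

(** The bound [hder_lip] on Re z >= a / 2 is uniform along vertical lines and so passes to suprema.
    Continuity is what makes the integrand measurable. *)
Lemma phi_cont h (M : R) : holo h -> bounded_by M h ->
  forall a, 0 < a -> {for a, continuous (phi h)}.
Proof.
move=> hh hM a a0; apply/cvgrPdist_le => e e0.
have M0 : 0 <= M by rewrite (le_trans (cabs_ge0 _) (hM 1 _)) //= ltr01.
pose L := 32 * M / (a / 2) ^+ 2.
have L0 : 0 <= L by rewrite /L divr_ge0 ?exprn_ge0 ?mulr_ge0 //; lra.
have L1 : 0 < L + 1 by lra.
apply/nbhs_ballP; exists (Num.min (a / 2) (e / (L + 1))) => /=.
  by rewrite lt_min !divr_gt0.
move=> x; rewrite /ball /= lt_min => /andP[x1 x2].
have x0 : a / 2 <= x by move: x1 => /ltr_normlP[]; lra.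
have key p q : a / 2 <= p -> a / 2 <= q -> `|p - q| < e / (L + 1) -> phi h p <= phi h q + e.
  move=> pa qa pq; apply: phi_le => b.
  have q0 : 0 < q by lra.
  have := bounded_phi_ge b hh hM q0.
  have a2 : 0 < a / 2 by lra.
  have := @hder_lip _ h M (a / 2) (p +i* b)%C (q +i* b)%C hh hM a2 pa qa.
  have -> : (p +i* b - (q +i* b) = (p - q)%:C)%C.
    by apply: complex_ext; rewrite /= ?subrr.
  rewrite cabs_real => H1 H2.
  have H3 : 32 * M * `|p - q| / (a / 2) ^+ 2 <= e.
    rewrite mulrAC -/L; move: pq; rewrite ltr_pdivlMr // => pq.
    by have := normr_ge0 (p - q); nra.
  move: (hder _ _) (hder _ _) H1 H2 => s t H1 H2.
  have := cabs_sub_ge t s; lra.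
have k1 : phi h a <= phi h x + e by apply: key => //; lra.
have k2 : phi h x <= phi h a + e by apply: key => //; [lra|rewrite distrC].
by rewrite ler_norml; apply/andP; split; lra.
Qed.

Lemma phi_meas h (M : R) (D : set R) : holo h -> bounded_by M h ->
  measurable D -> D `<=` @Rpos R -> measurable_fun D (EFin \o phi h).
Proof.
move=> hh hM mD DR; apply: (@measurable_funS _ _ _ _ (@Rpos R)) => //; first exact: measurable_itv.
apply/measurable_EFinP; apply: open_continuous_measurable_fun.
  exact: interval_open.
by move=> a; rewrite inE RposE => a0; exact: phi_cont hM _ a0.
Qed.

Lemma B0normE h (M : R) : holo h -> bounded_by M h ->
  B0norm h = (\int[leb]_(a in @Rpos R) (phi h a)%:E)%E.
Proof.
move=> hh hM; apply: eq_integral => a; rewrite inE RposE => a0.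
rewrite -(phiE (C := 4 * M / a)) => [|b]; last exact: bounded_hder.
by congr (ereal_sup _); apply: eq_imagel => b _; rewrite hderE.
Qed.

Lemma is_derive_line h (b x : R) (l : R[i]) : cdiff h (x +i* b)%C l ->
  is_derive x (1 : R) (fun t => complex.Re (h (t +i* b)%C)) (complex.Re l) /\
  is_derive x (1 : R) (fun t => complex.Im (h (t +i* b)%C)) (complex.Im l).
Proof.
move=> H.
have xt t : ((x + t) +i* b = x +i* b + t%:C)%C.
  by apply: complex_ext; rewrite /= ?addr0.
split; apply: approx_is_derive => e e0; have [d d0 {}H] := H e e0; exists d => // t td.
- have := H ((t%:C)%C); rewrite cabs_real => /(_ td); apply: le_trans.
  rewrite (le_trans _ (cabs_Re _)) // xt 2!ReD 2!ReN cReM /=.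
  by rewrite mulr0 subr0.
- have := H ((t%:C)%C); rewrite cabs_real => /(_ td); apply: le_trans.
  rewrite (le_trans _ (cabs_Im _)) // xt 2!ImD 2!ImN cImM /=.
  by rewrite mulr0 add0r.
Qed.

Lemma integral_derive (F f : R -> R) (a b : R) : a < b ->
  (forall x, a <= x <= b -> is_derive x (1 : R) F (f x)) ->
  (forall x, a <= x <= b -> {for x, continuous f}) ->
  (\int[leb]_(x in `[a, b]) (f x)%:E = (F b)%:E - (F a)%:E)%E.
Proof.
move=> ab dF cf.
have cw : {within `[a, b], continuous f}.
  by apply: continuous_in_subspaceT => x; rewrite inE /= in_itv /=; exact: cf.
have F0 x : a <= x <= b -> F y @[y --> x] --> F x.
  move=> xa; have [/derivable1_diffP/differentiable_continuous d0 _] := dF x xa.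
  exact: d0.
apply: continuous_FTC2 => //.
  split=> [x||].
  - rewrite in_itv /= => /andP[x1 x2].
    by have [|? _] := dF x; first by rewrite !ltW.
  - by apply: cvg_at_right_filter; apply: F0; rewrite lexx ltW.
  - by apply: cvg_at_left_filter; apply: F0; rewrite lexx ltW.
move=> x; rewrite in_itv /= => /andP[x1 x2]; rewrite derive1E.
by have [|_ ->] := dF x; first by rewrite !ltW.
Qed.

Lemma FTC_le (F f p : R -> R) (a a' eta : R) : a < a' ->
  (forall x, a <= x <= a' -> is_derive x (1 : R) F (f x)) ->
  (forall x, a <= x <= a' -> {for x, continuous f}) ->
  (forall x, a <= x <= a' -> `|f x| <= p x) ->
  measurable_fun `[a, a'] (EFin \o p) ->
  (\int[leb]_(x in `[a, a']) (p x)%:E <= eta%:E)%E ->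
  `|F a' - F a| <= eta.
Proof.
move=> aa dF cf fp mp Ip.
have cw : {within `[a, a'], continuous f}.
  by apply: continuous_in_subspaceT => x; rewrite inE /= in_itv /=; exact: cf.
have ig := continuous_compact_integrable (@segment_compact _ a a') cw.
have H := integral_derive aa dF cf.
rewrite -lee_fin (le_trans _ Ip) //.
have -> : (`|F a' - F a|%:E = `|\int[leb]_(x in `[a, a']) (f x)%:E|)%E by rewrite H.
rewrite (le_trans (le_abse_integral _ _ _)) //.
  exact: (measurable_int leb).
apply: ge0_le_integral => //.
by apply: measurableT_comp => //; exact: (measurable_int leb).
Qed.

(** The derivative is integrated along a horizontal segment that ends far to the right, where |u| is
    at most about [c]; the real and the imaginary part each change by at most [eta]. *)
Lemma sup_le_B0 u (M eta c : R) : holo u -> bounded_by M u ->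
  (\int[leb]_(a in @Rpos R) (phi u a)%:E <= eta%:E)%E ->
  (forall b e : R, 0 < e -> exists A : R, forall a, A <= a -> cabs (u (a +i* b)%C) <= c + e) ->
  bounded_by (2 * eta + c) u.
Proof.
move=> hu uM Iu Hc [a b] /= a0; apply/ler_addgt0Pr => e e0.
have [A HA] := Hc b e e0.
pose a' := Num.max A (a + 1).
have aa : a < a' by rewrite lt_max; apply/orP; right; lra.
have {}HA : cabs (u (a' +i* b)%C) <= c + e by apply: HA; rewrite le_max lexx.
have dl x : a <= x <= a' -> cdiff u (x +i* b)%C (hder u (x +i* b)%C).
  by move=> /andP[ax _]; apply: holo_cdiff => //=; lra.
have sub : `[a, a'] `<=` @Rpos R.
  by move=> x /=; rewrite RposE in_itv /= => /andP[ax _]; lra.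
have Ia : (\int[leb]_(x in `[a, a']) (phi u x)%:E <= eta%:E)%E.
  rewrite (le_trans _ Iu) //; apply: ge0_subset_integral => //.
  - exact: measurable_itv.
  - by apply: phi_meas hu uM _ _ => //; exact: measurable_itv.
  - by move=> x _; rewrite lee_fin phi_ge0.
have mp : measurable_fun `[a, a'] (EFin \o phi u) by apply: phi_meas hu uM _ _.
have rc x : a <= x <= a' -> rcont (fun t => hder u (t +i* b)%C) x.
  move=> /andP[ax _] d d0; have x0 : 0 < x by lra.
  have M0 : 0 <= M by rewrite (le_trans (cabs_ge0 _) (uM 1 _)) //= ltr01.
  pose L := 32 * M / (x / 2) ^+ 2.
  have L0 : 0 <= L by rewrite /L divr_ge0 ?exprn_ge0 ?mulr_ge0 //; lra.
  have L1 : 0 < L + 1 by lra.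
  exists (Num.min (x / 2) (d / (L + 1))); first by rewrite lt_min !divr_gt0.
  move=> s; rewrite lt_min => /andP[s1 s2].
  have sx : x / 2 <= s by move: s1 => /ltr_normlP[]; lra.
  have xx : x / 2 <= x by lra.
  have x2 : 0 < x / 2 by lra.
  rewrite (le_trans (@hder_lip _ u M (x / 2) (s +i* b)%C (x +i* b)%C hu uM x2 sx xx)) //.
  have -> : (s +i* b - (x +i* b) = (s - x)%:C)%C.
    by apply: complex_ext; rewrite /= ?subrr.
  rewrite cabs_real mulrAC -/L; move: s2; rewrite ltr_pdivlMr // => s2.
  by have := normr_ge0 (s - x); nra.
have BR : `|complex.Re (u (a' +i* b)%C) - complex.Re (u (a +i* b)%C)| <= eta.
  apply: (@FTC_le (fun t => complex.Re (u (t +i* b)%C))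
    (fun t => complex.Re (hder u (t +i* b)%C)) (phi u) a a') => //.
  - by move=> x /dl /is_derive_line[].
  - by move=> x /rc /rcont_Re.
  - move=> x /andP[ax _]; rewrite (le_trans (cabs_Re _)) //.
    by apply: bounded_phi_ge uM _ => //; lra.
have BI : `|complex.Im (u (a' +i* b)%C) - complex.Im (u (a +i* b)%C)| <= eta.
  apply: (@FTC_le (fun t => complex.Im (u (t +i* b)%C))
    (fun t => complex.Im (hder u (t +i* b)%C)) (phi u) a a') => //.
  - by move=> x /dl /is_derive_line[].
  - by move=> x /rc /rcont_Im.
  - move=> x /andP[ax _]; rewrite (le_trans (cabs_Im _)) //.
    by apply: bounded_phi_ge uM _ => //; lra.
have := cabs_le (u (a' +i* b)%C - u (a +i* b)%C); rewrite ReD ImD ReN ImN.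
have := cabs_sub_ge (u (a +i* b)%C) (u (a' +i* b)%C); rewrite cabs_distC.
lra.
Qed.

End Regularization.

(** * Comparison of the two closures *)

Section RegularizationTheorem.
Variable R : realType.
Notation leb := (@lebesgue_measure R).
Implicit Types (f g h u : R[i] -> R[i]) (z w : R[i]).

Lemma measurable_Rpos : measurable (@Rpos R).
Proof. exact: measurable_itv. Qed.

Lemma phi_integrable f (K : R) : holo f -> bounded_by K f -> (B0norm f < +oo)%E ->
  leb.-integrable (@Rpos R) (EFin \o phi f).
Proof.
move=> hf fK Bf; apply/integrableP; split.
  by apply: phi_meas hf fK measurable_Rpos _.
under eq_integral do rewrite gee0_abs ?lee_fin ?phi_ge0 //.
by rewrite -(B0normE hf fK).
Qed.

Lemma phi_small f (K eta : R) : holo f -> bounded_by K f -> (B0norm f < +oo)%E -> 0 < eta ->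
  exists2 d : R, 0 < d & (\int[leb]_(a in `]0%R, d]) (phi f a)%:E <= eta%:E)%E.
Proof.
move=> hf fK Bf eta0.
have [|||| n Hn] := @integral_vanish R _ _ leb (@Rpos R)
  (fun n => `]0%R, n.+1%:R^-1]%classic) (phi f) measurable_Rpos _ _ (phi_integrable hf fK Bf) _ _ eta eta0.
- by move=> n; exact: measurable_itv.
- by move=> n x /=; rewrite RposE in_itv /= => /andP[].
- by move=> x _; exact: phi_ge0.
- move=> x; rewrite RposE => x0; exists (Num.bound x^-1) => n Nn /=.
  apply/negP; rewrite in_itv /= x0 /= -ltNge.
  rewrite invf_plt ?posrE // (lt_le_trans (archi_boundP _)) ?invr_ge0 ?(ltW x0) //.
  by rewrite ler_nat ltnW.
by exists (n.+1%:R^-1); [rewrite invr_gt0|exact: ltW].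
Qed.

Lemma phi_tail f (K eta : R) : holo f -> bounded_by K f -> (B0norm f < +oo)%E -> 0 < eta ->
  exists2 N : R, 1 <= N & (\int[leb]_(a in `]N, +oo[) (phi f a)%:E <= eta%:E)%E.
Proof.
move=> hf fK Bf eta0.
have [|||| n Hn] := @integral_vanish R _ _ leb (@Rpos R)
  (fun n => `]n.+1%:R, +oo[%classic) (phi f) measurable_Rpos _ _ (phi_integrable hf fK Bf) _ _ eta eta0.
- by move=> n; exact: measurable_itv.
- move=> n x /=; rewrite RposE in_itv /= andbT; exact: lt_trans.
- by move=> x _; exact: phi_ge0.
- move=> x; rewrite RposE => x0; exists (Num.bound x) => n Nn /=.
  apply/negP; rewrite in_itv /= andbT -leNgt.
  rewrite ltW // (lt_le_trans (archi_boundP _)) ?(ltW x0) //.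
  by rewrite ler_nat ltnW.
by exists (n.+1%:R); [rewrite ler1n|exact: ltW].
Qed.

(** Besides holomorphy and boundedness, this is all that the comparison of the closures asks of [Y].
    The function [h] is prescribed on the open half-plane only, where both norms are computed, and
    [c] plays the part of g(+oo). *)
Definition shift_diff (Y : set (R[i] -> R[i])) g := forall eps N : R, 0 < eps -> eps < N ->
  exists h c, [/\ Y h, (forall z, 0 < complex.Re z ->
      h z = g (z + (eps%:C)%C) - g (z + (N%:C)%C) + c) &
    forall b e : R, 0 < e -> exists A : R, forall a, A <= a -> cabs (g (a +i* b)%C - c) <= e].

Section Estimate.
Variables (f g h : R[i] -> R[i]) (c : R[i]) (K eps N d e0 : R).
Hypotheses (hf : holo f) (fK : bounded_by K f) (hg : holo g)
  (fg : bounded_by e0 (fun z => f z - g z)) (eps_gt0 : 0 < eps) (eps_le : eps <= d)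
  (epsN : eps < N)
  (hE : forall z, 0 < complex.Re z -> h z = g (z + (eps%:C)%C) - g (z + (N%:C)%C) + c).

Let u z : R[i] := f z - h z.

Let N_gt0 : 0 < N. Proof. exact: lt_trans epsN. Qed.
Let d_gt0 : 0 < d. Proof. exact: lt_le_trans eps_le. Qed.

Let u_cdiff z : 0 < complex.Re z ->
  cdiff u z (hder f z - (hder g (z + (eps%:C)%C) - hder g (z + (N%:C)%C))).
Proof.
move=> z0; have [N0 p1] := (N_gt0, eps_gt0).
have zs (s : R) : 0 < s -> 0 < complex.Re (z + (s%:C)%C).
  by move=> s0; rewrite ReD /=; lra.
have H := cdiffB (holo_cdiff hf z0) (cdiffD (cdiffB
  (cdiff_shift (holo_cdiff hg (zs _ eps_gt0))) (cdiff_shift (holo_cdiff hg (zs _ N0))))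
  (cdiff_cst c z)).
rewrite addr0 in H; apply: (cdiff_ext z0 _ H) => w wz.
have w0 : 0 < complex.Re w by apply: (@halfplane_disc _ (complex.Re z) z).
by rewrite /u hE.
Qed.

Lemma reg_holo : holo u.
Proof. by apply: cdiff_holo => z z0; eexists; exact: u_cdiff. Qed.

(** With D = f - g, the derivative is (f'(z) - f'(z + eps)) + f'(z + N) + (D'(z + eps) - D'(z + N)).
    The last difference is estimated by [hder_lip], whose 1/(a + eps)^2 is integrable on the
    half-line. So is the first for a > d; there a + d <= 2 a turns the constant 32 into 128 and
    1/a^2 into a majorant that is integrable down to 0. *)
Lemma reg_hder (a b : R) : 0 < a -> cabs (hder u (a +i* b)%C) <=
  (if a <= d then phi f a + phi f (a + eps) else 0) + 128 * K * eps / (a + d) ^+ 2 +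
  phi f (a + N) + 32 * e0 * N / (a + eps) ^+ 2.
Proof.
move=> a0; have [N0 p1] := (N_gt0, eps_gt0); have [d0 p2] := (d_gt0, eps_le); have p3 := epsN.
have K0 : 0 <= K by rewrite (le_trans (cabs_ge0 _) (fK (z := 1) _)) //= ltr01.
have e00 : 0 <= e0 by rewrite (le_trans (cabs_ge0 _) (fg (z := 1) _)) //= ltr01.
have zs (s : R) : ((a +i* b) + s%:C = (a + s) +i* b)%C.
  by apply: complex_ext; rewrite /= ?addr0.
rewrite (hder_cdiff (u_cdiff _)) //= !zs.
pose D z := f z - g z.
have hD : holo D.
  apply: cdiff_holo => z z0; eexists; apply: cdiffB; exact: holo_cdiff.
have DE (s : R) : 0 < s -> hder g ((a + s) +i* b)%C =
    hder f ((a + s) +i* b)%C - hder D ((a + s) +i* b)%C.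
  move=> s0; have p0 : 0 < complex.Re (((a + s) +i* b)%C : R[i]) by rewrite /=; lra.
  rewrite (hder_cdiff (cdiffB (holo_cdiff hf p0) (holo_cdiff hg p0))).
  by rewrite subKr.
rewrite !DE //.
have H3 : cabs (hder D ((a + eps) +i* b)%C - hder D ((a + N) +i* b)%C) <= 32 * e0 * N / (a + eps) ^+ 2.
  have ae : 0 < a + eps by lra.
  rewrite (le_trans (@hder_lip _ D e0 (a + eps) _ _ hD fg ae _ _)) //; first by rewrite /=; lra.
  rewrite ler_wpM2r ?invr_ge0 ?exprn_ge0 ?(ltW ae) // ler_wpM2l ?mulr_ge0 //.
  have -> : ((a + eps) +i* b - ((a + N) +i* b) = (eps - N)%:C)%C.
    by apply: complex_ext; rewrite /= ?subrr //; ring.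
  by rewrite cabs_real ler_norml; apply/andP; split; lra.
have H2 : cabs (hder f ((a + N) +i* b)%C) <= phi f (a + N).
  by apply: bounded_phi_ge hf fK _; lra.
have H1 : cabs (hder f (a +i* b)%C - hder f ((a + eps) +i* b)%C) <=
    (if a <= d then phi f a + phi f (a + eps) else 0) + 128 * K * eps / (a + d) ^+ 2.
  case: (leP a d) => ad.
    rewrite (le_trans (cabsB _ _)) //.
    have : cabs (hder f (a +i* b)%C) <= phi f a by apply: bounded_phi_ge hf fK _.
    have : cabs (hder f ((a + eps) +i* b)%C) <= phi f (a + eps).
      by apply: bounded_phi_ge hf fK _; lra.
    have : 0 <= 128 * K * eps / (a + d) ^+ 2.
      by rewrite divr_ge0 ?exprn_ge0 ?mulr_ge0 ?(ltW eps_gt0) //; lra.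
    move: (hder _ _) (hder _ _) (phi _ _) (phi _ _) (_ / _) => p q P Q X; lra.
  rewrite add0r (le_trans (@hder_lip _ f K a _ _ hf fK a0 _ _)) //; first by rewrite /=; lra.
  have -> : (a +i* b - ((a + eps) +i* b) = (- eps)%:C)%C.
    by apply: complex_ext; rewrite /= ?subrr //; ring.
  rewrite cabs_real normrN gtr0_norm // ler_pdivrMr ?exprn_gt0 // [X in _ <= X]mulrAC ler_pdivlMr; last first.
    by rewrite exprn_gt0 //; lra.
  have -> : 128 * K * eps * a ^+ 2 = 32 * K * eps * (2 * a) ^+ 2 by ring.
  rewrite ler_wpM2l ?mulr_ge0 ?(ltW eps_gt0) //.
  have ad2 : a + d <= 2 * a by lra.
  have ad0 : 0 <= a + d by lra.
  have a20 : 0 <= 2 * a by lra.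
  by rewrite lerXn2r ?nnegrE.
move: (hder f (a +i* b)%C) (hder f ((a + eps) +i* b)%C) (hder f ((a + N) +i* b)%C)
  (hder D ((a + eps) +i* b)%C) (hder D ((a + N) +i* b)%C) H1 H2 H3 => q0 q1 q2 r1 r2 H1 H2 H3.
have -> : q0 - (q1 - r1 - (q2 - r2)) = (q0 - q1) + q2 + (r1 - r2) by ring.
have := cabsD (q0 - q1 + q2) (r1 - r2); have := cabsD (q0 - q1) q2.
by move=> S1 S2; rewrite (le_trans S2) // lerD // (le_trans S1) // lerD.
Qed.

Lemma reg_B0 (M eta : R) : (B0norm f < +oo)%E -> bounded_by M u ->
  (\int[leb]_(a in `]0%R, d]) (phi f a)%:E <= eta%:E)%E ->
  (\int[leb]_(a in `]0%R, (d + eps)%R]) (phi f a)%:E <= eta%:E)%E ->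
  (\int[leb]_(a in `]N, +oo[) (phi f a)%:E <= eta%:E)%E ->
  (\int[leb]_(a in @Rpos R) (phi u a)%:E <=
   (eta + eta + 128 * K * eps / d + eta + 32 * e0 * N / eps)%:E)%E.
Proof.
move=> Bf uM I1 I2 I3; have [N0 p1] := (N_gt0, eps_gt0); have [d0 p2] := (d_gt0, eps_le); have p3 := epsN.
have K0 : 0 <= K by rewrite (le_trans (cabs_ge0 _) (fK (z := 1) _)) //= ltr01.
have e00 : 0 <= e0 by rewrite (le_trans (cabs_ge0 _) (fg (z := 1) _)) //= ltr01.
have hu := reg_holo.
have mR := measurable_Rpos.
have mI : measurable (`]0%R, d]%classic : set R) by exact: measurable_itv.
have mshift (s : R) (D : set R) : measurable D -> D `<=` @Rpos R -> 0 < s ->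
    measurable_fun D (fun a : R => (phi f (a + s))%:E).
  move=> mD DR s0; apply: (@measurable_funS _ _ _ _ (@Rpos R)) => //.
  apply/measurable_EFinP; apply: open_continuous_measurable_fun; first exact: interval_open.
  move=> a; rewrite inE RposE => a0.
  apply: (@continuous_comp _ _ _ (fun x : R => x + s) (phi f)).
    by apply: cvgD; [exact: cvg_id|exact: cvg_cst].
  by apply: phi_cont hf fK _ _; lra.
have minv (k s : R) : 0 < s -> measurable_fun (@Rpos R) (fun a : R => (k / (a + s) ^+ 2)%:E).
  move=> s0; apply/measurable_EFinP; apply: open_continuous_measurable_fun; first exact: interval_open.
  move=> a; rewrite inE RposE => a0.
  exact: continuous_inv_sqr (ltW a0) s0.
pose g1 := (fun a : R => (phi f a)%:E + (phi f (a + eps))%:E)%E \_ `]0%R, d].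
pose g2 (a : R) := (128 * K * eps / (a + d) ^+ 2)%:E.
pose g3 (a : R) := (phi f (a + N))%:E.
pose g4 (a : R) := (32 * e0 * N / (a + eps) ^+ 2)%:E.
have sub0 : `]0%R, d]%classic `<=` @Rpos R.
  by move=> x /=; rewrite RposE in_itv /= => /andP[].
have g10 a : @Rpos R a -> (0 <= g1 a)%E.
  move=> _; rewrite /g1 patchE; case: ifP => // _.
  by rewrite -EFinD lee_fin addr_ge0 // phi_ge0.
have g20 a : @Rpos R a -> (0 <= g2 a)%E.
  rewrite RposE => a0; rewrite lee_fin divr_ge0 ?exprn_ge0 ?mulr_ge0 ?(ltW eps_gt0) //; lra.
have g30 a : @Rpos R a -> (0 <= g3 a)%E by move=> _; rewrite lee_fin phi_ge0.
have g40 a : @Rpos R a -> (0 <= g4 a)%E.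
  by rewrite RposE => a0; rewrite lee_fin divr_ge0 ?exprn_ge0 ?mulr_ge0 //; lra.
have mg1 : measurable_fun (@Rpos R) g1.
  apply/(measurable_restrict _ mI mR).
  apply: (@measurable_funS _ _ _ _ `]0%R, d]) => //.
  apply: emeasurable_funD; first by apply: phi_meas hf fK _ _.
  exact: mshift.
have mg2 : measurable_fun (@Rpos R) g2 by exact: minv.
have mg3 : measurable_fun (@Rpos R) g3 by exact: mshift.
have mg4 : measurable_fun (@Rpos R) g4 by exact: minv.
have mg12 : measurable_fun (@Rpos R) (fun a => g1 a + g2 a)%E by exact: emeasurable_funD.
have mg123 : measurable_fun (@Rpos R) (fun a => g1 a + g2 a + g3 a)%E by exact: emeasurable_funD.
apply: (@le_trans _ _ (\int[leb]_(a in @Rpos R) (g1 a + g2 a + g3 a + g4 a))%E).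
  apply: ge0_le_integral => //.
  - by move=> a _; rewrite lee_fin phi_ge0.
  - exact: phi_meas hu uM _ _.
  - exact: emeasurable_funD.
  - move=> a; rewrite RposE => a0.
    have -> : (g1 a + g2 a + g3 a + g4 a)%E = ((if a <= d then phi f a + phi f (a + eps) else 0)
      + 128 * K * eps / (a + d) ^+ 2 + phi f (a + N) + 32 * e0 * N / (a + eps) ^+ 2)%:E.
      rewrite /g1 patchE !EFinD; congr (_ + _ + _ + _)%E.
      case: (leP a d) => ad; first by rewrite mem_set //= in_itv /= a0.
      by rewrite memNset //= in_itv /= a0 /= leNgt ad.
    by rewrite lee_fin; apply: phi_le => b; exact: reg_hder.
rewrite ge0_integralD //; last by move=> a Ra; rewrite !adde_ge0 // ?g10 ?g20 ?g30.
rewrite ge0_integralD //; last by move=> a Ra; rewrite !adde_ge0 // ?g10 ?g20.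
rewrite ge0_integralD //.
rewrite !EFinD; apply: leeD; last by rewrite /g4 integral_inv_sqr ?mulr_ge0 // ltW.
apply: leeD; last first.
  (* Translation by [N] turns this term into the tail of the integral of [phi f] beyond [N]; the
     shift by [eps] is treated in the same way below. *)
  rewrite (le_trans _ I3) // (@integral_shift R N `]N, +oo[) //.
  - rewrite /g3 le_eqVlt; apply/orP; left; apply/eqP.
    congr (integral _ _ _).
    by apply/seteqP; split => x /=; rewrite /Rpos /= !in_itv /= !andbT; lra.
  - apply: phi_meas hf fK _ _ => //.
    by move=> x /=; rewrite RposE in_itv /= andbT; lra.
  - by move=> x _; rewrite lee_fin phi_ge0.
apply: leeD; last by rewrite /g2 integral_inv_sqr ?mulr_ge0 // ltW.
rewrite /g1 -integral_mkcondr setIidr //.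
rewrite ge0_integralD //.
- apply: leeD => //.
  rewrite (le_trans _ I2) //.
  apply: (@le_trans _ _ (\int[leb]_(a in `]eps, (d + eps)%R]) (phi f a)%:E)%E).
    rewrite (@integral_shift R eps `]eps, (d + eps)%R]) //.
    + rewrite le_eqVlt; apply/orP; left; apply/eqP.
      congr (integral _ _ _).
      by apply/seteqP; split => x /=; rewrite !in_itv /=; lra.
    + apply: phi_meas hf fK _ _ => //.
      by move=> x /=; rewrite RposE in_itv /=; lra.
    + by move=> x _; rewrite lee_fin phi_ge0.
  apply: ge0_subset_integral => //.
  + apply: phi_meas hf fK _ _ => //.
    by move=> x /=; rewrite RposE in_itv /=; lra.
  + by move=> x _; rewrite lee_fin phi_ge0.
  + by move=> x /=; rewrite !in_itv /=; lra.
- by move=> x _; rewrite lee_fin phi_ge0.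
- exact: phi_meas hf fK _ _.
- by move=> x _; rewrite lee_fin phi_ge0.
- exact: mshift.
Qed.

End Estimate.

Lemma supn_ltP f (e : R) : (supn f < e%:E)%E -> bounded_by e f.
Proof.
move=> H z z0; rewrite -lee_fin (le_trans _ (ltW H)) //.
by apply: ereal_sup_ubound; exists z.
Qed.

Lemma supn_le f (e : R) : bounded_by e f -> (supn f <= e%:E)%E.
Proof. by move=> H; apply: ge_ereal_sup => _ [z z0 <-]; rewrite lee_fin; exact: H. Qed.

Lemma B0norm_ge0 f : (0 <= B0norm f)%E.
Proof.
apply: integral_ge0 => a _.
apply: (@le_trans _ _ (cabs (hder f (a +i* 0)%C))%:E); first by rewrite lee_fin cabs_ge0.
by apply: ereal_sup_ubound; exists 0 => //; rewrite hderE.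
Qed.

Theorem closB_eq_closInf (Y : set (R[i] -> R[i])) :
  (forall g, Y g -> holo g) -> (forall g, Y g -> exists M, bounded_by M g) ->
  (forall g, Y g -> shift_diff Y g) ->
  closB Y = closInf Y.
Proof.
move=> Yh Yb Ys; apply/seteqP; split => f [Bf H]; split => // e e0.
  have [g Yg Hg] := H e e0; exists g => //.
  by rewrite (le_lt_trans _ Hg) // /Bnorm leeDl // B0norm_ge0.
have [hf Bf0] := Bf.
(* An approximation within 1 serves only to bound [f], so that [K] is fixed before [N], [eps] and
   the final accuracy are chosen. *)
have [g1 Yg1 /supn_ltP fg1] := H 1 ltr01; have [M1 g1M] := Yb _ Yg1.
have fK : bounded_by (M1 + 1) f.
  move=> z z0; have := fg1 z z0; have := g1M z z0.
  by have := cabs_sub_ge (f z) (g1 z); lra.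
have {fg1 Yg1} M10 : 0 <= M1 by rewrite (le_trans (cabs_ge0 _) (g1M 1 _)) //= ltr01.
have : 0 < M1 + 1 by lra.
move: (M1 + 1) fK => K fK K0.
(* The integral norm of the error will be at most 5 eta and its sup norm at most 11 eta, 16 eta in
   all. *)
pose eta := e / 40; have eta0 : 0 < eta by rewrite divr_gt0.
have [d2 d20 Id] := phi_small hf fK Bf0 eta0.
have [N N1 IN] := phi_tail hf fK Bf0 eta0.
(* Half of [d2] leaves room for the shift: d + eps <= d2. *)
pose d := d2 / 2; have d0 : 0 < d by rewrite divr_gt0.
pose eps := Num.min (Num.min d (1 / 2)) (eta * d / (128 * K)).
have eps0 : 0 < eps by rewrite !lt_min d0 !divr_gt0 ?mulr_gt0.
have epsd : eps <= d by rewrite !ge_min lexx.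
have eps1 : eps <= 1 / 2 by rewrite !ge_min lexx !orbT.
have epsK : eps <= eta * d / (128 * K) by rewrite !ge_min lexx !orbT.
have epsN : eps < N by lra.
have N0 : 0 < N by lra.
pose e1 := Num.min eta (eta * eps / (32 * N)).
have e10 : 0 < e1 by rewrite lt_min eta0 !divr_gt0 ?mulr_gt0.
have e1e : e1 <= eta by rewrite ge_min lexx.
have e1N : e1 <= eta * eps / (32 * N) by rewrite ge_min lexx orbT.
have [g Yg /supn_ltP fg] := H e1 e10.
have [h [c [Yh' hE gc]]] := Ys g Yg eps N eps0 epsN.
exists h => //.
pose u z := f z - h z.
have hu : holo u := @reg_holo f g h c eps N hf (Yh _ Yg) eps0 epsN hE.
have [M hM] := Yb _ Yh'.
have uM : bounded_by (K + M) u.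
  move=> z z0; have := fK z z0; have := hM z z0; have := cabsB (f z) (h z).
  by rewrite /u; lra.
have sm (x : R) : 0 <= x <= d2 -> (\int[leb]_(a in `]0%R, x]) (phi f a)%:E <= eta%:E)%E.
  move=> /andP[x0 xd]; rewrite (le_trans _ Id) //; apply: ge0_subset_integral => //.
  - by apply: phi_meas hf fK _ _ => // y /=; rewrite RposE in_itv /= => /andP[].
  - by move=> y _; rewrite lee_fin phi_ge0.
  - by move=> y /=; rewrite !in_itv /=; lra.
have dd : 0 <= d <= d2 by rewrite /d; lra.
have dde : 0 <= d + eps <= d2 by move: epsd; rewrite /d; lra.
have B0 := @reg_B0 f g h c K eps N d e1 hf fK (Yh _ Yg) fg eps0 epsd epsN hE (K + M) eta Bf0 uM
  (sm _ dd) (sm _ dde) IN.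
have {}B0 : (\int[leb]_(a in @Rpos R) (phi u a)%:E <= (5 * eta)%:E)%E.
  rewrite (le_trans B0) // lee_fin.
  have q1 : 128 * K * eps / d <= eta.
    rewrite ler_pdivrMr // mulrC -ler_pdivlMr // mulr_gt0 //.
  have q2 : 32 * e1 * N / eps <= eta.
    rewrite ler_pdivrMr //; move: e1N; rewrite ler_pdivlMr ?mulr_gt0 //.
    by have -> : 32 * e1 * N = e1 * (32 * N) by ring.
  lra.
(* At +oo the two shifts of [g] cancel and [c] remains, so that [f - h] is there as small as
   [f - g], that is at most [eta] up to [t]. *)
have su : bounded_by (2 * (5 * eta) + eta) u.
  apply: (sup_le_B0 hu uM B0) => b t t0.
  have [A HA] := gc b _ (divr_gt0 t0 (ltr0Sn _ 2)).
  exists (Num.max A 1) => a; rewrite ge_max => /andP[Aa a1].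
  have a0 : 0 < a by lra.
  have zs (s : R) : ((a +i* b) + s%:C = (a + s) +i* b)%C.
    by apply: complex_ext; rewrite /= ?addr0.
  have G0 := HA a Aa.
  have G1 : cabs (g ((a + eps) +i* b)%C - c) <= t / 3 by apply: HA; lra.
  have G2 : cabs (g ((a + N) +i* b)%C - c) <= t / 3 by apply: HA; lra.
  have := fg (a +i* b)%C a0.
  rewrite /u hE //= !zs; move: G0 G1 G2.
  move: (f _) (g (a +i* b)%C) (g ((a + eps) +i* b)%C) (g ((a + N) +i* b)%C) => F G P Q G0 G1 G2 FG.
  have -> : F - (P - Q + c) = (F - G) + (G - c) - (P - c) + (Q - c) by ring.
  have := cabsD (F - G + (G - c) - (P - c)) (Q - c).
  have := cabsB (F - G + (G - c)) (P - c).
  have := cabsD (F - G) (G - c).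
  clear -G0 G1 G2 FG e1e; lra.
rewrite /Bnorm (B0normE hu uM).
apply: (@le_lt_trans _ _ ((2 * (5 * eta) + eta)%:E + (5 * eta)%:E)%E).
  by apply: leeD => //; exact: supn_le.
by rewrite -EFinD lte_fin /eta; lra.
Qed.

End RegularizationTheorem.

(** * Uniform approximation by combinations of resolvents *)

Section Density.
Variable R : realType.
Implicit Types (f g h : R[i] -> R[i]) (z w : R[i]) (P : (R[i] -> R[i]) -> Prop).

Definition near_sup (e : R) f g := forall z, 0 < complex.Re z -> cabs (f z - g z) <= e.

Definition lin_closed P := forall c f g, P f -> P g -> P (fun z => f z + c * g z).

Definition sup_closed P := forall f,
  (forall e : R, 0 < e -> exists2 g, P g & near_sup e f g) -> P f.

Definition has_resolvents P := forall l : R, 0 < l -> P (fun z => (z + (l%:C)%C)^-1).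

(* Membership in the sup-norm closed linear span of the functions 1/(z + l), l > 0. *)
Definition clspan f := forall P, has_resolvents P -> lin_closed P -> sup_closed P -> P f.

Lemma clspan_res : has_resolvents clspan.
Proof. by move=> l l0 P P1 P2 P3; exact: P1. Qed.

Lemma clspan_lin : lin_closed clspan.
Proof. by move=> c f g Hf Hg P P1 P2 P3; exact: (P2 c f g (Hf P P1 P2 P3) (Hg P P1 P2 P3)). Qed.

Lemma clspan_sup : sup_closed clspan.
Proof.
move=> f H P P1 P2 P3; apply: (P3 f) => e e0; have [g Hg fg] := H e e0.
by exists g => //; exact: Hg P P1 P2 P3.
Qed.

Lemma clspan_ext f g : (forall z, 0 < complex.Re z -> f z = g z) -> clspan g -> clspan f.
Proof.
move=> fg Hg; apply: clspan_sup => e e0; exists g => // z z0.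
by rewrite fg // subrr cabs0 ltW.
Qed.

Lemma cabs_addr_ge z (s : R) : 0 <= complex.Re z -> 0 <= s -> cabs z <= cabs (z + (s%:C)%C).
Proof.
case: z => x y /= x0 s0; rewrite addr0 ler_sqrt ?addr_ge0 ?sqr_ge0 //.
by rewrite lerD2r lerXn2r ?nnegrE ?addr_ge0 // lerDl.
Qed.

Lemma cabs_addr_ge' z (s : R) : 0 <= complex.Re z -> 0 <= s -> s <= cabs (z + (s%:C)%C).
Proof.
by move=> z0 s0; rewrite (le_trans _ (cabs_Re_ge _)) // ReD /= lerDr.
Qed.

Lemma addr_neq0 z (s : R) : 0 < complex.Re z -> 0 <= s -> z + (s%:C)%C != 0.
Proof.
move=> z0 s0; apply/eqP => /(congr1 (@complex.Re R)); rewrite ReD /=; lra.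
Qed.

Let one : ((1 : R)%:C)%C = 1 :> R[i]. Proof. by []. Qed.

(** Membership in [clspan] is applied to the predicate of being in [clspan] after multiplication.
    For l <> 1 partial fractions split the product of two resolvents; for l = 1 the double pole is a
    uniform limit of products with l = 1 + e. *)
Lemma clspan_mul f : clspan f -> clspan (fun z => (z + 1)^-1 * f z).
Proof.
have inv1 z : 0 < complex.Re z -> cabs (z + 1)^-1 <= 1.
  move=> z0; rewrite cabsV invf_le1 ?cabs_gt0; last exact: (@addr_neq0 z 1).
  by apply: (@cabs_addr_ge' z 1) => //; exact: ltW.
move=> Hf; apply: (Hf (fun f => clspan (fun z => (z + 1)^-1 * f z))) => {f Hf}.
- have gen (l : R) : 0 < l -> l != 1 -> clspan (fun z => (z + 1)^-1 * (z + (l%:C)%C)^-1).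
    move=> l0 l1.
    have k0 : ((1 - l)%:C)%C != 0 :> R[i].
      by rewrite -cabs_gt0 cabs_real normr_gt0 subr_eq0 eq_sym.
    pose k : R[i] := (((1 - l)%:C)%C)^-1.
    have H := clspan_lin (-1) (clspan_res l0) (clspan_res (@ltr01 R)).
    (* Only sums f + c g are at hand, so the multiple k H is formed as H + (k - 1) H. *)
    have H2 := clspan_lin (k - 1) H H.
    apply: clspan_ext H2 => z z0; rewrite one.
    have z1 : z + 1 != 0 by apply: (@addr_neq0 z 1) => //; exact: ltr01.
    have zl : z + (l%:C)%C != 0 by apply: addr_neq0 => //; exact: ltW.
    have -> : (z + (l%:C)%C)^-1 + -1 * (z + 1)^-1 =
        ((1 - l)%:C)%C * ((z + 1)^-1 * (z + (l%:C)%C)^-1).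
      by rewrite rmorphB /= one; field; rewrite z1 zl.
    by rewrite /k; move: k0; move: ((1 - l)%:C)%C => q q0; field; rewrite z1 zl q0.
  move=> l l0; have [l1|] := eqVneq l 1; last exact: gen.
  apply: clspan_sup => e e0.
  have e1 : 0 < 1 + e by lra.
  exists (fun z => (z + 1)^-1 * (z + ((1 + e)%:C)%C)^-1); first by apply: gen => //; lra.
  move=> z z0; rewrite l1 one.
  have z1 : z + 1 != 0 by apply: (@addr_neq0 z 1) => //; exact: ltr01.
  have ze : z + ((1 + e)%:C)%C != 0 by apply: addr_neq0 => //; exact: ltW.
  have -> : (z + 1)^-1 * (z + 1)^-1 - (z + 1)^-1 * (z + ((1 + e)%:C)%C)^-1 =
      (e%:C)%C * ((z + 1)^-1 * ((z + 1)^-1 * (z + ((1 + e)%:C)%C)^-1)).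
    by move: ze; rewrite rmorphD /= one => ze; field; rewrite z1 ze.
  rewrite cabsM cabs_real gtr0_norm // ler_piMr ?(ltW e0) // cabsM.
  rewrite mulr_ile1 ?cabs_ge0 ?inv1 // cabsM mulr_ile1 ?cabs_ge0 ?inv1 //.
  rewrite cabsV invf_le1 ?cabs_gt0 //.
  by have := @cabs_addr_ge' z (1 + e) (ltW z0) (ltW e1); lra.
- move=> c f g Hf Hg; apply: clspan_ext (clspan_lin c Hf Hg) => z _.
  by rewrite mulrDr mulrCA.
- move=> f H; apply: clspan_sup => e e0; have [g Hg fg] := H e e0.
  exists (fun z => (z + 1)^-1 * g z) => // z z0.
  by rewrite -mulrBr cabsM (le_trans _ (fg z z0)) // ler_piMl ?cabs_ge0 // inv1.
Qed.

Lemma clspan0 : clspan (fun=> 0).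
Proof.
have H := clspan_lin (-1) (clspan_res (@ltr01 R)) (clspan_res (@ltr01 R)).
by apply: clspan_ext H => z _; rewrite mulN1r subrr.
Qed.

(** The base is (z - 1)/(z + 1), the coordinate of the unit disc. Its powers tend to 1 at infinity,
    and subtracting 1 makes them vanish there. *)
Lemma clspan_cayley n : clspan (fun z => (1 - 2 * (z + 1)^-1) ^+ n - 1).
Proof.
elim: n => [|n IH]; first by apply: clspan_ext clspan0 => z _; rewrite expr0 subrr.
have H := clspan_lin (-2) (clspan_lin (-2) IH (clspan_mul IH)) (clspan_res (@ltr01 R)).
by apply: clspan_ext H => z _; rewrite exprS one; ring.
Qed.

Lemma clspan_sum (c : nat -> R[i]) n :
  clspan (fun z => \sum_(k < n) c k * ((1 - 2 * (z + 1)^-1) ^+ k - 1)).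
Proof.
elim: n => [|n IH]; first by apply: clspan_ext clspan0 => z _; rewrite big_ord0.
apply: clspan_ext (clspan_lin (c n) IH (clspan_cayley n)) => z _.
by rewrite big_ord_recr.
Qed.

(** This serves to show that the constant left over in [C0_clspan] is small. *)
Lemma clspan_decay f : clspan f ->
  forall e : R, 0 < e -> exists X : R, forall x, X <= x -> cabs (f (x%:C)%C) <= e.
Proof.
pose P f := forall e : R, 0 < e -> exists X : R, forall x, X <= x -> cabs (f (x%:C)%C) <= e.
move=> Hf; apply: (Hf P) => {f Hf}.
- move=> l l0 e e0; exists (e^-1) => x xe.
  have x0 : 0 < x by rewrite (lt_le_trans _ xe) // invr_gt0.
  rewrite -rmorphD cabsV cabs_real gtr0_norm ?addr_gt0 // invf_ple ?posrE ?addr_gt0 //.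
  by lra.
- move=> c f g Hf Hg e e0.
  have k0 : 0 < 1 + cabs c by have := cabs_ge0 c; lra.
  have e2 : 0 < e / 2 by rewrite divr_gt0.
  have [X1 H1] := Hf _ e2; have [X2 H2] := Hg _ (divr_gt0 e2 k0).
  exists (Num.max X1 X2) => x; rewrite ge_max => /andP[/H1 {}H1 /H2].
  rewrite ler_pdivlMr // => {}H2; rewrite (le_trans (cabsD _ _)) // [e]splitr lerD // cabsM.
  by have := cabs_ge0 (g (x%:C)%C); nra.
- move=> f H e e0; have e2 : 0 < e / 2 by rewrite divr_gt0.
  have [g Hg fg] := H _ e2; have [X HX] := Hg _ e2.
  exists (Num.max X 1) => x; rewrite ge_max => /andP[/HX gx x1].
  have x0 : 0 < complex.Re ((x%:C)%C : R[i]) by rewrite /=; lra.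
  by have := fg _ x0; have := cabs_sub_ge (f (x%:C)%C) (g (x%:C)%C); lra.
Qed.

Lemma cabs_sqr z : cabs z ^+ 2 = complex.Re z ^+ 2 + complex.Im z ^+ 2.
Proof. by case: z => x y; rewrite cabsE sqr_sqrtr // addr_ge0 // sqr_ge0. Qed.

Lemma cabs_lt1_sub z : 0 < complex.Re z -> cabs (z - 1) < cabs (z + 1).
Proof.
move=> z0; rewrite -(@ltr_pXn2r _ 2) ?nnegrE ?cabs_ge0 // !cabs_sqr !ReD !ImD !ReN !ImN /=.
by rewrite oppr0 !addr0; nra.
Qed.

(** Re v > 0 amounts to |v - 1| < |v + 1|, and here v - 1 = w (v + 1). *)
Lemma Re_cayley w : cabs w < 1 -> 0 < complex.Re ((1 + w) / (1 - w)).
Proof.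
move=> w1; have w10 : 1 - w != 0.
  by rewrite subr_eq0; apply/eqP => E; move: w1; rewrite -E cabs1 ltxx.
have n0 : 0 < cabs (1 - w) by rewrite cabs_gt0.
set v := (1 + w) / (1 - w).
have vE : v + 1 = 2 / (1 - w) by rewrite /v; field.
have vE' : v - 1 = 2 * w / (1 - w) by rewrite /v; field.
have : cabs (v - 1) < cabs (v + 1).
  rewrite vE vE' !cabsM ltr_pM2r ?cabsV ?invr_gt0 // gtr_pMr // cabs_gt0.
  by rewrite pnatr_eq0.
rewrite -(@ltr_pXn2r _ 2) ?nnegrE ?cabs_ge0 // !cabs_sqr !ReD !ImD !ReN !ImN /=.
by rewrite oppr0 !addr0; nra.
Qed.

(** On the disc the function [F] is uniformly a limit of Taylor polynomials only on smaller discs,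
    so it is evaluated at rho w. On the half-plane this composes [f] with [m], which moves points of
    a bounded set very little and keeps distant points distant, where [f] is small. A polynomial in
    the Cayley coordinate, less its value at infinity, belongs to [clspan]. *)
Theorem C0_clspan f : holo f -> C0prop f -> clspan f.
Proof.
move=> hf cf; apply: clspan_sup => e0 e00.
pose e := e0 / 8; have e_gt0 : 0 < e by rewrite divr_gt0.
have [M fM] := C0prop_bounded cf.
have M0 : 0 <= M by rewrite (le_trans (cabs_ge0 _) (fM 1 _)) //= ltr01.
have e2 : 0 < e / 2 by rewrite divr_gt0.
have [M1' fM1'] := cf.2 _ e2.
pose M1 := Num.max M1' 1.
have M11 : 1 <= M1 by rewrite le_max lexx orbT.
have fM1 z : 0 < complex.Re z -> M1 < cabs z -> cabs (f z) <= e / 2.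
  by move=> z0 zM; apply: fM1' => //; rewrite (le_lt_trans _ zM) // le_max lexx.
pose B := 2 * M1 + 2.
have [d d0 fd] := C0prop_unif B cf e_gt0.
(* For |z| <= B the third bound keeps z - m z = eps (z^2 - 1)/(1 + eps z) below [d]. The first gives
   M1 eps <= 1/2, so that |m z| > M1 as soon as |z| > B = 2 M1 + 2. The second makes rho
   positive. *)
pose eps := Num.min (B^-1) (Num.min (1 / 2) (d / (2 * (1 + B ^+ 2)))).
have B0 : 0 < B by rewrite /B; lra.
have B1 : 0 < 2 * (1 + B ^+ 2) by have := sqr_ge0 B; lra.
have eps0 : 0 < eps by rewrite !lt_min invr_gt0 B0 !divr_gt0.
have epsB : eps <= B^-1 by rewrite ge_min lexx.
have eps1 : eps <= 1 / 2 by rewrite !ge_min lexx orbT.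
have epsd : eps <= d / (2 * (1 + B ^+ 2)) by rewrite !ge_min lexx !orbT.
clearbody eps.
pose E : R[i] := (eps%:C)%C.
pose m z := (z + E) / (1 + E * z).
have mul_re z : complex.Re (E * z) = eps * complex.Re z.
  by case: z => x y /=; rewrite mul0r subr0.
have dn z : 0 < complex.Re z -> 1 <= cabs (1 + E * z).
  move=> z0; rewrite addrC; apply: (@cabs_addr_ge' (E * z) 1) => //.
  by rewrite mul_re mulr_ge0 // ltW.
have dn0 z : 0 < complex.Re z -> 1 + E * z != 0.
  by move=> z0; rewrite -cabs_gt0 (lt_le_trans ltr01) // dn.
have cE : cabs E = eps by rewrite cabs_real gtr0_norm.
pose rho := (1 - eps) / (1 + eps).
have rho0 : 0 < rho by rewrite divr_gt0; lra.
have rho1 : rho < 1 by rewrite ltr_pdivrMr; lra.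
pose W z := (1 - 2 * (z + 1)^-1).
have z1 z : 0 < complex.Re z -> z + 1 != 0.
  by move=> z0; apply: (@addr_neq0 z 1) => //; exact: ltr01.
have WE z : 0 < complex.Re z -> W z = (z - 1) / (z + 1).
  by move=> z0; rewrite /W; field; exact: z1.
have W1 z : 0 < complex.Re z -> cabs (W z) < 1.
  move=> z0; rewrite WE // cabsM cabsV ltr_pdivrMr ?mul1r ?cabs_lt1_sub //.
  by rewrite cabs_gt0 z1.
pose F w := f ((1 + w) / (1 - w)).
pose rC : R[i] := (rho%:C)%C.
have crC : cabs rC = rho by rewrite cabs_real gtr0_norm.
have E1 : 1 + E != 0.
  by rewrite addrC; apply: (@addr_neq0 E 1) => //; exact: ltr01.
have rCE : rC = (1 - E) / (1 + E).
  by rewrite /rC /rho /E rmorphM fmorphV rmorphB rmorphD /= one.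
have mE z : 0 < complex.Re z -> m z = (1 + rC * W z) / (1 - rC * W z).
  move=> z0; rewrite /m WE // rCE.
  have h1 := z1 _ z0; have h2 := dn0 _ z0.
  field; rewrite h2 E1 h1 /= ?andbT.
  apply/negP => /eqP X; move/eqP: h2; apply.
  have : 2 * (1 + E * z) = 0 by rewrite -[RHS]X; ring.
  by move/eqP; rewrite mulf_eq0 pnatr_eq0 /= => /eqP.
have FW z : 0 < complex.Re z -> F (rC * W z) = f (m z) by move=> z0; rewrite /F mE.
have Rm z : 0 < complex.Re z -> 0 < complex.Re (m z).
  move=> z0; rewrite mE //; apply: Re_cayley; rewrite cabsM crC -[ltRHS]mul1r.
  by rewrite ltr_pM ?cabs_ge0 ?(ltW rho0) // W1.
have fm z : 0 < complex.Re z -> cabs (f z - f (m z)) <= e.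
  move=> z0; have [zB|Bz] := leP (cabs z) B.
    apply: fd => //; first exact: Rm.
    have -> : z - m z = E * (z * z - 1) / (1 + E * z).
      by rewrite /m; field; exact: dn0.
    rewrite cabsM cabsV cabsM cE ltr_pdivrMr; last by rewrite (lt_le_trans ltr01) // dn.
    apply: (@lt_le_trans _ _ (d * 1)); last by rewrite ler_pM2l // dn.
    have zz : cabs (z * z - 1) <= B ^+ 2 + 1.
      rewrite (le_trans (cabsB _ _)) // cabs1 cabsM -expr2 lerD2r.
      by rewrite lerXn2r ?nnegrE ?cabs_ge0 // ltW.
    move: epsd; rewrite ler_pdivlMr // => epsd; rewrite mulr1.
    have : eps * cabs (z * z - 1) <= eps * (B ^+ 2 + 1) by rewrite ler_pM2l.
    lra.
  have h1 : cabs (f z) <= e / 2 by apply: fM1 => //; move: Bz; rewrite /B; lra.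
  have h2 : cabs (f (m z)) <= e / 2.
    apply: fM1; first exact: Rm.
    have q0 : 0 < cabs (1 + E * z) by rewrite (lt_le_trans ltr01) // dn.
    rewrite /m cabsM cabsV ltr_pdivlMr //.
    apply: (@lt_le_trans _ _ (cabs z)); last exact: cabs_addr_ge (ltW z0) (ltW eps0).
    have : cabs (1 + E * z) <= 1 + eps * cabs z.
      by rewrite (le_trans (cabsD _ _)) // cabs1 cabsM cE.
    have : M1 * eps <= 1 / 2.
      have : M1 * eps <= M1 * B^-1 by rewrite ler_wpM2l //; lra.
      have : M1 * B^-1 <= 1 / 2 by rewrite ler_pdivrMr // /B; lra.
      lra.
    move: q0 Bz; rewrite /B; have := cabs_ge0 z; move: (cabs z) (cabs (1 + E * z)) => p q p0 q0 Bp A1 A2.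
    have : M1 * q <= M1 * (1 + eps * p) by rewrite ler_wpM2l //; lra.
    have : M1 * eps * p <= 1 / 2 * p by rewrite ler_wpM2r.
    lra.
  by rewrite (le_trans (cabsB _ _)) // [e]splitr lerD.
have dF w : cabs w < 1 -> exists l, cdiff F w l.
  move=> w1; have w10 : 1 - w != 0.
    by rewrite subr_eq0; apply/eqP => X; move: w1; rewrite -X cabs1 ltxx.
  have C := cdiffM (cdiffD (cdiff_cst 1 w) (cdiff_id w))
     (cdiffV (cdiffB (cdiff_cst 1 w) (cdiff_id w)) w10).
  eexists; apply: (cdiff_comp C); apply: holo_cdiff => //; exact: Re_cayley.
have bF w : cabs w < 1 -> cabs (F w) <= M by move=> w1; apply: fM; exact: Re_cayley.
(* The radius lies strictly between [rho], for geometric convergence at rho w, and 1, the radius of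
   the disc where [F] is holomorphic. *)
pose r := (1 + rho) / 2.
have r01 : 0 < r < 1 by rewrite /r; lra.
have [c [_ Tc]] := taylor r01 dF bF.
have rr : 0 < r - rho by rewrite /r; lra.
have r0 : 0 < r by case/andP: r01.
clearbody r.
have [n Hn] : exists n, (rho / r) ^+ n * (2 * M * (r / (r - rho))) <= e.
  apply: pow_small => //.
    by apply/andP; split; [rewrite divr_ge0 // ltW|rewrite ltr_pdivrMr // mul1r -subr_gt0].
  by rewrite !mulr_ge0 ?invr_ge0 ?(ltW r0) ?(ltW rr).
pose C k := c k * rC ^+ k.
pose G z := \sum_(k < n) C k * W z ^+ k.
have fG z : 0 < complex.Re z -> cabs (f (m z) - G z) <= e.
  move=> z0; rewrite -FW //.
  have wr : cabs (rC * W z) <= rho.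
    by rewrite cabsM crC ler_piMr ?(ltW rho0) // ltW // W1.
  have wr' : cabs (rC * W z) < r by rewrite (le_lt_trans wr) // -subr_gt0.
  have := Tc n _ wr'.
  have -> : \sum_(k < n) c k * (rC * W z) ^+ k = G z.
    by apply: eq_bigr => k _; rewrite exprMn mulrA.
  move=> /le_trans; apply; rewrite (le_trans _ Hn) // mulrCA.
  have v0 := cabs_ge0 (rC * W z).
  have vr : 0 < r - cabs (rC * W z) by rewrite subr_gt0.
  apply: ler_pM => //.
  - by rewrite exprn_ge0 // divr_ge0 // ltW.
  - by rewrite !mulr_ge0 ?invr_ge0 ?(ltW r0) ?(ltW vr).
  - apply: lerXn2r; rewrite ?nnegrE; try by rewrite divr_ge0 // ltW.
    by rewrite ler_pM2r // invr_gt0.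
  - by rewrite ler_wpM2l ?mulr_ge0 // ler_wpM2l ?(ltW r0) // lef_pV2 ?posrE // lerD2l lerN2.
pose Ginf := \sum_(k < n) C k.
have cG := clspan_sum C n.
exists (fun z => \sum_(k < n) C k * (W z ^+ k - 1)) => //.
have GE z : \sum_(k < n) C k * (W z ^+ k - 1) = G z - Ginf.
  by rewrite /G /Ginf -sumrB; apply: eq_bigr => k _; rewrite mulrBr mulr1.
(* [Ginf] is the value of the polynomial at infinity. Far out on the real axis [f] is small, [G] is
   within 2 e of [f], and G - Ginf is small as a member of [clspan]. *)
have Gsmall : cabs Ginf <= 4 * e.
  have [X HX] := clspan_decay cG e_gt0.
  pose x := Num.max X (Num.max 1 (M1 + 1)).
  have xX : X <= x by rewrite le_max lexx.
  have x1 : 1 <= x by rewrite !le_max lexx orbT.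
  have xM : M1 + 1 <= x by rewrite !le_max lexx !orbT.
  have x0 : 0 < complex.Re ((x%:C)%C : R[i]) by rewrite /=; lra.
  have := HX x xX; rewrite -/(W _) GE.
  have := fG _ x0; have := fm _ x0.
  have : cabs (f (x%:C)%C) <= e / 2.
    by apply: fM1 => //; rewrite cabs_real gtr0_norm; lra.
  move: (f (x%:C)%C) (f (m _)) (G _) => a b p H1 H2 H3 H4.
  have -> : Ginf = a - (a - b) - (b - p) - (p - Ginf) by ring.
  have := cabsB (a - (a - b) - (b - p)) (p - Ginf).
  have := cabsB (a - (a - b)) (b - p).
  have := cabsB a (a - b).
  lra.
move=> z z0; rewrite GE.
have := fG _ z0; have := fm _ z0.
move: (f z) (f (m _)) (G _) => a b p H2 H3.
have -> : a - (p - Ginf) = (a - b) + (b - p) + Ginf by ring.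
have := cabsD (a - b + (b - p)) Ginf; have := cabsD (a - b) (b - p).
by move: Gsmall; rewrite /e; rewrite /e in H2 H3; lra.
Qed.

End Density.

(** * Criteria for spaces of C_0 functions *)

Section DenseSpaces.
Variable R : realType.
Implicit Types (f g h : R[i] -> R[i]) (z w : R[i]) (Y : set (R[i] -> R[i])).

(** Equality is asked on the open half-plane, since that is where the transform of a combination of
    densities is identified. *)
Definition lin_stable Y := forall c g1 g2, Y g1 -> Y g2 -> exists2 h, Y h &
  forall z, 0 < complex.Re z -> h z = g1 z + c * g2 z.

Definition shift_stable Y := forall g (s : R), Y g -> 0 <= s -> exists2 h, Y h &
  forall z, 0 < complex.Re z -> h z = g (z + (s%:C)%C).

Definition approx_resolvents Y := forall l e : R, 0 < l -> 0 < e -> exists2 g, Y g &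
  near_sup e (fun z => (z + (l%:C)%C)^-1) g.

(** Functions in C_0 have limit 0 to the right, so the constant is 0 and a difference of two shifts
    is already the required function. *)
Lemma stable_shift_diff Y g : lin_stable Y -> shift_stable Y ->
  Y g -> C0prop g -> shift_diff Y g.
Proof.
move=> Yl Ys Yg [_ dg] eps N eps0 epsN.
have [h1 Yh1 E1] := Ys g eps Yg (ltW eps0).
have [h2 Yh2 E2] := Ys g N Yg (ltW (lt_trans eps0 epsN)).
have [h Yh E] := Yl (-1) h1 h2 Yh1 Yh2.
exists h, 0; split => // [z z0|b e e0].
  by rewrite E // E1 // E2 // mulN1r addr0.
have [M HM] := dg e e0; exists (Num.max 1 (M + 1)) => a; rewrite ge_max => /andP[a1 aM].
rewrite subr0; apply: HM; first by rewrite /=; lra.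
by rewrite (lt_le_trans _ (cabs_Re_ge _)) //=; lra.
Qed.

Theorem closB_C0 Y : closB Y = closInf Y -> (forall g, Y g -> C0prop g) ->
  lin_stable Y -> approx_resolvents Y ->
  closB Y = [set f | Bspace f /\ C0cl f].
Proof.
move=> -> Yc Yl Yr; apply/seteqP; split => f [Bf H]; split => //.
  apply: C0prop_cl; apply: C0prop_limit => e e0.
  have [g Yg fg] := H e e0; exists g; [exact: Yc|exact: supn_ltP fg].
have [hf _] := Bf.
suff ap : forall e : R, 0 < e -> exists2 g, Y g & near_sup e f g.
  move=> e e0; have [g Yg fg] := ap _ (divr_gt0 e0 (ltr0Sn _ 1)); exists g => //.
  by rewrite (le_lt_trans (supn_le fg)) // lte_fin; lra.
(* Uniform approximability by [Y] is a predicate that contains the resolvents and is closed under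
   combinations and uniform limits, so it holds on all of [clspan]. *)
apply: (C0_clspan hf (C0cl_prop H)
  (P := fun f => forall e : R, 0 < e -> exists2 g, Y g & near_sup e f g)).
- by move=> l l0 e e0; exact: Yr.
- move=> c f1 f2 H1 H2 e e0.
  have k0 : 0 < 1 + cabs c by have := cabs_ge0 c; lra.
  have e2 : 0 < e / 2 by rewrite divr_gt0.
  have [g1 Y1 fg1] := H1 _ e2; have [g2 Y2 fg2] := H2 _ (divr_gt0 e2 k0).
  have [h Yh hE] := Yl c g1 g2 Y1 Y2; exists h => // z z0.
  rewrite hE // opprD addrACA -mulrBr (le_trans (cabsD _ _)) // [e]splitr lerD ?fg1 //.
  rewrite cabsM; have := fg2 z z0; rewrite ler_pdivlMr //.
  by have := cabs_ge0 (f2 z - g2 z); move: (cabs (_ - _)) => q; nra.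
- move=> f1 H1 e e0; have e2 : 0 < e / 2 by rewrite divr_gt0.
  have [g1 P1 fg1] := H1 _ e2; have [g2 Y2 fg2] := P1 _ e2.
  exists g2 => // z z0; have := fg1 z z0; have := fg2 z z0.
  by have := cabs_dist_trans (g1 z) (f1 z) (g2 z); lra.
Qed.

Lemma ccont_C0prop f : (forall z, 0 <= complex.Re z -> ccont f z) ->
  (forall e : R, 0 < e -> exists M : R, forall z, 0 < complex.Re z -> M < cabs z -> cabs (f z) <= e) ->
  C0prop f.
Proof.
move=> cf df; split => // z z0 e e0.
have [d d0 H] := cf z z0 _ (divr_gt0 e0 (ltr0Sn _ 1)); exists d => // v w _ _ /H H1 /H H2.
by rewrite (le_trans (cabs_dist_trans (f z) _ _)) // (cabs_distC (f z)); lra.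
Qed.

End DenseSpaces.

(** * Rational functions vanishing at infinity *)

Section RationalFunctions.
Variable R : realType.
Implicit Types (p q : {poly R[i]}) (z : R[i]).

Lemma poly_cdiff p z : exists l, cdiff (horner p) z l.
Proof.
elim/poly_ind: p => [|p c [l IH]].
  exists 0; have -> : horner (0 : {poly R[i]}) = fun=> 0 by apply/funext => w; rewrite horner0.
  exact: cdiff_cst.
have -> : horner (p * 'X + c%:P) = fun w => p.[w] * w + c.
  by apply/funext => w; rewrite !hornerE.
eexists; apply: cdiffD (cdiff_cst _ _); apply: cdiffM IH (cdiff_id z).
Qed.

Lemma rat_cdiff p q z : q.[z] != 0 -> exists l, cdiff (fun z => p.[z] / q.[z]) z l.
Proof.
move=> qz; have [l Hp] := poly_cdiff p z; have [l' Hq] := poly_cdiff q z.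
by eexists; apply: cdiffM Hp (cdiffV Hq qz).
Qed.

(** The factor |z| on the left expresses growth of order m - 1 without a subtraction, so that m = 0
    is included. *)
Lemma poly_growth p m : (size p <= m)%N -> exists2 C : R, 0 <= C &
  forall z, 1 <= cabs z -> cabs p.[z] * cabs z <= C * cabs z ^+ m.
Proof.
move=> pm; exists (\sum_(i < m) cabs p`_i); first by apply: sumr_ge0 => i _; exact: cabs_ge0.
move=> z z1; rewrite (horner_coef_wide _ pm) !mulr_suml.
apply: (@le_trans _ _ ((\sum_(i < m) cabs (p`_i * z ^+ i)) * cabs z)).
  rewrite ler_wpM2r ?cabs_ge0 //.
  elim/big_ind2: _ => [|x1 x2 y1 y2 h1 h2|//]; first by rewrite cabs0.
  by rewrite (le_trans (cabsD _ _)) // lerD.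
rewrite mulr_suml; apply: ler_sum => i _; rewrite cabsM cabsX -mulrA -exprSr.
by rewrite ler_wpM2l ?cabs_ge0 // ler_weXn2l.
Qed.

Lemma rat_decay p q : (size p < size q)%N -> forall e : R, 0 < e -> exists M : R,
  forall z, M < cabs z -> cabs (p.[z] / q.[z]) <= e.
Proof.
move=> pq e e0.
have q0 : q != 0 by rewrite -size_poly_gt0 (leq_ltn_trans _ pq).
pose m := (size q).-1.
have qm : size q = m.+1 by rewrite /m prednK // size_poly_gt0.
have [C C0 HC] : exists2 C : R, 0 <= C & forall z, 1 <= cabs z -> cabs p.[z] * cabs z <= C * cabs z ^+ m.
  by apply: poly_growth; rewrite -ltnS -qm.
(* [q] without its leading term: it is dominated by half of that term for large z, which bounds |q|
   from below. *)
pose q' := q - lead_coef q *: 'X^m.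
have [D D0 HD] : exists2 C : R, 0 <= C & forall z, 1 <= cabs z -> cabs q'.[z] * cabs z <= C * cabs z ^+ m.
  apply: poly_growth; apply/leq_sizeP => j mj; rewrite coefB coefZ coefXn.
  have [->|jm] := eqVneq j m; first by rewrite mulr1 lead_coefE subrr.
  by rewrite mulr0 subr0 nth_default // qm ltn_neqAle eq_sym jm.
pose L := cabs (lead_coef q).
have L0 : 0 < L by rewrite cabs_gt0 lead_coef_eq0.
exists (Num.max 1 (Num.max (2 * D / L) (2 * C / L / e))) => z; rewrite !gt_max => /and3P[z1 zD zC].
have {}HC := HC z (ltW z1); have {}HD := HD z (ltW z1).
have z0 : 0 < cabs z by lra.
have zm : 0 < cabs z ^+ m by rewrite exprn_gt0.
have qE : q.[z] = lead_coef q * z ^+ m + q'.[z] by rewrite /q' hornerD hornerN hornerZ hornerXn addrC subrK.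
have hq : L / 2 * cabs z ^+ m <= cabs q.[z].
  have : cabs q'.[z] <= L / 2 * cabs z ^+ m.
    rewrite -(ler_pM2r z0) (le_trans HD) //.
    have -> : L / 2 * cabs z ^+ m * cabs z = L / 2 * cabs z * cabs z ^+ m by ring.
    rewrite ler_pM2r //; move: zD; rewrite ltr_pdivrMr //; lra.
  have := cabs_sub_ge (lead_coef q * z ^+ m) (- q'.[z]); rewrite opprK -qE cabsN cabsM cabsX -/L.
  move: (_ ^+ m) (cabs q.[z]) (cabs q'.[z]) => X Y Z; lra.
have q0' : 0 < cabs q.[z] by rewrite (lt_le_trans _ hq) // mulr_gt0 // divr_gt0.
rewrite cabsM cabsV ler_pdivrMr // -(ler_pM2r z0) (le_trans HC) //.
apply: (@le_trans _ _ (e * (L / 2 * cabs z ^+ m) * cabs z)); last first.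
  by rewrite ler_pM2r // ler_pM2l.
have -> : e * (L / 2 * cabs z ^+ m) * cabs z = e * (L / 2) * cabs z * cabs z ^+ m by ring.
rewrite ler_pM2r //; move: zC; rewrite !ltr_pdivrMr //; nra.
Qed.

Lemma root_neq0 q z : (forall z, root q z -> complex.Re z < 0) -> 0 <= complex.Re z -> q.[z] != 0.
Proof. by move=> Hq z0; apply: contraTneq z0 => /rootP /Hq; rewrite -ltNge. Qed.

Lemma R0_C0prop g : R0 R g -> C0prop g.
Proof.
move=> [p [q [pq Hq ->]]]; apply: ccont_C0prop => [z z0|e e0].
  by have [l] := rat_cdiff p (root_neq0 Hq z0); exact: cdiff_cont.
by have [M HM] := rat_decay pq e0; exists M => z _; exact: HM.
Qed.

Lemma R0_holo g : R0 R g -> holo g.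
Proof.
move=> [p [q [pq Hq ->]]]; apply: cdiff_holo => z z0.
exact: rat_cdiff (root_neq0 Hq (ltW z0)).
Qed.

Lemma R0_lin : lin_stable (R0 R).
Proof.
move=> c _ _ [p1 [q1 [pq1 Hq1 ->]]] [p2 [q2 [pq2 Hq2 ->]]].
exists (fun z => (p1 * q2 + c *: (p2 * q1)).[z] / (q1 * q2).[z]).
  exists (p1 * q2 + c *: (p2 * q1)), (q1 * q2); split => //; last first.
    by move=> z; rewrite rootM => /orP[/Hq1|/Hq2].
  have q10 : q1 != 0 by rewrite -size_poly_gt0 (leq_ltn_trans _ pq1).
  have q20 : q2 != 0 by rewrite -size_poly_gt0 (leq_ltn_trans _ pq2).
  have q10' : (0 < size q1)%N by rewrite size_poly_gt0.
  have q20' : (0 < size q2)%N by rewrite size_poly_gt0.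
  rewrite size_mul //.
  have s1 := size_polyMleq p1 q2; have s2 := size_polyMleq p2 q1.
  have s3 := size_scale_leq c (p2 * q1).
  rewrite (leq_ltn_trans (size_polyD _ _)) // gtn_max; apply/andP; split.
    rewrite (leq_ltn_trans s1) // -!subn1 ltn_sub2r ?ltn_add2r //.
    by rewrite -addn1 leq_add.
  rewrite (leq_ltn_trans s3) // (leq_ltn_trans s2) // -!subn1 addnC ltn_sub2r ?ltn_add2l //.
  by rewrite -addn1 leq_add.
move=> z z0; have h1 := root_neq0 Hq1 (ltW z0); have h2 := root_neq0 Hq2 (ltW z0).
rewrite hornerD hornerZ !hornerM.
by move: (p1.[z]) (p2.[z]) (q1.[z]) (q2.[z]) h1 h2 => a b k l h1 h2; field; rewrite h1 h2.
Qed.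

Lemma R0_shift : shift_stable (R0 R).
Proof.
move=> _ s [p [q [pq Hq ->]]] s0.
exists (fun z => (p \Po ('X + (s%:C)%C%:P)).[z] / (q \Po ('X + (s%:C)%C%:P)).[z]).
  exists (p \Po ('X + (s%:C)%C%:P)), (q \Po ('X + (s%:C)%C%:P)); split => //.
    by rewrite !size_comp_poly2 ?size_XaddC.
  move=> z; rewrite /root horner_comp !hornerE => /Hq; rewrite ReD /=; lra.
by move=> z z0; rewrite !horner_comp !hornerE.
Qed.

Lemma R0_resolvents : approx_resolvents (R0 R).
Proof.
move=> l e l0 e0; exists (fun z => (1 : {poly R[i]}).[z] / ('X + (l%:C)%C%:P).[z]).
  exists 1, ('X + (l%:C)%C%:P); split => //; first by rewrite size_XaddC size_poly1.
  move=> z; rewrite /root !hornerE addr_eq0 => /eqP ->; rewrite ReN /=; lra.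
by move=> z z0; rewrite !hornerE ?mul1r subrr cabs0 ltW.
Qed.

End RationalFunctions.

(** * The entire functions (1 - exp(-T w)) / w *)

Section ExponentialQuotient.
Variable R : realType.
Implicit Types (f g h H : R[i] -> R[i]) (z w l : R[i]).

(** The expansion of [H] at 0 starts with 0 and [l]; hence H(w)/w = l + c2 w + O(w^2), and c2 is the
    derivative of the completed quotient. *)
Lemma removable H l (M : R) : (forall z, exists l, cdiff H z l) -> (forall z, z = 0 -> H z = 0) -> cdiff H 0 l ->
  (forall z, cabs z < 2 -> cabs (H z) <= M) ->
  exists l', cdiff (fun w => if w == 0 then l else H w / w) 0 l'.
Proof.
move=> dH H0 Hl bH.
have r01 : 0 < (1 : R) < (2 : R) by apply/andP; split; [exact: ltr01|rewrite ltr1n].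
have [c [_ Tc]] := taylor r01 (fun z _ => dH z) bH.
have M0 : 0 <= M by rewrite (le_trans (cabs_ge0 _) (bH 0 _)) // cabs0.
have c0 k : k = 0%N -> c k = 0.
  move=> ->; have := Tc 1%N 0; rewrite cabs0 => /(_ ltr01).
  rewrite big_ord1 expr0 mulr1 mul0r expr1 mul0r mulr0 (H0 0) // sub0r cabsN => c0.
  by apply/eqP; rewrite -cabs_eq0 eq_le cabs_ge0 andbT.
have half (x : R) : 0 <= x -> x <= 1 / 2 -> 1 / (1 - x) <= 2.
  by move=> x0 x1; rewrite ler_pdivrMr; lra.
have c1 k : k = 1%N -> c k = l.
  move=> ->; apply: cdiff_unique Hl => e e0.
  exists (Num.min (1 / 2) (e / (4 * M + 1))).
    by rewrite lt_min !divr_gt0 //; lra.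
  move=> w; rewrite lt_min => /andP[w1]; rewrite ltr_pdivlMr; last by lra.
  have w0 := cabs_ge0 w => w2; have w1' : cabs w < 1 by lra.
  have := Tc 2%N w w1'; rewrite big_ord_recr big_ord1 /= (c0 0%N) // mul0r add0r expr1 divr1.
  rewrite add0r (H0 0) // subr0 => /le_trans; apply.
  have := half _ w0 (ltW w1); move: (1 / _) => q hq.
  have : cabs w ^+ 2 * q <= cabs w ^+ 2 * 2 by rewrite ler_wpM2l // sqr_ge0.
  move: (cabs w) w0 w2 => p p0 w2 hp.
  have : 2 * M * (p ^+ 2 * q) <= 2 * M * (p ^+ 2 * 2) by rewrite ler_wpM2l // mulr_ge0.
  have : (p * (4 * M + 1)) * p <= e * p by rewrite ler_wpM2r // ltW.
  by have := sqr_ge0 p; rewrite expr2; lra.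
exists (c 2%N) => e e0.
exists (Num.min (1 / 2) (e / (4 * M + 1))).
  by rewrite lt_min !divr_gt0 //; lra.
move=> w; rewrite lt_min => /andP[w1]; rewrite ltr_pdivlMr; last by lra.
have w0 := cabs_ge0 w => w2; have w1' : cabs w < 1 by lra.
rewrite add0r eqxx; case: eqVneq => [->|wn]; first by rewrite subrr mulr0 subrr cabs0 mulr0.
have := Tc 3%N w w1'; rewrite !big_ord_recr big_ord0 /= (c0 0%N) // (c1 1%N) // mul0r !add0r expr1 divr1.
have -> : H w - (l * w + c 2%N * w ^+ 2) = (H w / w - l - c 2%N * w) * w by field.
rewrite cabsM => hT; have wp : 0 < cabs w by rewrite cabs_gt0.
rewrite -(ler_pM2r wp) (le_trans hT) //.
have := half _ w0 (ltW w1); move: (1 / _) => q hq.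
have : cabs w ^+ 3 * q <= cabs w ^+ 3 * 2 by rewrite ler_wpM2l // exprn_ge0.
move: (cabs w) w0 w2 => p p0 w2 hp.
have : 2 * M * (p ^+ 3 * q) <= 2 * M * (p ^+ 3 * 2) by rewrite ler_wpM2l // mulr_ge0.
have : (p * (4 * M + 1)) * (p * p) <= e * (p * p) by rewrite ler_wpM2r ?mulr_ge0 // ltW.
have -> : p ^+ 3 = p * p * p by rewrite !exprS expr0; ring.
by have := mulr_ge0 (mulr_ge0 p0 p0) p0; lra.
Qed.

(** The Laplace transform of the indicator of [0, T]. For large T it is uniformly close to 1/w on Re
    w >= l > 0, so its shifts replace the resolvents in both [J0] and [LL1]. *)
Definition expq (T : R) w : R[i] :=
  if w == 0 then (T%:C)%C else (1 - cexp (- ((T%:C)%C * w))) / w.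

Lemma expq_cdiff (T : R) w : exists l, cdiff (expq T) w l.
Proof.
pose t : R[i] := (T%:C)%C; pose H v : R[i] := 1 - cexp (- (t * v)).
have dH v : cdiff H v (t * cexp (- (t * v))).
  have := cdiffB (cdiff_cst 1 v) (cdiff_comp (cdiffN (cdiffM (cdiff_cst t v) (cdiff_id v)))
    (cdiff_cexp (- (t * v)))).
  by rewrite sub0r mul0r add0r mulr1 mulrN opprK (mulrC (cexp _)).
have [->|w0] := eqVneq w 0.
  apply: (@removable H t (1 + expR (`|T| * 2))).
  - by move=> v; eexists; exact: dH.
  - by move=> _ ->; rewrite /H mulr0 oppr0 cexp0 subrr.
  - by have := dH 0; rewrite mulr0 oppr0 cexp0 mulr1.
  - move=> v v2; rewrite (le_trans (cabsB _ _)) // cabs1 lerD2l cabs_cexp ler_expR.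
    rewrite (le_trans (cabs_Re_ge _)) // cabsN cabsM cabs_real.
    by rewrite ler_wpM2l // ltW.
have wp : 0 < cabs w by rewrite cabs_gt0.
eexists; apply: (cdiff_ext wp _ (cdiffM (dH w) (cdiff_inv w0))) => v vw.
rewrite /expq ifN //; apply: contraTneq vw => ->.
by rewrite sub0r cabsN ltxx.
Qed.

(** The quadratic estimate of the exponential leaves a factor |w| after division, which covers small
    w as well; one more exp(|w|) absorbs it, whence 2 T + 1 in the exponent. *)
Lemma expq_type (T : R) w : 0 <= T ->
  cabs (expq T w) <= (T + 4 * T ^+ 2) * expR (2 + (2 * T + 1) * cabs w).
Proof.
move=> T0; have w0 := cabs_ge0 w.
have X1 : 1 <= expR (2 + (2 * T + 1) * cabs w).
  by rewrite -[leLHS]expR0 ler_expR; have := mulr_ge0 T0 w0; lra.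
have T2 := sqr_ge0 T.
rewrite /expq; case: eqVneq => [_|wn].
  rewrite cabs_real ger0_norm //.
  by rewrite (le_trans _ (ler_peMr _ X1)) //; lra.
have wp : 0 < cabs w by rewrite cabs_gt0.
rewrite cabsM cabsV ler_pdivrMr //.
set v := - ((T%:C)%C * w).
have cv : cabs v = T * cabs w by rewrite cabsN cabsM cabs_real ger0_norm.
have := cexp_quadratic v; rewrite cv => Q.
have : cabs (1 - cexp v) <= T * cabs w + 4 * expR (2 + 2 * (T * cabs w)) * (T * cabs w) ^+ 2.
  have -> : 1 - cexp v = - v - (cexp v - 1 - v) by ring.
  by rewrite (le_trans (cabsB _ _)) // cabsN cv lerD2l.
move=> /le_trans; apply.
have e1 : expR (2 + 2 * (T * cabs w)) * cabs w <= expR (2 + (2 * T + 1) * cabs w).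
  have -> : 2 + (2 * T + 1) * cabs w = 2 + 2 * (T * cabs w) + cabs w by ring.
  rewrite [leRHS]expRD ler_wpM2l ?expR_ge0 //.
  by have := expR_ge1Dx (cabs w); lra.
clear Q; move: (expR (2 + 2 * (T * cabs w))) (expR (2 + (2 * T + 1) * cabs w)) X1 e1 => p q X1 e1.
move: (cabs w) w0 e1 => x x0 e1.
have -> : T * x + 4 * p * (T * x) ^+ 2 = (T + 4 * T ^+ 2 * (p * x)) * x by ring.
rewrite ler_wpM2r //.
have : 4 * T ^+ 2 * (p * x) <= 4 * T ^+ 2 * q by rewrite ler_wpM2l // mulr_ge0.
have : T * 1 <= T * q by rewrite ler_wpM2l.
lra.
Qed.

Lemma expq_near (T : R) w : 0 <= T -> w != 0 ->
  cabs (w^-1 - expq T w) <= expR (- (T * complex.Re w)) / cabs w.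
Proof.
move=> T0 wn; rewrite /expq ifN //.
have -> : w^-1 - (1 - cexp (- ((T%:C)%C * w))) / w = cexp (- ((T%:C)%C * w)) / w by field.
rewrite cabsM cabsV cabs_cexp le_eqVlt; apply/orP; left; apply/eqP; congr (expR _ / _).
by rewrite ReN; case: w {wn} => x y /=; rewrite mul0r subr0.
Qed.

Lemma expq_decay (T : R) w : 0 <= T -> 0 <= complex.Re w -> w != 0 ->
  cabs (expq T w) <= 2 / cabs w.
Proof.
move=> T0 w0 wn; have := expq_near T0 wn; have := cabs_sub_ge (expq T w) w^-1.
have wp : 0 < cabs w by rewrite cabs_gt0.
have : expR (- (T * complex.Re w)) / cabs w <= 1 / cabs w.
  by rewrite ler_pM2r ?invr_gt0 // -expR0 ler_expR oppr_le0 mulr_ge0.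
rewrite (cabs_distC (expq T w)) cabsV; lra.
Qed.

Lemma expq_C0prop (T : R) : 0 <= T -> C0prop (expq T).
Proof.
move=> T0; apply: ccont_C0prop => [z _|e e0].
  by have [l] := expq_cdiff T z; exact: cdiff_cont.
exists (2 / e) => z z0 ez; have wp : 0 < cabs z by rewrite (le_lt_trans _ ez) // divr_ge0 // ltW.
rewrite (le_trans (expq_decay T0 (ltW z0) _)) -?cabs_gt0 //.
by rewrite ler_pdivrMr // mulrC -ler_pdivrMr // ltW.
Qed.

Lemma expq_resolvent (l e : R) : 0 < l -> 0 < e -> exists2 T : R, 0 <= T &
  near_sup e (fun z => (z + (l%:C)%C)^-1) (fun z => expq T (z + (l%:C)%C)).
Proof.
(* For Re w >= l this choice gives exp(T Re w) >= exp(1/(e l)) >= 1/(e l), so the error is at most e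
   l / |w| <= e. *)
move=> l0 e0; exists ((e * l)^-1 / l); first by rewrite divr_ge0 ?invr_ge0 ?mulr_ge0 // ltW.
set T := _ / l; have T0 : 0 <= T by rewrite divr_ge0 ?invr_ge0 ?mulr_ge0 // ltW.
move=> z z0; have wn : z + (l%:C)%C != 0 by apply: addr_neq0 => //; exact: ltW.
rewrite (le_trans (expq_near T0 wn)) //.
have wl := cabs_addr_ge' (ltW z0) (ltW l0).
rewrite ler_pdivrMr; last by rewrite cabs_gt0.
apply: (@le_trans _ _ (e * l)); last by rewrite ler_pM2l.
rewrite expRN invf_ple ?posrE ?expR_gt0 ?mulr_gt0 //.
apply: (@le_trans _ _ (expR (e * l)^-1)); first by have := expR_ge1Dx (e * l)^-1; lra.
rewrite ler_expR ReD /= /T mulrDr mulfVK ?gt_eqF // lerDr mulr_ge0 //.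
exact: ltW.
Qed.

End ExponentialQuotient.

(** * Entire functions of exponential type *)

Section EntireFunctions.
Variable R : realType.
Implicit Types (f g : R[i] -> R[i]) (z : R[i]).

Lemma J0_intro f : (forall z, exists l, cdiff f z l) ->
  (exists A B : R, forall z, cabs (f z) <= A * expR (B * cabs z)) -> C0prop f -> J0 R f.
Proof.
move=> df tf cf; split => //; first by move=> z; have [l /cdiff_derivable[]] := df z.
  have [M HM] := C0prop_bounded cf.
  by rewrite (le_lt_trans (supn_le HM)) // ltry.
exact: C0prop_cl.
Qed.

Lemma J0_elim f : J0 R f -> [/\ forall z, exists l, cdiff f z l,
  exists A B : R, [/\ 0 <= A, 0 <= B & forall z, cabs (f z) <= A * expR (B * cabs z)] & C0prop f].
Proof.
move=> [df [A [B tf]] _ cf]; split; last exact: C0cl_prop.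
  by move=> z; eexists; exact: derivable_cdiff (df z).
exists `|A|, `|B|; split => // z; rewrite (le_trans (tf z)) //.
apply: (@le_trans _ _ (`|A| * expR (B * cabs z))); first by rewrite ler_wpM2r ?expR_ge0 ?ler_norm.
by rewrite ler_wpM2l // ler_expR ler_wpM2r ?cabs_ge0 ?ler_norm.
Qed.

Lemma J0_C0prop g : J0 R g -> C0prop g. Proof. by case/J0_elim. Qed.

Lemma J0_holo g : J0 R g -> holo g.
Proof. by case/J0_elim => dg _ _; apply: cdiff_holo => z _; exact: dg. Qed.

Lemma J0_lin : lin_stable (J0 R).
Proof.
move=> c f g /J0_elim[df [A [B [A0 B0 tf]]] cf] /J0_elim[dg [A' [B' [A0' B0' tg]]] cg].
exists (fun z => f z + c * g z) => //; apply: J0_intro; last exact: C0prop_lin.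
  move=> z; have [l Hl] := df z; have [l' Hl'] := dg z.
  by eexists; apply: cdiffD Hl (cdiffM (cdiff_cst c z) Hl').
exists (A + cabs c * A'), (B + B') => z.
rewrite (le_trans (cabsD _ _)) // mulrDl cabsM -mulrA; apply: lerD.
  rewrite (le_trans (tf z)) // ler_wpM2l // ler_expR ler_wpM2r ?cabs_ge0 //; lra.
rewrite ler_wpM2l ?cabs_ge0 // (le_trans (tg z)) // ler_wpM2l // ler_expR ler_wpM2r ?cabs_ge0 //; lra.
Qed.

Lemma C0prop_shift g (s : R) : 0 <= s -> C0prop g -> C0prop (fun z => g (z + (s%:C)%C)).
Proof.
move=> s0 [cg dg].
have rs z : 0 < complex.Re z -> 0 < complex.Re (z + (s%:C)%C) by move=> z0; rewrite ReD /=; lra.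
split => [z z0 e e0|e e0].
  have [|d d0 H] := cg (z + (s%:C)%C) _ e e0; first by rewrite ReD /=; lra.
  exists d => // v w v0 w0 vz wz; apply: H; rewrite ?rs //.
    by rewrite opprD addrACA subrr addr0.
  by rewrite opprD addrACA subrr addr0.
have [M HM] := dg e e0; exists M => z z0 Mz; apply: HM; first exact: rs.
by rewrite (lt_le_trans Mz) // cabs_addr_ge // ltW.
Qed.

Lemma J0_shift : shift_stable (J0 R).
Proof.
move=> g s /J0_elim[dg [A [B [A0 B0 tg]]] cg] s0.
exists (fun z => g (z + (s%:C)%C)) => //; apply: J0_intro; last exact: C0prop_shift.
  by move=> z; have [l Hl] := dg (z + (s%:C)%C); exists l; exact: cdiff_shift.
exists (A * expR (B * s)), B => z; rewrite (le_trans (tg _)) // -mulrA ler_wpM2l //.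
rewrite -expRD ler_expR -mulrDr ler_wpM2l // (le_trans (cabsD _ _)) //.
by rewrite cabs_real ger0_norm // addrC.
Qed.

Lemma J0_resolvents : approx_resolvents (J0 R).
Proof.
move=> l e l0 e0; have [T T0 HT] := expq_resolvent l0 e0.
have [h Jh hE] : exists2 h, J0 R h & forall z, 0 < complex.Re z -> h z = expq T (z + (l%:C)%C).
  apply: J0_shift (ltW l0); apply: J0_intro (expq_C0prop T0); first exact: expq_cdiff.
  exists ((T + 4 * T ^+ 2) * expR 2), (2 * T + 1) => z.
  by rewrite -mulrA -expRD; exact: expq_type.
by exists h => // z z0; rewrite hE //; exact: HT.
Qed.

End EntireFunctions.

(** * Finite measures given by a density *)

Section DensityMeasure.
Context d (T : measurableType d) (R : realType).
Variables (mu : {sigma_finite_measure set T -> \bar R}) (w : T -> R).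
Hypotheses (mw : measurable_fun setT w) (w0 : forall x, 0 <= w x)
  (iw : mu.-integrable setT (EFin \o w)).

(** The three properties of [w] are carried as arguments so that the instances declared below can be
    inferred from the term itself. *)
Definition dens (_ : measurable_fun setT w) (_ : forall x, 0 <= w x)
  (_ : mu.-integrable setT (EFin \o w)) (A : set T) : \bar R := (\int[mu]_(x in A) (w x)%:E)%E.

Local Notation nu := (dens mw w0 iw).

Let dens0 : nu set0 = 0%E.
Proof. by rewrite /dens integral_set0. Qed.

Let dens_ge0 A : (0 <= nu A)%E.
Proof. by apply: integral_ge0 => x _; rewrite lee_fin. Qed.

Let dens_sigma_additive : semi_sigma_additive nu.
Proof.
move=> /= F mF tF mUF; rewrite /dens; apply: cvg_toP.
  apply: ereal_nondecreasing_is_cvgn => m n mn.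
  by apply: lee_sum_nneg_natr => // k _ _; exact: dens_ge0.
rewrite ge0_integral_bigcup //=.
- by apply: measurable_funTS; exact: measurableT_comp.
- by move=> x _; rewrite lee_fin.
Qed.

HB.instance Definition _ := isMeasure.Build _ _ _ nu dens0 dens_ge0 dens_sigma_additive.

Let dens_fin : fin_num_fun nu.
Proof.
by move=> A mA; apply: integrable_fin_num => //; apply: integrableS iw.
Qed.

HB.instance Definition _ := @Measure_isFinite.Build _ _ _ nu dens_fin.

Lemma dens_dominates : nu `<< mu.
Proof.
apply/null_content_dominatesP => A mA A0; rewrite /dens.
by apply: null_set_integral => //; apply/measurable_funTS/measurableT_comp.
Qed.

(** The Radon-Nikodym derivative of the new measure is almost everywhere [w], so the change of
    variables formula applies. *)
Lemma integral_dens (f : T -> \bar R) D : measurable D -> nu.-integrable D f ->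
  (\int[nu]_(x in D) f x = \int[mu]_(x in D) (f x * (w x)%:E))%E.
Proof.
move=> mD If; rewrite -(Radon_Nikodym_change_of_variables dens_dominates) //=.
have mf := measurable_int _ If.
apply: ae_eq_integral => //.
- apply: emeasurable_funM => //; apply: (measurable_int mu).
  apply: (integrableS _ _ (@subsetT _ _)) => //=.
  by apply: Radon_Nikodym_integrable; exact: dens_dominates.
- by apply: emeasurable_funM => //; apply/measurable_funTS/measurableT_comp.
- apply: ae_eqe_mul2l => /=; rewrite Radon_NikodymE //=; first exact: dens_dominates.
  move=> abmu; case: cid => /= h [h1 h2 h3].
  apply: integral_ae_eq => //=; first exact: integrableS h2.
  + by apply/measurable_funTS/measurableT_comp.
  + by move=> E E01 mE; rewrite -h3.
Qed.

End DensityMeasure.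

(** * Integration of complex functions against a finite measure *)

Section LaplaceFunctional.
Variable R : realType.
Implicit Types (nu : {finite_measure set R -> \bar R}) (phi psi : R -> R[i]) (z : R[i]).
Local Notation I0 := (`[0%R, +oo[%classic : set R).

Definition Lint nu phi : R[i] :=
  ((Rintegral nu I0 (fun t => complex.Re (phi t))) +i*
   (Rintegral nu I0 (fun t => complex.Im (phi t))))%C.

Definition cmeasf phi := measurable_fun setT (fun t => complex.Re (phi t)) /\
  measurable_fun setT (fun t => complex.Im (phi t)).

Definition bdd (C : R) phi := forall t, 0 <= t -> cabs (phi t) <= C.

Lemma mI0 : measurable I0. Proof. exact: measurable_itv. Qed.

Lemma bounded_int nu (f : R -> R) (C : R) : measurable_fun setT f ->
  (forall t, 0 <= t -> `|f t| <= C) -> nu.-integrable I0 (EFin \o f).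
Proof.
move=> mf fC; apply: (@measurable_bounded_integrable _ _ _ nu f I0 mI0).
- by rewrite ltey_eq fin_num_measure //; exact: mI0.
- exact: measurable_funTS.
- exists C; split; first by rewrite num_real.
  move=> y Cy t /=; rewrite in_itv /= andbT => t0.
  by rewrite (le_trans (fC t t0)) // ltW.
Qed.

Lemma bdd_Re nu (C : R) phi : cmeasf phi -> bdd C phi ->
  nu.-integrable I0 (EFin \o (fun t => complex.Re (phi t))).
Proof.
by move=> [m1 m2] b; apply: (bounded_int _ (C := C)) => // t /b; apply: le_trans; exact: cabs_Re.
Qed.

Lemma bdd_Im nu (C : R) phi : cmeasf phi -> bdd C phi ->
  nu.-integrable I0 (EFin \o (fun t => complex.Im (phi t))).
Proof.
by move=> [m1 m2] b; apply: (bounded_int _ (C := C)) => // t /b; apply: le_trans; exact: cabs_Im.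
Qed.

Lemma eq_Lint nu phi psi : (forall t, 0 <= t -> phi t = psi t) -> Lint nu phi = Lint nu psi.
Proof.
by move=> H; rewrite /Lint; congr (_ +i* _)%C; apply: eq_Rintegral => t;
  rewrite inE /= in_itv /= andbT => /H ->.
Qed.

Lemma cmeasf_lin c phi psi : cmeasf phi -> cmeasf psi -> cmeasf (fun t => phi t + c * psi t).
Proof.
move=> [m1 m2] [n1 n2]; split.
- under eq_fun do rewrite ReD cReM.
  by apply: measurable_funD => //; apply: measurable_funB => //; exact: measurable_funM.
- under eq_fun do rewrite ImD cImM.
  by apply: measurable_funD => //; apply: measurable_funD => //; exact: measurable_funM.
Qed.

Lemma Lint_lin nu (C C' : R) c phi psi : cmeasf phi -> bdd C phi -> cmeasf psi -> bdd C' psi ->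
  Lint nu (fun t => phi t + c * psi t) = Lint nu phi + c * Lint nu psi.
Proof.
move=> m1 b1 m2 b2.
have I1 := bdd_Re nu m1 b1; have I2 := bdd_Im nu m1 b1.
have I3 := bdd_Re nu m2 b2; have I4 := bdd_Im nu m2 b2.
have Z (r : R) (f : R -> R) : nu.-integrable I0 (EFin \o f) ->
    nu.-integrable I0 (EFin \o (fun t => r * f t)).
  by have := fun mI H => @integrableZl _ _ _ nu I0 mI r _ H; apply; exact: mI0.
have [mR DR] := (mI0, fun f g H1 H2 => @integrableD _ _ _ nu I0 mI0 f g H1 H2).
have BR := fun f g H1 H2 => @integrableB _ _ _ nu I0 mI0 f g H1 H2.
apply: complex_ext; rewrite ?ReD ?ImD ?cReM ?cImM /=.
- rewrite -!RintegralZl // -RintegralB //; [|exact: Z|exact: Z].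
  rewrite -RintegralD //; last exact: (BR _ _ (Z _ _ I3) (Z _ _ I4)).
  by apply: eq_Rintegral => t _; rewrite ReD cReM.
- rewrite -!RintegralZl // -RintegralD //; [|exact: Z|exact: Z].
  rewrite -RintegralD //; last exact: (DR _ _ (Z _ _ I4) (Z _ _ I3)).
  by apply: eq_Rintegral => t _; rewrite ImD cImM.
Qed.

Lemma Lint_le nu (C : R) phi (psi : R -> R) : cmeasf phi -> bdd C phi ->
  nu.-integrable I0 (EFin \o psi) -> (forall t, 0 <= t -> cabs (phi t) <= psi t) ->
  cabs (Lint nu phi) <= 2 * Rintegral nu I0 psi.
Proof.
move=> m b Ip H.
have I1 := bdd_Re nu m b; have I2 := bdd_Im nu m b.
have aux (f : R -> R) : nu.-integrable I0 (EFin \o f) ->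
    (forall t, 0 <= t -> `|f t| <= psi t) -> `|Rintegral nu I0 f| <= Rintegral nu I0 psi.
  move=> If fp; rewrite (le_trans (le_normr_Rintegral mI0 If)) //.
  apply: le_Rintegral => //.
  + exact: (integrable_norm If).
  + by move=> t /=; rewrite in_itv /= andbT; exact: fp.
rewrite (le_trans (cabs_le _)) //= mulr_natl mulr2n; apply: lerD; apply: aux => // t t0.
- exact: le_trans (cabs_Re _) (H t t0).
- exact: le_trans (cabs_Im _) (H t t0).
Qed.

Definition mass nu : R := fine (nu I0).

Lemma mass_ge0 nu : 0 <= mass nu. Proof. exact: fine_ge0. Qed.

Lemma Rintegral_cst_mass nu (C : R) : Rintegral nu I0 (fun=> C) = C * mass nu.
Proof. by rewrite Rintegral_cst. Qed.

Lemma Lint_bound nu (C : R) phi : cmeasf phi -> bdd C phi ->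
  cabs (Lint nu phi) <= 2 * (C * mass nu).
Proof.
move=> m b; rewrite -Rintegral_cst_mass; apply: (Lint_le m b _ b).
by apply: (bounded_int _ (C := `|C|)) => //; exact: measurable_cst.
Qed.

Lemma rcont_cmeasf phi : (forall t, rcont phi t) -> cmeasf phi.
Proof.
by move=> c; split; apply: continuous_measurable_fun => t; [exact: rcont_Re|exact: rcont_Im].
Qed.

Lemma ccont_cmeasf (f : R[i] -> R[i]) : (forall v, ccont f v) -> cmeasf (fun t => f (t%:C)%C).
Proof.
by move=> c; apply: rcont_cmeasf => t; apply: rcont_comp (rcont_horiz 0 t) _; exact: c.
Qed.

Definition lexp z (t : R) : R[i] := cexp (- (z * (t%:C)%C)).

Lemma cabs_lexp z t : cabs (lexp z t) = expR (- (complex.Re z * t)).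
Proof. by rewrite cabs_cexp ReN cReM /= mulr0 subr0. Qed.

Lemma lexp_ccont z v : ccont (fun v => cexp (- (z * v))) v.
Proof.
by apply: cdiff_cont; apply: cdiff_comp (cdiffN (cdiffM (cdiff_cst z v) (cdiff_id v))) (cdiff_cexp _).
Qed.

Lemma cmeasf_lexp z : cmeasf (lexp z).
Proof. exact: (ccont_cmeasf (lexp_ccont z)). Qed.

Lemma bdd_lexp z : 0 <= complex.Re z -> bdd 1 (lexp z).
Proof.
by move=> z0 t t0; rewrite cabs_lexp -expR0 ler_expR oppr_le0 mulr_ge0.
Qed.

Lemma lapR_Lint nu z : 0 <= complex.Re z -> lapR nu z = Lint nu (lexp z).
Proof.
move=> z0; rewrite /lapR /Lint; congr (_ +i* _)%C.
  apply: eq_Rintegral => t _; rewrite /lexp /cexp /= ReN ImN cReM cImM /= mulr0 subr0 mulr0 add0r.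
  by rewrite cosN.
have E t : complex.Im (lexp z t) = - (expR (- (complex.Re z * t)) * sin (complex.Im z * t)).
  by rewrite /lexp /cexp /= ReN ImN cReM cImM /= mulr0 subr0 mulr0 add0r sinN mulrN.
rewrite -mulN1r -RintegralZl //.
- by apply: eq_Rintegral => t _; rewrite E mulN1r.
- have -> : (fun t : R => expR (- (complex.Re z * t)) * sin (complex.Im z * t)) =
      (fun t => -1 * complex.Im (lexp z t)).
    by apply/funext => t; rewrite E mulN1r opprK.
  exact: (@integrableZl _ _ _ nu I0 mI0 (-1) _ (bdd_Im nu (cmeasf_lexp z) (bdd_lexp z0))).
Qed.

End LaplaceFunctional.

(** * Holomorphy and boundedness of Laplace transforms *)

Section LaplaceTransforms.
Variable R : realType.
Implicit Types (nu : {finite_measure set R -> \bar R}) (z : R[i]) (mu : cmeas R).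
Local Notation I0 := (`[0%R, +oo[%classic : set R).

Lemma sqr_le_exp (s : R) : 0 <= s -> s ^+ 2 <= 4 * expR s.
Proof.
move=> s0; have := expR_ge1Dx (s / 2); have -> : expR s = expR (s / 2) * expR (s / 2).
  by rewrite -expRD -splitr.
by move: (expR _) => q; rewrite expr2; nra.
Qed.

(** Differentiation under the integral sign: exp(-z t) (exp(-h t) - 1 + h t) is bounded by a
    constant times |h|^2, uniformly in t >= 0. For |h| < x / 4 half of the decay exp(-x t) survives
    the factor from [cexp_quadratic], and it absorbs t^2 by [sqr_le_exp], which produces 16 /
    x^2. *)
Lemma lapR_cdiff nu z : 0 < complex.Re z -> exists l, cdiff (lapR nu) z l.
Proof.
move=> z0; set x := complex.Re z in z0 *.
pose psi t : R[i] := (t%:C)%C * lexp z t.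
have mp : cmeasf psi.
  by apply: (@ccont_cmeasf _ (fun v => v * cexp (- (z * v)))) => v;
    apply: ccont_mul (ccont_id _) (lexp_ccont _ _).
have bp : bdd (x^-1) psi.
  move=> t t0; rewrite cabsM cabs_real ger0_norm // cabs_lexp -/x expRN ler_pdivrMr ?expR_gt0 //.
  by rewrite ler_pdivlMl // (le_trans _ (expR_ge1Dx _)) // lerDr.
have ml := cmeasf_lexp z; have bl := bdd_lexp (ltW z0).
exists (- Lint nu psi) => e e0.
pose C := 2 * (4 * expR 2 * (16 / x ^+ 2) * mass nu).
have C0 : 0 <= C.
  by rewrite mulr_ge0 // mulr_ge0 ?mass_ge0 // mulr_ge0 ?divr_ge0 ?exprn_ge0 ?mulr_ge0 ?expR_ge0 // ltW.
exists (Num.min (x / 4) (e / (C + 1))).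
  by rewrite lt_min !divr_gt0 //; lra.
move=> h; rewrite lt_min => /andP[h1]; rewrite ltr_pdivlMr; last by lra.
move=> h2; have h0 := cabs_ge0 h.
have zh : 0 < complex.Re (z + h).
  by have := cabs_Re h => /ler_normlP[k1 k2]; rewrite ReD -/x; lra.
rewrite (lapR_Lint nu (ltW zh)) (lapR_Lint nu (ltW z0)).
have mzh := cmeasf_lexp (z + h); have bzh := bdd_lexp (ltW zh).
pose chi t := lexp (z + h) t + (-1) * lexp z t.
have mchi : cmeasf chi by exact: cmeasf_lin.
have bchi : bdd 2 chi.
  move=> t t0; rewrite /chi mulN1r (le_trans (cabsB _ _)) //.
  by have := bzh t t0; have := bl t t0; lra.
have -> : Lint nu (lexp (z + h)) - Lint nu (lexp z) - - Lint nu psi * h =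
    Lint nu (fun t => chi t + h * psi t).
  rewrite (Lint_lin nu _ mchi bchi mp bp) /chi (Lint_lin nu _ mzh bzh ml bl).
  by ring.
have bnd : bdd (4 * expR 2 * (16 / x ^+ 2) * cabs h ^+ 2) (fun t => chi t + h * psi t).
  move=> t t0.
  have -> : chi t + h * psi t = lexp z t * (cexp (- (h * (t%:C)%C)) - 1 - (- (h * (t%:C)%C))).
    rewrite /chi /psi /lexp mulrDl opprD cexpD; ring.
  rewrite cabsM cabs_lexp -/x.
  have ht : cabs (- (h * (t%:C)%C)) = cabs h * t by rewrite cabsN cabsM cabs_real ger0_norm.
  have := cexp_quadratic (- (h * (t%:C)%C)); rewrite ht => Q.
  rewrite (le_trans (ler_wpM2l (expR_ge0 _) Q)) //.
  have -> : expR (- (x * t)) * (4 * expR (2 + 2 * (cabs h * t)) * (cabs h * t) ^+ 2) =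
    4 * (expR (- (x * t)) * expR (2 + 2 * (cabs h * t)) * t ^+ 2) * cabs h ^+ 2 by ring.
  rewrite ler_wpM2r ?sqr_ge0 // -(mulrA 4 (expR 2)) ler_pM2l // -expRD.
  have H1 : expR (- (x * t) + (2 + 2 * (cabs h * t))) <= expR 2 * expR (- (x * t / 2)).
    rewrite -expRD ler_expR.
    have : cabs h * t <= x / 4 * t by rewrite ler_wpM2r // ltW.
    by lra.
  rewrite (le_trans (ler_wpM2r (sqr_ge0 _) H1)) // -(mulrA (expR 2)) ler_pM2l ?expR_gt0 //.
  rewrite expRN (mulrC _ (t ^+ 2)) ler_pdivrMr ?expR_gt0 //.
  have xt0 : 0 <= x * t / 2 by rewrite divr_ge0 // mulr_ge0 // ltW.
  have := sqr_le_exp xt0.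
  have -> : (x * t / 2) ^+ 2 = x ^+ 2 * t ^+ 2 / 4 by field.
  have x2 : 0 < x ^+ 2 by rewrite exprn_gt0.
  rewrite (mulrAC 16) ler_pdivlMr // (mulrC (t ^+ 2)); lra.
rewrite (le_trans (Lint_bound nu (cmeasf_lin h mchi mp) bnd)) //.
have -> : 2 * (4 * expR 2 * (16 / x ^+ 2) * cabs h ^+ 2 * mass nu) = C * cabs h * cabs h.
  by rewrite /C; ring.
rewrite ler_wpM2r //; lra.
Qed.

Lemma lapR_bound nu z : 0 < complex.Re z -> cabs (lapR nu z) <= 2 * mass nu.
Proof.
move=> z0; rewrite (lapR_Lint nu (ltW z0)) (le_trans (Lint_bound nu (cmeasf_lexp z) (bdd_lexp (ltW z0)))) //.
by rewrite mul1r.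
Qed.

Lemma lap_holo mu : holo (lap mu).
Proof.
apply: cdiff_holo => z z0.
have [l1 H1] := lapR_cdiff (cm1 mu) z0; have [l2 H2] := lapR_cdiff (cm2 mu) z0.
have [l3 H3] := lapR_cdiff (cm3 mu) z0; have [l4 H4] := lapR_cdiff (cm4 mu) z0.
by eexists; apply: cdiffD (cdiffB H1 H2) (cdiffM (cdiff_cst _ z) (cdiffB H3 H4)).
Qed.

Lemma cabs_i : cabs ('i%C : R[i]) = 1.
Proof. by rewrite cabs_imag normr1. Qed.

Lemma lap_bounded mu : exists M, bounded_by M (lap mu).
Proof.
exists (2 * mass (cm1 mu) + 2 * mass (cm2 mu) + (2 * mass (cm3 mu) + 2 * mass (cm4 mu))) => z z0.
rewrite (le_trans (cabsD _ _)) // cabsM cabs_i mul1r.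
by apply: lerD; rewrite (le_trans (cabsB _ _)) //; apply: lerD; exact: lapR_bound.
Qed.

End LaplaceTransforms.

(** * Multiplication of measures by a weight *)

Section Weight.
Variable R : realType.
Implicit Types (nu : {finite_measure set R -> \bar R}) (z : R[i]) (mu : cmeas R).
Local Notation I0 := (`[0%R, +oo[%classic : set R).

Lemma measurable_expN (a : R) : measurable_fun setT (fun t : R => expR (- (a * t))).
Proof.
apply: continuous_measurable_fun => t; apply: continuous_comp; last exact: continuous_expR.
by apply: cvgN; apply: cvgM; [exact: cvg_cst|exact: cvg_id].
Qed.

Lemma Lint_dens nu (w : R -> R) (mw : measurable_fun setT w) (w0 : forall x, 0 <= w x)
    (iw : nu.-integrable setT (EFin \o w)) (phi : R -> R[i]) (C : R) : cmeasf phi -> bdd C phi ->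
  Lint (dens mw w0 iw) phi = Lint nu (fun t => (w t)%:C%C * phi t).
Proof.
move=> m b; have I1 := bdd_Re (dens mw w0 iw) m b; have I2 := bdd_Im (dens mw w0 iw) m b.
rewrite /Lint /Rintegral; congr (_ +i* _)%C; congr fine.
- rewrite integral_dens //; apply: eq_integral => t _; rewrite /= -EFinM cReM /=.
  by rewrite mul0r subr0 mulrC.
- rewrite integral_dens //; apply: eq_integral => t _; rewrite /= -EFinM cImM /=.
  by rewrite mul0r addr0 mulrC.
Qed.

(** [Lint nu one0] is the mass of [nu] at 0 and the limit of its transform to the right. *)
Definition one0 (t : R) : R[i] := ((\1_[set (0 : R)] t)%:C)%C.

Lemma cmeasf_one0 : cmeasf one0.
Proof. by split => /=; [exact: measurable_indic|exact: measurable_cst]. Qed.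

Lemma bdd_one0 : bdd 1 one0.
Proof. by move=> t _; rewrite cabs_real indicE ger0_norm //; case: (_ \in _). Qed.

(** Away from 0 the half-line is cut at d = 1/(n + 1): ]0, d] has small mass, and beyond d the
    exponential is at most exp(- a d). *)
Lemma lapR_lim nu (b e : R) : 0 < e -> exists A : R, forall a, A <= a ->
  cabs (lapR nu (a +i* b)%C - Lint nu one0) <= e.
Proof.
move=> e0; have e4 : 0 < e / 4 by rewrite divr_gt0.
have [|||||n Hn] := @integral_vanish R _ _ nu I0 (fun n => `]0%R, n.+1%:R^-1]%classic) (fun=> 1)
  (@mI0 R) _ _ _ _ _ _ e4.
- by move=> n; exact: measurable_itv.
- by move=> n t /=; rewrite !in_itv /= andbT => /andP[/ltW].
- by apply: (bounded_int _ (C := 1)) => [|t _]; [exact: measurable_cst|rewrite normr1].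
- by [].
- move=> t; rewrite /= in_itv /= andbT => t0.
  have [->|tn] := eqVneq t 0; first by exists 0%N => n _; rewrite in_itv /= ltxx.
  have tp : 0 < t by rewrite lt_def tn.
  exists (Num.bound t^-1) => n Nn; apply/negP; rewrite in_itv /= tp /= -ltNge.
  rewrite invf_plt ?posrE // (lt_le_trans (archi_boundP _)) ?invr_ge0 //.
  by rewrite ler_nat ltnW.
set E := (`]0%R, n.+1%:R^-1]%classic : set R) in Hn.
have mE : measurable E by exact: measurable_itv.
pose d : R := n.+1%:R^-1; have d0 : 0 < d by rewrite invr_gt0.
pose m := mass nu; have m0 : 0 <= m := mass_ge0 nu.
have K0 : 0 < 4 * (m + 1) / e by rewrite divr_gt0 // mulr_gt0 //; lra.
(* Then exp(a d) >= a d >= 4 (m + 1) / e, so the part beyond d weighs at most e / 4; with the mass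
   of ]0, d] and the factor 2 of [Lint_le] the total is [e]. *)
exists (Num.max 1 (4 * (m + 1) / e / d)) => a; rewrite ge_max => /andP[a1 aK].
have a0 : 0 <= complex.Re ((a +i* b)%C : R[i]) by rewrite /=; lra.
set z := (a +i* b)%C in a0 *.
have -> : lapR nu z - Lint nu one0 = Lint nu (fun t => lexp z t + (-1) * one0 t).
  by rewrite (Lint_lin nu _ (cmeasf_lexp z) (bdd_lexp a0) cmeasf_one0 bdd_one0) mulN1r -lapR_Lint.
pose psi t : R := \1_E t + expR (- (a * d)).
have Ipsi : nu.-integrable I0 (EFin \o psi).
  apply: (bounded_int _ (C := 1 + expR (- (a * d)))).
    by apply: measurable_funD => //; exact: measurable_indic.
  move=> t _; rewrite /psi indicE ger0_norm ?addr_ge0 ?expR_ge0 // lerD2r.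
  by case: (_ \in _).
have bb : bdd 2 (fun t => lexp z t + (-1) * one0 t).
  move=> t t0; rewrite mulN1r (le_trans (cabsB _ _)) //.
  by have := bdd_lexp a0 t0; have := bdd_one0 t0; lra.
rewrite (le_trans (Lint_le (cmeasf_lin _ (cmeasf_lexp z) cmeasf_one0) bb Ipsi _)) //.
  move=> t t0; rewrite /psi /one0 !indicE.
  have [->|tn] := eqVneq t 0.
    rewrite /lexp mulr0 oppr0 cexp0 mem_set // mulr1 subrr cabs0.
    by rewrite addr_ge0 ?expR_ge0 //; case: (_ \in _).
  have tp : 0 < t by rewrite lt_def tn.
  rewrite [t \in [set 0]]memNset; last by move/eqP: tn.
  rewrite mulr0 addr0 cabs_lexp /=; case: (boolP (t \in E)) => tE /=.
    have : expR (- (a * t)) <= 1 by rewrite -expR0 ler_expR oppr_le0 mulr_ge0.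
    by have := expR_ge0 (- (a * d)); lra.
  rewrite add0r ler_expR lerN2 ler_wpM2l //.
  move: tE; rewrite notin_setE /E /= in_itv /= tp /= => /negP; rewrite -ltNge => /ltW.
  by [].
have -> : Rintegral nu I0 psi = fine (nu E) + expR (- (a * d)) * m.
  rewrite /psi RintegralD //; first last.
  - by apply: (bounded_int _ (C := expR (- (a * d)))) => [|t _]; rewrite ?ger0_norm ?expR_ge0.
  - apply: (bounded_int _ (C := 1)) => [|t _]; first exact: measurable_indic.
    by rewrite indicE ger0_norm //; case: (_ \in _).
  rewrite Rintegral_cst_mass; congr (_ + _); rewrite /Rintegral integral_indic //.
  by rewrite setIidl // => t; rewrite /E /= !in_itv /= andbT => /andP[/ltW].
have nE : fine (nu E) <= e / 4.
  rewrite -lee_fin fineK ?fin_num_measure //; move: Hn => /ltW; apply: le_trans.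
  by rewrite integral_cst // mul1e.
have ed : expR (- (a * d)) * m <= e / 4.
  have ad : 4 * (m + 1) / e <= a * d by rewrite -ler_pdivrMr.
  have : 4 * (m + 1) / e <= expR (a * d) by rewrite (le_trans ad) // (le_trans _ (expR_ge1Dx _)) // lerDr.
  rewrite ler_pdivrMr // => h; rewrite expRN (mulrC _ m) ler_pdivrMr ?expR_gt0 //.
  by move: (expR _) h => q h; lra.
lra.
Qed.

Section WithParameters.
Variables (eps N : R).
Hypotheses (eps0 : 0 < eps) (epsN : eps < N).

(* On [0, oo) this is e^{-eps t} - e^{-N t}, plus 1 at t = 0: the extra unit mass
   accounts for the constant mu({0}), the limit of the transform at infinity. *)
Definition weight (t : R) : R :=
  \1_[set (0 : R)] t + \1_(`]0%R, +oo[%classic) t * (expR (- (eps * t)) - expR (- (N * t))).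

Lemma measurable_weight : measurable_fun setT weight.
Proof.
apply: measurable_funD; first exact: measurable_indic.
apply: measurable_funM; first by apply: measurable_indic; exact: measurable_itv.
by apply: measurable_funB; exact: measurable_expN.
Qed.

Lemma weight_bound t : 0 <= weight t <= 2.
Proof.
have i01 (A : set R) : 0 <= ((t \in A)%:R : R) <= 1.
  by rewrite ler0n lern1 leq_b1.
rewrite /weight !indicE.
have := i01 [set 0]; have [t0|t0] := ltP 0 t; last first.
  by rewrite [in _ * _]memNset ?mul0r ?addr0 /= ?in_itv /= ?andbT ?ltNge ?t0 //; lra.
have : expR (- (N * t)) <= expR (- (eps * t)) by rewrite ler_expR lerN2 ler_pM2r // ltW.
have : expR (- (eps * t)) <= 1 by rewrite -expR0 ler_expR oppr_le0 mulr_ge0 // ltW.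
have := expR_ge0 (- (N * t)); have := i01 `]0%R, +oo[%classic.
by move: (_ \in _)%:R (_ \in _)%:R => p q; nra.
Qed.

Lemma weight_ge0 t : 0 <= weight t. Proof. by have /andP[] := weight_bound t. Qed.

Lemma weight_integrable nu : nu.-integrable setT (EFin \o weight).
Proof.
apply: measurable_bounded_integrable => //.
- by rewrite ltey_eq fin_num_measure.
- exact: measurable_weight.
- exists 2; split; first by rewrite num_real.
  move=> y y2 t _ /=; have /andP[w0 w2] := weight_bound t.
  by rewrite ger0_norm // (le_trans w2) // ltW.
Qed.

Definition wmeas nu : {finite_measure set R -> \bar R} :=
  dens measurable_weight weight_ge0 (weight_integrable nu).

Lemma lapR_wmeas nu z : 0 < complex.Re z ->
  lapR (wmeas nu) z = lapR nu (z + eps%:C%C) - lapR nu (z + N%:C%C) + Lint nu one0.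
Proof.
move=> z0; have [N0 e0] := (lt_trans eps0 epsN, eps0).
have ze : 0 <= complex.Re (z + eps%:C%C) by rewrite ReD /=; lra.
have zN : 0 <= complex.Re (z + N%:C%C) by rewrite ReD /=; lra.
rewrite (lapR_Lint _ (ltW z0)) !lapR_Lint // (Lint_dens _ _ _ (cmeasf_lexp z) (bdd_lexp (ltW z0))).
have [m1 b1] := (cmeasf_lexp (z + eps%:C%C), bdd_lexp ze).
have [m2 b2] := (cmeasf_lexp (z + N%:C%C), bdd_lexp zN).
have b12 : bdd 2 (fun t => lexp (z + eps%:C%C) t + (-1) * lexp (z + N%:C%C) t).
  move=> t t0; rewrite mulN1r (le_trans (cabsB _ _)) //.
  by have := b1 t t0; have := b2 t t0; lra.
rewrite -mulN1r -(Lint_lin nu (-1) m1 b1 m2 b2) -[X in _ + X]mul1r.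
rewrite -(Lint_lin nu 1 (cmeasf_lin (-1) m1 m2) b12 cmeasf_one0 bdd_one0).
apply: eq_Lint => t t0; rewrite /one0 /weight !indicE.
have sp (s : R) : lexp (z + s%:C%C) t = (expR (- (s * t)))%:C%C * lexp z t.
  rewrite /lexp mulrDl opprD cexpD mulrC; congr (_ * _).
  by apply: complex_ext; rewrite /= !(mul0r, mulr0, subr0, addr0) oppr0 ?cos0 ?sin0 ?mulr1 ?mulr0.
rewrite !sp; have [->|tn] := eqVneq t 0.
  by rewrite mem_set // !mulr0 oppr0 expR0 subrr mulr0 addr0 /lexp mulr0 oppr0 cexp0; ring.
have tp : 0 < t by rewrite lt_def tn.
rewrite memNset; last by move/eqP: tn.
rewrite mem_set; last by rewrite /= in_itv /= tp.
move: (expR (- (eps * t))) (expR (- (N * t))) => p q.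
have -> : false%:R + true%:R * (p - q) = p - q by rewrite mulr0n mulr1n add0r mul1r.
rewrite (rmorphB (real_complex R)) (_ : (false%:R)%:C%C = 0 :> R[i]) //; ring.
Qed.

Definition wcm mu : cmeas R :=
  CMeas (wmeas (cm1 mu)) (wmeas (cm2 mu)) (wmeas (cm3 mu)) (wmeas (cm4 mu)).

Lemma wcm_Rplus mu : cm_on_Rplus (wcm mu).
Proof.
have H nu : wmeas nu `]-oo, 0%R[ = 0%E.
  rewrite /wmeas /= /dens; apply: integral0_eq => t; rewrite /= in_itv /= => t0.
  rewrite /weight !indicE !memNset ?mul0r ?addr0 //=; first by rewrite in_itv /= andbT ltNge ltW.
  by move=> t00; move: t0; rewrite t00 ltxx.
by split; exact: H.
Qed.

Lemma fine_finite_eq (nu nu' : {finite_measure set R -> \bar R}) A : measurable A ->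
  fine (nu A) - fine (nu' A) = 0 -> nu A = nu' A.
Proof.
move=> mA /eqP; rewrite subr_eq0 => /eqP E.
by rewrite -[LHS]fineK ?fin_num_measure // E fineK // fin_num_measure.
Qed.

(** Weighting acts on the four positive parts separately, whereas the classes speak of their
    differences. If these vanish on every measurable subset of [A], the parts agree on [A] in pairs,
    and so do their weighted versions. *)
Lemma wcm_vanish mu A : measurable A ->
  (forall B, measurable B -> B `<=` A -> cmval mu B = 0) -> cmval (wcm mu) A = 0.
Proof.
move=> mA H.
have E (nu nu' : {finite_measure set R -> \bar R}) :
    (forall B, measurable B -> B `<=` A -> fine (nu B) - fine (nu' B) = 0) ->
    fine (wmeas nu A) - fine (wmeas nu' A) = 0.
  move=> K; rewrite (_ : wmeas nu A = wmeas nu' A) ?subrr // /wmeas /= /dens.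
  apply: eq_measure_integral => B mB BA; apply: fine_finite_eq => //; exact: K.
apply: complex_ext => /=; apply: E => B mB BA; have := H B mB BA.
  by move=> /(congr1 (@complex.Re R)).
by move=> /(congr1 (@complex.Im R)).
Qed.

End WithParameters.

Definition weight_stable (P : cmeas R -> Prop) := forall eps N mu,
  forall (e0 : 0 < eps) (eN : eps < N), P mu -> P (wcm e0 eN mu).

Lemma LN_shift_diff P g : weight_stable P -> LN P g -> shift_diff (LN P) g.
Proof.
move=> Pw [mu [mu0 Pmu ->]] eps N e0 eN.
pose c nu := Lint nu one0.
exists (lap (wcm e0 eN mu)), ((c (cm1 mu) - c (cm2 mu)) + 'i%C * (c (cm3 mu) - c (cm4 mu))).
split.
- by exists (wcm e0 eN mu); split => //; [exact: wcm_Rplus|exact: Pw].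
- by move=> z z0; rewrite /lap /= !(lapR_wmeas e0 eN) // /c; ring.
- move=> b e e00; have e4 : 0 < e / 4 by rewrite divr_gt0.
  have [A1 H1] := lapR_lim (cm1 mu) b e4; have [A2 H2] := lapR_lim (cm2 mu) b e4.
  have [A3 H3] := lapR_lim (cm3 mu) b e4; have [A4 H4] := lapR_lim (cm4 mu) b e4.
  exists (Num.max (Num.max A1 A2) (Num.max A3 A4)) => a; rewrite !ge_max.
  move=> /andP[/andP[/H1 {}H1 /H2 {}H2] /andP[/H3 {}H3 /H4 {}H4]].
  set z := (a +i* b)%C in H1 H2 H3 H4 *.
  have -> : lap mu z - (c (cm1 mu) - c (cm2 mu) + 'i%C * (c (cm3 mu) - c (cm4 mu))) =
    (lapR (cm1 mu) z - c (cm1 mu)) - (lapR (cm2 mu) z - c (cm2 mu)) +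
    'i%C * ((lapR (cm3 mu) z - c (cm3 mu)) - (lapR (cm4 mu) z - c (cm4 mu))).
    by rewrite /lap; ring.
  rewrite (le_trans (cabsD _ _)) // cabsM cabs_i mul1r [e](_ : _ = (e / 4 + e / 4) + (e / 4 + e / 4)); last by field.
  by apply: lerD; rewrite (le_trans (cabsB _ _)) //; apply: lerD.
Qed.

Lemma weight_stable_all : weight_stable (@Mall R).
Proof. by []. Qed.

(** Here, as for the next two classes, the measure is required to vanish on certain sets, and
    thereby on all their measurable subsets; [wcm_vanish] then transfers the condition. *)
Lemma weight_stable_ac : weight_stable (@Mac R).
Proof.
move=> eps N mu e0 eN H A mA A0; apply: wcm_vanish => // B mB BA; apply: H => //.
by apply/eqP; rewrite -measure_le0 -A0; apply: le_measure => //; rewrite inE.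
Qed.

Lemma weight_stable_disc : weight_stable (@Mdisc R).
Proof.
move=> eps N mu e0 eN [S [cS H]]; exists S; split => // A mA AS.
apply: wcm_vanish => // B mB BA; apply: H => //.
by rewrite -subset0 -AS => t [Bt St]; split => //; exact: BA.
Qed.

Lemma weight_stable_sing : weight_stable (@Msing R).
Proof.
move=> eps N mu e0 eN [H1 [S [mS S0 H2]]]; split => [t|].
  apply: wcm_vanish => // B mB Bt; have [Bt'|nBt] := pselect (B t).
    by rewrite (_ : B = [set t]) //; apply/seteqP; split => // _ ->.
  rewrite (_ : B = set0); last by rewrite -subset0 => s Bs; apply: nBt; rewrite -(Bt s Bs).
  by rewrite /cmval !measure0 /= subrr.
exists S; split => // A mA AS.
apply: wcm_vanish => // B mB BA; apply: H2 => //.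
by rewrite -subset0 -AS => t [Bt St]; split => //; exact: BA.
Qed.

Lemma LN_closB P : weight_stable P -> closB (LN P) = closInf (LN P).
Proof.
move=> Pw; apply: closB_eq_closInf => [g [mu [_ _ ->]]|g [mu [_ _ ->]]|g Lg].
- exact: lap_holo.
- exact: lap_bounded.
- exact: LN_shift_diff.
Qed.

End Weight.

(** * Laplace transforms of integrable densities *)

Section DensityTransform.
Variable R : realType.
Implicit Types (w v : R -> R) (z : R[i]).
Local Notation I0 := (`[0%R, +oo[%classic : set R).
Local Notation leb := (@lebesgue_measure R).

(** The transform of a density of either sign, written as a Lebesgue integral so that it is linear
    in [w]. *)
Definition Dtr w z : R[i] :=
  ((Rintegral leb I0 (fun t => w t * complex.Re (lexp z t))) +i*
   (Rintegral leb I0 (fun t => w t * complex.Im (lexp z t))))%C.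

Lemma integrable_mul_bounded w (f : R -> R) : leb.-integrable I0 (EFin \o w) ->
  measurable_fun setT f -> (forall t, 0 <= t -> `|f t| <= 1) ->
  leb.-integrable I0 (EFin \o (fun t => w t * f t)).
Proof.
move=> iw mf f1; have mw := measurable_int _ iw; apply: le_integrable iw => //.
  apply/measurable_EFinP; apply: measurable_funM; first exact/measurable_EFinP.
  exact: measurable_funTS.
move=> t; rewrite /= in_itv /= andbT => t0; rewrite lee_fin normrM.
by rewrite ler_piMr // f1.
Qed.

Lemma Dtr_integrable w z : 0 <= complex.Re z -> leb.-integrable I0 (EFin \o w) ->
  leb.-integrable I0 (EFin \o (fun t => w t * complex.Re (lexp z t))) /\
  leb.-integrable I0 (EFin \o (fun t => w t * complex.Im (lexp z t))).
Proof.
move=> z0 iw; have [m1 m2] := cmeasf_lexp z.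
split; apply: integrable_mul_bounded => // t t0; apply: le_trans (bdd_lexp z0 t0).
- exact: cabs_Re.
- exact: cabs_Im.
Qed.

Lemma Dtr_lin (r : R) w v z : 0 <= complex.Re z -> leb.-integrable I0 (EFin \o w) ->
  leb.-integrable I0 (EFin \o v) ->
  Dtr (fun t => w t + r * v t) z = Dtr w z + r%:C%C * Dtr v z.
Proof.
move=> z0 iw iv; have [w1 w2] := Dtr_integrable z0 iw; have [v1 v2] := Dtr_integrable z0 iv.
have mI : measurable I0 by [].
have Z (f : R -> R) : leb.-integrable I0 (EFin \o f) ->
    leb.-integrable I0 (EFin \o (fun t => r * f t)).
  by move=> If; have := fun mI => @integrableZl _ _ _ leb I0 mI r _ If; apply.
apply: complex_ext; rewrite ?ReD ?ImD ?cReM ?cImM /= mul0r ?subr0 ?addr0.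
- rewrite -RintegralZl // -RintegralD //; last exact: Z v1.
  by apply: eq_Rintegral => t _; rewrite mulrDl -mulrA.
- rewrite -RintegralZl // -RintegralD //; last exact: Z v2.
  by apply: eq_Rintegral => t _; rewrite mulrDl -mulrA.
Qed.

Lemma Dtr_bound w (E : set R) (e : R) z : 0 <= complex.Re z -> measurable E -> E `<=` I0 ->
  leb.-integrable I0 (EFin \o w) -> (forall t, I0 t -> ~ E t -> w t = 0) ->
  (\int[leb]_(t in E) `|w t|%:E <= e%:E)%E -> cabs (Dtr w z) <= 2 * e.
Proof.
move=> z0 mE EI iw wE we; have [w1 w2] := Dtr_integrable z0 iw.
have N : Rintegral leb I0 (fun t => `|w t|) <= e.
  have IE : (\int[leb]_(t in I0) `|w t|%:E = \int[leb]_(t in E) `|w t|%:E)%E.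
    rewrite -[in RHS](setIidr EI) integral_mkcondr; apply: eq_integral => t.
    rewrite inE patchE => It; case: ifPn => // /negP tE.
    by rewrite wE ?normr0 // => Et; apply: tE; rewrite inE.
  have f1 : (\int[leb]_(t in I0) `|w t|%:E)%E \is a fin_num.
    by apply: integrable_fin_num (integrable_norm iw) => //.
  by rewrite -lee_fin /Rintegral fineK // IE.
have aux (f : R -> R) : leb.-integrable I0 (EFin \o (fun t => w t * f t)) ->
    (forall t, 0 <= t -> `|f t| <= 1) -> `|Rintegral leb I0 (fun t => w t * f t)| <= e.
  move=> If f1; rewrite (le_trans _ N) // (le_trans (le_normr_Rintegral _ If)) //.
  apply: le_Rintegral => //.
  + exact: (integrable_norm If).
  + exact: (integrable_norm iw).
  + by move=> t /=; rewrite in_itv /= andbT => t0; rewrite normrM ler_piMr // f1.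
rewrite (le_trans (cabs_le _)) //= mulr_natl mulr2n; apply: lerD; apply: aux => // t t0;
  apply: le_trans (bdd_lexp z0 t0).
- exact: (cabs_Re (lexp z t)).
- exact: (cabs_Im (lexp z t)).
Qed.

Lemma Dtr_restrict w (T : R) z :
  Dtr (fun t => w t * \1_`[0%R, T] t) z = Cint 0 T (fun t => (w t)%:C%C * lexp z t).
Proof.
have TI : `[0%R, T]%classic `<=` I0 by move=> t /=; rewrite !in_itv /= andbT => /andP[].
have H (f g : R -> R) : (forall t, w t * f t = g t) ->
    Rintegral leb I0 (fun t => w t * \1_`[0%R, T] t * f t) = Rintegral leb `[0%R, T] g.
  move=> fg; rewrite /Rintegral -[in RHS](setIidr TI) integral_mkcondr; congr fine.
  apply: eq_integral => t _; rewrite patchE indicE; case: ifPn => _.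
    by rewrite mulr1 fg.
  by rewrite mulr0 mul0r.
by rewrite /Dtr /Cint; congr (_ +i* _)%C; apply: H => t; rewrite ?cReM ?cImM /= mul0r ?subr0 ?addr0.
Qed.

Lemma continuous_rcont (g : R -> R) : continuous g -> forall t, rcont (fun t => (g t)%:C%C) t.
Proof.
move=> cg t e e0; have /cvgrPdist_le /(_ e e0) /nbhs_ballP[d d0 H] := cg t.
exists d => [//|s st]; have -> : (g s)%:C%C - (g t)%:C%C = (g s - g t)%:C%C by rewrite rmorphB.
rewrite cabs_real distrC; apply: H.
by rewrite /ball /= distrC.
Qed.

(** By polarization: [rcont_comp] composes with functions of one variable, which covers squares, and
    a product is a combination of two squares. *)
Lemma rcontM (phi psi : R -> R[i]) t : rcont phi t -> rcont psi t ->
  rcont (fun s => phi s * psi s) t.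
Proof.
move=> H1 H2; have sq (chi : R -> R[i]) : rcont chi t -> rcont (fun s => chi s * chi s) t.
  by move=> H; apply: rcont_comp H (ccont_mul (ccont_id _) (ccont_id _)).
have -> : (fun s => phi s * psi s) = (fun s => 4^-1 * ((phi s + psi s) * (phi s + psi s) +
    (-1) * ((phi s + (-1) * psi s) * (phi s + (-1) * psi s)))).
  by apply/funext => s; field.
apply/rcontZ/rcontD; first exact/sq/rcontD.
by apply/rcontZ/sq/rcontD => //; exact: rcontZ.
Qed.

Lemma rcont_lexp z t : rcont (lexp z) t.
Proof. exact: rcont_comp (rcont_horiz 0 t) (lexp_ccont _ _). Qed.

(** For z <> 0 a primitive is - exp(-z t) / z; the completed value of [expq] at 0 settles z = 0. *)
Lemma Cint_lexp (a b : R) z : a <= b -> Cint a b (lexp z) = expq b z - expq a z.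
Proof.
rewrite le_eqVlt => /orP[/eqP ->|ab]; first by rewrite Cint_pt subrr.
rewrite /expq; case: eqVneq => [->|zn].
  have -> : b%:C%C - a%:C%C = (b - a)%:C%C by rewrite rmorphB.
  rewrite -[RHS]mul1r -Cint_cst; last exact: ltW.
  by apply: eq_Cint => t _; rewrite /lexp mul0r oppr0 cexp0.
pose F (v : R[i]) := - z^-1 * cexp (- (z * v)).
have dF t : cdiff F (t +i* 0)%C (lexp z t).
  have := cdiffM (cdiff_cst (- z^-1) (t +i* 0)%C) (cdiff_comp (cdiffN (cdiffM
    (cdiff_cst z (t +i* 0)%C) (cdiff_id _))) (cdiff_cexp _)).
  rewrite /lexp; congr (cdiff _ _ _); by field.
have Re_ := integral_derive ab (fun x _ => (is_derive_line (dF x)).1)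
  (fun x _ => rcont_Re (rcont_lexp z x)).
have Im_ := integral_derive ab (fun x _ => (is_derive_line (dF x)).2)
  (fun x _ => rcont_Im (rcont_lexp z x)).
have -> : Cint a b (lexp z) = F (b%:C)%C - F (a%:C)%C.
  by rewrite /Cint /Rintegral Re_ Im_; apply: complex_ext; rewrite ?ReD ?ImD ?ReN ?ImN.
by rewrite /F (mulrC z) (mulrC z); field.
Qed.

(* Locally [g] is nearly constant, so that bisection reduces to [Cint_lexp]. *)
Lemma Cint_C0prop (g : R -> R) (a b : R) : continuous g -> 0 <= a <= b ->
  C0prop (fun z => Cint a b (fun t => (g t)%:C%C * lexp z t)).
Proof.
move=> cg /andP[a0 ab].
have cont z p q : cont_on p q (fun t => (g t)%:C%C * lexp z t).
  by move=> t _; apply: rcontM; [exact: continuous_rcont|exact: rcont_lexp].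
apply: C0prop_limit => e e0.
have k0 : 0 < 2 * (b - a) + 1 by lra.
pose d := e / (2 * (b - a) + 1); have d0 : 0 < d by rewrite divr_gt0.
(* The second interval is a dummy: [rect_ind] is used in one dimension. An error proportional to the
   length adds up under bisection. *)
pose P a' b' (_ _ : R) := 0 <= a' -> a' <= b' -> exists2 h, C0prop h & forall z, 0 < complex.Re z ->
  cabs (Cint a' b' (fun t => (g t)%:C%C * lexp z t) - h z) <= d * (2 * (b' - a')).
have PP : P a b 0 1.
  apply: (@rect_ind R P) => //.
  - move=> a' b' c' d' ab' _ H1 H2 _ _ p0 _.
    have [h1 C1 E1] := H1 p0 ltac:(lra); have [h2 C2 E2] := H2 ltac:(lra) ltac:(lra).
    exists (fun z => h1 z + 1 * h2 z); first exact: C0prop_lin.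
    move=> z z0; rewrite (@Cint_split R ((a' + b') / 2)) //; last by apply/andP; split; lra.
    rewrite mul1r opprD addrACA (le_trans (cabsD _ _)) //.
    rewrite (le_trans (lerD (E1 z z0) (E2 z z0))) // -mulrDr ler_pM2l //; lra.
  - move=> x y /andP[xa xb] _; have [r r0 Hr] := continuous_rcont cg x d0.
    exists (r / 2) => [|a' b' c' d' aa /andP[ax bx] bb _ _ _ hr _ p0 pab].
      by rewrite divr_gt0.
    exists (fun z => 0 + (g x)%:C%C * (expq b' z + (-1) * expq a' z)).
      have z0 : C0prop (fun=> 0 : R[i]).
        by apply: C0prop_ext (C0prop_lin (-1) (expq_C0prop p0) (expq_C0prop p0)) => z _; ring.
      by apply: C0prop_lin z0 (C0prop_lin _ _ _); apply: expq_C0prop; lra.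
    move=> z z0; rewrite add0r mulN1r -Cint_lexp //.
    have cl : cont_on a' b' (lexp z) by move=> t _; exact: rcont_lexp.
    have cc : cont_on a' b' (fun t => (- (g x)%:C%C) * lexp z t).
      by move=> t tt; apply: rcontZ; exact: cl.
    rewrite -mulNr -CintZ // -CintD //.
    rewrite mulrA (mulrC d 2); apply: Cint_bound => //.
      by move=> t tt; apply: rcontD; [exact: cont tt|exact: cc].
    move=> t /andP[ta tb]; rewrite mulNr -mulrBl cabsM (le_trans (ler_piMr (cabs_ge0 _) _)) //.
      by apply: bdd_lexp (ltW z0) _ _; lra.
    by apply: Hr; apply/ltr_normlP; split; lra.
have [h Ch H] := PP a0 ab; exists h => // z z0; rewrite (le_trans (H z z0)) //.
rewrite /d mulrAC ler_pdivrMr // ler_pM2l //; lra.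
Qed.

(** As |exp(-z t)| <= 1, an error in L^1 norm costs at most twice as much in sup norm. The density
    is cut at T and then replaced on [0, T] by a continuous function; each change is below e / 4 in
    L^1. *)
Lemma Dtr_C0prop w : leb.-integrable I0 (EFin \o w) -> C0prop (Dtr w).
Proof.
move=> iw; apply: C0prop_limit => e e0; have e4 : 0 < e / 4 by rewrite divr_gt0.
have [|||||n Hn] := @integral_vanish R _ _ leb I0 (fun n => `]n%:R, +oo[%classic) (fun t => `|w t|)
  _ _ _ (integrable_norm iw) _ _ _ e4.
- by [].
- by move=> n.
- by move=> n t /=; rewrite !in_itv /= !andbT => /ltW; apply: le_trans; rewrite ler0n.
- by [].
- move=> t; rewrite /= in_itv /= andbT => t0; exists (Num.bound t) => n Nn.
  rewrite in_itv /= andbT; apply/negP; rewrite -leNgt ltW //.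
  by rewrite (lt_le_trans (archi_boundP t0)) // ler_nat.
set T : R := n%:R in Hn; set J := `[0%R, T]%classic.
have mJ : measurable J by exact: measurable_itv.
have mJ' : measurable (J : set (measurableTypeR R)) by exact: measurable_itv.
have JI : J `<=` I0 by move=> t /=; rewrite !in_itv /= andbT => /andP[].
have [|||g_ [cg ig ag]] := @approximation_continuous_integrable R J w => //.
- by rewrite /J /= lebesgue_measure_itv /=; case: ifP => _; rewrite ?ltry // -EFinB ltry.
- by apply: integrableS iw.
have [m Hm] : exists m, (\int[leb]_(t in J) `|(w t - g_ m t)%:E| <= (e / 4)%:E)%E.
  move: ag => /fine_cvgP[[N1 _ H1] /cvgrPdist_lt /(_ _ e4)[N2 _ H2]].
  exists (maxn N1 N2); have {}H1 := H1 _ (leq_maxl N1 N2); have {}H2 := H2 _ (leq_maxr N1 N2).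
  move: H1 H2; rewrite /= sub0r normrN => H1 H2.
  by rewrite -(fineK H1) lee_fin (le_trans (ler_norm _)) // ltW.
set g := g_ m in Hm; exists (fun z => Cint 0 T (fun t => (g t)%:C%C * lexp z t)).
  by apply: Cint_C0prop; [exact: cg|rewrite lexx ler0n].
move=> z z0; rewrite -Dtr_restrict; set v := fun t => g t * _.
have iv : leb.-integrable I0 (EFin \o v).
  apply: (@integrableS _ _ _ leb setT) => //.
  have -> : EFin \o v = (EFin \o g) \_ J.
    apply/funext => t; rewrite patchE /= /v indicE.
    by case: ifPn => _; rewrite ?mulr1 ?mulr0.
  by rewrite -integrable_mkcond //; exact: ig.
pose w1 t := w t * \1_J t.
have iw1 : leb.-integrable I0 (EFin \o w1).
  apply: integrable_mul_bounded => // t _.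
  by rewrite indicE ger0_norm //; case: (_ \in _).
have z0' := ltW z0.
have B (p q : R -> R) : leb.-integrable I0 (EFin \o p) -> leb.-integrable I0 (EFin \o q) ->
    leb.-integrable I0 (EFin \o (fun t => p t + -1 * q t)).
  move=> ip iq; have -> : (fun t => p t + -1 * q t) = (fun t => p t - q t).
    by apply/funext => t; rewrite mulN1r.
  by have := fun mI => @integrableB _ _ _ leb I0 mI _ _ ip iq; apply.
have e1 : cabs (Dtr (fun t => w t + -1 * w1 t) z) <= 2 * (e / 4).
  apply: (@Dtr_bound _ `]T, +oo[%classic) => //; first last.
  - move: Hn => /ltW; apply: le_trans; rewrite le_eqVlt; apply/orP; left; apply/eqP.
    apply: eq_integral => t; rewrite inE /= in_itv /= andbT => Tt; rewrite /w1 indicE memNset.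
      by rewrite !mulr0 addr0.
    by rewrite /J /= in_itv /= => /andP[_]; rewrite leNgt Tt.
  - move=> t; rewrite /= !in_itv /= !andbT => t0 /negP; rewrite -leNgt => tT.
    rewrite /w1 indicE mem_set ?mulr1 ?mulN1r ?subrr //.
    by rewrite /J /= in_itv /= t0.
  - exact: B.
  - by move=> t; rewrite /= !in_itv /= !andbT => /ltW; apply: le_trans; rewrite ler0n.
have e2 : cabs (Dtr (fun t => w1 t + -1 * v t) z) <= 2 * (e / 4).
  apply: (@Dtr_bound _ J) => //; first last.
  - move: Hm; apply: le_trans; rewrite le_eqVlt; apply/orP; left; apply/eqP.
    apply: eq_integral => t tJ; rewrite /w1 /v indicE tJ.
    by rewrite !mulr1 mulN1r.
  - move=> t _ nJ; rewrite /w1 /v indicE memNset // !mulr0 addr0 //.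
  - exact: B.
have -> : Dtr w z - Dtr v z = Dtr (fun t => w t + -1 * w1 t) z + Dtr (fun t => w1 t + -1 * v t) z.
  rewrite !Dtr_lin //; have -> : (-1)%:C%C = -1 :> R[i] by rewrite rmorphN rmorph1.
  ring.
rewrite (le_trans (cabsD _ _)) //; lra.
Qed.

End DensityTransform.

(** * Absolutely continuous measures and their densities *)

Section AbsolutelyContinuousMeasures.
Variable R : realType.
Implicit Types (w f : R -> R) (z : R[i]).
Local Notation I0 := (`[0%R, +oo[%classic : set R).
Local Notation leb := (@lebesgue_measure R).
Local Notation fmeas := ({finite_measure set R -> \bar R}).

Section Display.
Variable nu : {finite_measure set (measurableTypeR R) -> \bar R}.

(* Lebesgue measure lives on [measurableTypeR R], which differs from [R] only by
   its display. *)
Definition toR (A : set R) : \bar R := nu A.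

Let toR0 : toR set0 = 0%E. Proof. exact: measure0. Qed.

Let toR_ge0 A : (0 <= toR A)%E. Proof. exact: measure_ge0. Qed.

Let toR_sigma_additive : semi_sigma_additive toR.
Proof. exact: (@measure_semi_sigma_additive _ _ _ nu). Qed.

HB.instance Definition _ := isMeasure.Build _ _ _ toR toR0 toR_ge0 toR_sigma_additive.

Let toR_fin : fin_num_fun toR. Proof. exact: (fin_num_measure nu). Qed.

HB.instance Definition _ := @Measure_isFinite.Build _ _ _ toR toR_fin.

Lemma integral_toR (D : set R) f : measurable D -> measurable_fun setT f ->
  nu.-integrable D (EFin \o f) ->
  (\int[toR]_(x in D) (f x)%:E = \int[nu]_(x in D) (f x)%:E)%E.
Proof.
move=> mD mf If.
have mid : measurable_fun [set: measurableTypeR R] (fun x : measurableTypeR R => x : R).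
  by move=> _ A mA; rewrite setTI.
have := @integral_pushforward _ _ _ _ R _ mid nu D (EFin \o f) _ If mD.
by apply; exact/measurable_EFinP.
Qed.

End Display.

Lemma density_measure w : (forall t, 0 <= w t) -> measurable_fun setT w ->
  leb.-integrable setT (EFin \o w) ->
  exists2 nu : fmeas, forall A, measurable A -> nu A = (\int[leb]_(t in A) (w t)%:E)%E &
    forall z, 0 <= complex.Re z -> lapR nu z = Dtr w z.
Proof.
move=> w0 mw iw.
have mw' : measurable_fun [set: measurableTypeR R] w by [].
exists (toR (dens mw' w0 iw)) => // z z0.
have [[m1 m2] b] := (cmeasf_lexp z, bdd_lexp z0).
have H (f : R -> R) : measurable_fun setT f -> (forall t, 0 <= t -> `|f t| <= 1) ->
    Rintegral (toR (dens mw' w0 iw)) I0 f = Rintegral leb I0 (fun t => w t * f t).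
  move=> mf f1.
  have If : (dens mw' w0 iw).-integrable I0 (EFin \o f).
    apply: measurable_bounded_integrable => //.
    - by rewrite ltey_eq fin_num_measure.
    - exact: measurable_funTS.
    - exists 1; split; first by rewrite num_real.
      move=> y y1 t /=; rewrite in_itv /= andbT => t0.
      by rewrite (le_trans (f1 t t0)) // ltW.
  rewrite /Rintegral integral_toR // integral_dens //; congr fine.
  by apply: eq_integral => t _; rewrite /= -EFinM mulrC.
rewrite lapR_Lint // /Lint /Dtr; congr (_ +i* _)%C; apply: H => // t t0;
  apply: le_trans (b t t0); [exact: cabs_Re|exact: cabs_Im].
Qed.

(** A [cmeas] is made of positive measures, so a real density enters through its positive and
    negative parts. *)
Lemma signed_density f : measurable_fun setT f -> leb.-integrable setT (EFin \o f) ->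
  exists nu nu' : fmeas,
  [/\ forall A, measurable A -> fine (nu A) - fine (nu' A) = Rintegral leb A f,
      forall z, 0 <= complex.Re z -> lapR nu z - lapR nu' z = Dtr f z &
      (forall t, t < 0 -> f t = 0) -> nu `]-oo, 0%R[ = 0%E /\ nu' `]-oo, 0%R[ = 0%E].
Proof.
move=> mf If.
pose p t := Num.max (f t) 0; pose q t := Num.max (- f t) 0.
have pq t : f t = p t + -1 * q t.
  by rewrite /p /q; case: (leP (f t) 0); case: (leP (- f t) 0); lra.
have p0 t : 0 <= p t by rewrite le_max lexx orbT.
have q0 t : 0 <= q t by rewrite le_max lexx orbT.
have mp : measurable_fun setT p by apply: measurable_maxr.
have mq : measurable_fun setT q.
  by apply: measurable_maxr => //; apply: measurableT_comp.
have ip : leb.-integrable setT (EFin \o p).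
  apply: le_integrable If => //; first exact/measurable_EFinP.
  move=> t _; rewrite /= lee_fin ger0_norm // /p ge_max normr_ge0 andbT; exact: ler_norm.
have iq : leb.-integrable setT (EFin \o q).
  apply: le_integrable If => //; first exact/measurable_EFinP.
  by move=> t _; rewrite /= lee_fin ger0_norm // /q ge_max normr_ge0 andbT -normrN ler_norm.
have [nu nuE nuL] := density_measure p0 mp ip.
have [nu' nuE' nuL'] := density_measure q0 mq iq.
exists nu, nu'; split.
- move=> A mA; rewrite nuE // nuE' // -RintegralB //; last 2 first.
  + exact: integrableS ip.
  + exact: integrableS iq.
  by apply: eq_Rintegral => t _; rewrite [RHS]pq mulN1r.
- move=> z z0; rewrite nuL // nuL' // -mulN1r.
  have -> : -1 = (-1)%:C%C :> R[i] by rewrite rmorphN rmorph1.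
  rewrite -Dtr_lin //; [|exact: integrableS ip|exact: integrableS iq].
  by congr (Dtr _ z); apply/funext => t; rewrite -pq.
- move=> f0; split.
    rewrite nuE //; apply: integral0_eq => t; rewrite /= in_itv /= => /f0 ft.
    by rewrite /p ft maxxx.
  rewrite nuE' //; apply: integral0_eq => t; rewrite /= in_itv /= => /f0 ft.
  by rewrite /q ft oppr0 maxxx.
Qed.

(** Rearranged as m1 + n2 = n1 + m2, the hypothesis is an identity of positive measures, against
    which bounded functions can be integrated. *)
Lemma lapR_signed (m1 m2 n1 n2 : fmeas) z :
  (forall A, measurable A -> fine (m1 A) - fine (m2 A) = fine (n1 A) - fine (n2 A)) ->
  0 <= complex.Re z -> lapR m1 z - lapR m2 z = lapR n1 z - lapR n2 z.
Proof.
move=> H z0; have [[mR mI] b] := (cmeasf_lexp z, bdd_lexp z0).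
have E A : measurable A -> (measure_add m1 n2 A = measure_add n1 m2 A)%E.
  move=> mA; rewrite !measure_addE /=.
  rewrite -(fineK (fin_num_measure m1 _ mA)) -(fineK (fin_num_measure n2 _ mA)).
  rewrite -(fineK (fin_num_measure n1 _ mA)) -(fineK (fin_num_measure m2 _ mA)) -!EFinD.
  by congr (_%:E); have := H A mA; lra.
have F (m n : fmeas) (g : R -> R) : measurable_fun setT g -> (forall t, 0 <= t -> `|g t| <= 1) ->
    fine (\int[measure_add m n]_(t in I0) (g t)%:E) = Rintegral m I0 g + Rintegral n I0 g.
  move=> mg g1; have [i1 i2] := (bounded_int m mg g1, bounded_int n mg g1).
  rewrite integral_measure_add //.
  by rewrite fineD //; exact: integrable_fin_num.
have G (g : R -> R) : measurable_fun setT g -> (forall t, 0 <= t -> `|g t| <= 1) ->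
    Rintegral m1 I0 g - Rintegral m2 I0 g = Rintegral n1 I0 g - Rintegral n2 I0 g.
  move=> mg g1; have := F n1 m2 g mg g1; have := F m1 n2 g mg g1.
  rewrite (eq_measure_integral (measure_add n1 m2)); last by move=> A mA _; exact: E.
  by move=> ->; lra.
rewrite !lapR_Lint // /Lint; apply: complex_ext; rewrite ?ReD ?ImD ?ReN ?ImN /=; apply: G => // t t0;
  apply: le_trans (b t t0); [exact: (cabs_Re (lexp z t))|exact: (cabs_Im (lexp z t))].
Qed.

Section Difference.
Variables m1 m2 : fmeas.

Let chargeR := cadd (charge_of_finite_measure m1) (cscale (-1) (charge_of_finite_measure m2)).

(** Absolute continuity concerns the difference of the two parts, not each of them, so the
    Radon-Nikodym theorem is applied to a charge. It is stated on [measurableTypeR R], where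
    Lebesgue measure lives. *)
Definition diff_charge (A : set (measurableTypeR R)) : \bar R := chargeR A.

Let diff_charge0 : diff_charge set0 = 0%E. Proof. exact: charge0. Qed.

Let diff_charge_fin A : measurable A -> diff_charge A \is a fin_num.
Proof. exact: (fin_num_measure chargeR). Qed.

Let diff_charge_sigma_additive : semi_sigma_additive diff_charge.
Proof. exact: (@charge_semi_sigma_additive _ _ _ chargeR). Qed.

HB.instance Definition _ := isCharge.Build _ _ _ diff_charge
  diff_charge0 diff_charge_fin diff_charge_sigma_additive.

Lemma diff_chargeE A : measurable A -> diff_charge A = (fine (m1 A) - fine (m2 A))%:E.
Proof.
move=> mA; rewrite /diff_charge /chargeR /cadd /= cscaleN1 EFinB !fineK ?fin_num_measure //.
Qed.

Lemma ac_density :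
  (forall A, measurable A -> leb A = 0%E -> fine (m1 A) - fine (m2 A) = 0) ->
  exists f, [/\ measurable_fun setT f, leb.-integrable setT (EFin \o f) &
    forall z, 0 <= complex.Re z -> lapR m1 z - lapR m2 z = Dtr f z].
Proof.
move=> ac; have dom : diff_charge `<< leb.
  by apply/null_content_dominatesP => A mA A0; rewrite diff_chargeE // ac.
pose f t := fine (Radon_Nikodym diff_charge leb t).
have fE : EFin \o f = Radon_Nikodym diff_charge leb.
  by apply/funext => t; rewrite /= fineK //; exact: Radon_Nikodym_fin_num.
have If : leb.-integrable setT (EFin \o f) by rewrite fE; exact: Radon_Nikodym_integrable.
have mf : measurable_fun setT f by have /measurable_EFinP := measurable_int _ If.
exists f; split => // z z0.
have [nu [nu' [nuE nuL _]]] := signed_density mf If.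
rewrite -nuL //; apply: lapR_signed => // A mA; rewrite nuE // /Rintegral.
have -> : (\int[leb]_(t in A) (f t)%:E = diff_charge A)%E.
  by rewrite (Radon_Nikodym_integral dom) // -fE.
by rewrite diff_chargeE.
Qed.

End Difference.

Lemma LL1_density mu : Mac mu -> exists f1 f2,
  [/\ measurable_fun setT f1 /\ leb.-integrable setT (EFin \o f1),
      measurable_fun setT f2 /\ leb.-integrable setT (EFin \o f2) &
      forall z, 0 <= complex.Re z -> lap mu z = Dtr f1 z + 'i%C * Dtr f2 z].
Proof.
move=> ac.
have [|f1 [m1 i1 E1]] := @ac_density (cm1 mu) (cm2 mu).
  by move=> A mA A0; have := ac A mA A0 => /(congr1 (@complex.Re R)).
have [|f2 [m2 i2 E2]] := @ac_density (cm3 mu) (cm4 mu).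
  by move=> A mA A0; have := ac A mA A0 => /(congr1 (@complex.Im R)).
by exists f1, f2; split => // z z0; rewrite /lap E1 // E2.
Qed.

Lemma density_LL1 f1 f2 :
  measurable_fun setT f1 -> leb.-integrable setT (EFin \o f1) ->
  measurable_fun setT f2 -> leb.-integrable setT (EFin \o f2) ->
  exists2 h, LL1 R h & forall z, 0 < complex.Re z -> h z = Dtr f1 z + 'i%C * Dtr f2 z.
Proof.
have K f : measurable_fun setT f -> leb.-integrable setT (EFin \o f) ->
    exists nu nu' : fmeas,
    [/\ forall A, measurable A -> leb A = 0%E -> fine (nu A) - fine (nu' A) = 0,
      forall z, 0 <= complex.Re z -> lapR nu z - lapR nu' z = Dtr f z &
      nu `]-oo, 0%R[ = 0%E /\ nu' `]-oo, 0%R[ = 0%E].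
  (* Cutting the density to [0, +oo) does not change its transform and makes the measure live on the
     half-line. *)
  move=> mf If; pose g t := f t * \1_I0 t.
  have mg : measurable_fun setT g by apply: measurable_funM.
  have Ig : leb.-integrable setT (EFin \o g).
    have -> : EFin \o g = (EFin \o f) \_ I0.
      apply/funext => t; rewrite patchE /= /g indicE.
      by case: ifPn => _; rewrite ?mulr1 ?mulr0.
    by rewrite -integrable_mkcond //; exact: integrableS If.
  have [nu [nu' [nuE nuL nu0]]] := signed_density mg Ig; exists nu, nu'; split.
  - move=> A mA A0; rewrite nuE // /Rintegral null_set_integral //.
    by apply/measurable_funTS/measurableT_comp.
  - move=> z z0; rewrite nuL // /Dtr; congr (_ +i* _)%C; apply: eq_Rintegral => t tI;
      by rewrite /g indicE tI mulr1.
  - apply: nu0 => t t0; rewrite /g indicE memNset ?mulr0 //= in_itv /= andbT.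
    by apply/negP; rewrite -ltNge.
move=> mf1 If1 mf2 If2; have [n1 [n2 [a1 T1 [s1 s2]]]] := K _ mf1 If1.
have [n3 [n4 [a2 T2 [s3 s4]]]] := K _ mf2 If2.
exists (lap (CMeas n1 n2 n3 n4)).
  exists (CMeas n1 n2 n3 n4); split => // A mA A0.
  by rewrite /cmval /= a1 // a2.
by move=> z z0; rewrite /lap /= T1 ?T2 // ltW.
Qed.

End AbsolutelyContinuousMeasures.

(** * Combinations and resolvents among the transforms of L^1 *)

Section LL1Space.
Variable R : realType.
Local Notation leb := (@lebesgue_measure R).

Lemma LL1_C0prop g : LL1 R g -> C0prop g.
Proof.
move=> [mu [_ ac ->]]; have [f1 [f2 [[_ i1] [_ i2] E]]] := LL1_density ac.
apply: C0prop_ext (C0prop_lin 'i%C (Dtr_C0prop (integrableS _ _ _ i1))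
  (Dtr_C0prop (integrableS _ _ _ i2))) => // z z0.
by rewrite E // ltW.
Qed.

(** The combination is formed on the densities: with c = x + i y the new real and imaginary
    densities are f1 + x h1 - y h2 and f2 + x h2 + y h1. *)
Lemma LL1_lin : lin_stable (LL1 R).
Proof.
move=> [x y] g1 g2 [mu [_ ac ->]] [mu' [_ ac' ->]].
have [f1 [f2 [[m1 i1] [m2 i2] E]]] := LL1_density ac.
have [h1 [h2 [[n1 j1] [n2 j2] E']]] := LL1_density ac'.
have ml (r : R) (f h : R -> R) : measurable_fun setT f -> measurable_fun setT h ->
    measurable_fun setT (fun t : R => f t + r * h t).
  by move=> mf mh; apply: measurable_funD => //; apply: measurable_funM.
have il (r : R) (f h : R -> R) : leb.-integrable setT (EFin \o f) ->
    leb.-integrable setT (EFin \o h) -> leb.-integrable setT (EFin \o (fun t => f t + r * h t)).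
  move=> If Ih; have Z := fun mI => @integrableZl _ _ _ leb setT mI r _ Ih.
  by have := fun mI => @integrableD _ _ _ leb setT mI _ _ If (Z mI); apply.
have S (f : R -> R) : leb.-integrable setT (EFin \o f) ->
  leb.-integrable `[0%R, +oo[ (EFin \o f) by exact: integrableS.
have [h Lh hE] := density_LL1 (ml (- y) _ _ (ml x _ _ m1 n1) n2)
  (il (- y) _ _ (il x _ _ i1 j1) j2) (ml y _ _ (ml x _ _ m2 n2) n1)
  (il y _ _ (il x _ _ i2 j2) j1).
exists h => // z z0; have z0' := ltW z0.
rewrite hE // E // E' // !Dtr_lin //; do ?[exact: S | exact/S/il].
have -> : (x +i* y)%C = x%:C%C + 'i%C * y%:C%C :> R[i] by apply: complex_ext; rewrite /=; ring.
have i2E : 'i%C * 'i%C = -1 :> R[i] by rewrite -expr2 sqr_i.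
have -> : (- y)%:C%C = - y%:C%C :> R[i] by rewrite rmorphN.
move: (Dtr f1 z) (Dtr f2 z) (Dtr h1 z) (Dtr h2 z) (x%:C%C) (y%:C%C) => a b c d p q.
have -> : (p + 'i%C * q) * (c + 'i%C * d) =
    p * c + 'i%C * (p * d + q * c) + ('i%C * 'i%C) * (q * d) by ring.
rewrite i2E; ring.
Qed.

Lemma LL1_resolvents : approx_resolvents (LL1 R).
Proof.
move=> l e l0 e0; have [T T0 HT] := expq_resolvent l0 e0.
(* The density exp(-l t) on [0, T] has the transform [expq T (z + l)], the entire approximation of
   the resolvent. *)
pose f t : R := expR (- (l * t)); pose g t := f t * \1_`[0%R, T] t.
have mg : measurable_fun setT g.
  by apply: measurable_funM => //; exact: measurable_expN.
have Ig : leb.-integrable setT (EFin \o g).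
  have -> : EFin \o g = (EFin \o f) \_ `[0%R, T].
    apply/funext => t; rewrite patchE /= /g indicE.
    by case: ifPn => _; rewrite ?mulr1 ?mulr0.
  rewrite -integrable_mkcond //.
  apply: continuous_compact_integrable; first exact: segment_compact.
  apply: continuous_subspaceT => t; apply: continuous_comp; last exact: continuous_expR.
  by apply: cvgN; apply: cvgM; [exact: cvg_cst|exact: cvg_id].
have m0 : measurable_fun setT (fun _ : R => 0 : R) by [].
have i0 : leb.-integrable setT (EFin \o (fun _ : R => 0 : R)) by exact: integrable0.
have [h Lh hE] := density_LL1 mg Ig m0 i0.
exists h => // z z0; rewrite hE //.
have -> : Dtr (fun=> 0) z = 0.
  by rewrite /Dtr /Rintegral !integral0_eq // => t _; rewrite mul0r.
rewrite mulr0 addr0 Dtr_restrict (_ : Cint _ _ _ = expq T (z + l%:C%C)); first exact: HT.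
(* [expq 0] vanishes, which gives the difference the form that [Cint_lexp] produces on [0, T]. *)
have -> : expq T (z + l%:C%C) = expq T (z + l%:C%C) - expq 0 (z + l%:C%C).
  rewrite {3}/expq; case: ifP => _; first by rewrite subr0.
  by rewrite mul0r oppr0 cexp0 subrr mul0r subr0.
rewrite -Cint_lexp //; apply: eq_Cint => t _.
rewrite /lexp mulrDl opprD cexpD mulrC; congr (_ * _); apply: complex_ext;
  by rewrite /= !(mul0r, mulr0, subr0, addr0) oppr0 ?cos0 ?sin0 ?mulr1 ?mulr0.
Qed.

End LL1Space.

Theorem mainTheorem7 (R : realType) :
  (forall Y : set (R[i] -> R[i]),
     Y = LM R \/ Y = LL1 R \/ Y = LMd R \/ Y = LMs R \/ Y = R0 R \/ Y = J0 R ->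
     closB Y = closInf Y) /\
  (forall Y : set (R[i] -> R[i]),
     Y = LL1 R \/ Y = R0 R \/ Y = J0 R ->
     closB Y = [set f | Bspace f /\ C0cl f]).
Proof.
(* This covers [R0] and [J0], whose elements tend to 0 at infinity. Transforms of general measures
   need not do so, and the four spaces of transforms go through [LN_closB] and the weights. *)
have dense (Y : set (R[i] -> R[i])) : (forall g, Y g -> C0prop g) -> (forall g, Y g -> holo g) ->
    lin_stable Y -> shift_stable Y -> closB Y = closInf Y.
  move=> Yc Yh Yl Ys; apply: closB_eq_closInf => // g Yg.
    by have [M H] := C0prop_bounded (Yc g Yg); exists M.
  by apply: stable_shift_diff => //; exact: Yc.
have eR0 := dense _ (@R0_C0prop R) (@R0_holo R) (@R0_lin R) (@R0_shift R).
have eJ0 := dense _ (@J0_C0prop R) (@J0_holo R) (@J0_lin R) (@J0_shift R).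
have eL1 := LN_closB (@weight_stable_ac R).
split=> Y.
- move=> [->|[->|[->|[->|[->|->]]]]] //.
  + exact: LN_closB (@weight_stable_all R).
  + exact: LN_closB (@weight_stable_disc R).
  + exact: LN_closB (@weight_stable_sing R).
- move=> [->|[->|->]].
  + exact: closB_C0 eL1 (@LL1_C0prop R) (@LL1_lin R) (@LL1_resolvents R).
  + exact: closB_C0 eR0 (@R0_C0prop R) (@R0_lin R) (@R0_resolvents R).
  + exact: closB_C0 eJ0 (@J0_C0prop R) (@J0_lin R) (@J0_resolvents R).
Qed.
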